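(* Let $-1\le B<A\le1$ and let $f\in\mathcal{C}(A,B)$. Then the logarithmic coefficients $\gamma_n$ of $f$ satisfy $$\sum_{n=1}^{\infty}n^2|\gamma_n|^2\le\frac14\sum_{n=1}^{\infty}|E_n|^2$$ and, for every real $t\le2$, $$\sum_{n=1}^{\infty}(n+1)^t|\gamma_n|^2\le\frac14\sum_{n=1}^{\infty}\frac{(n+1)^t}{n^2}|E_n|^2,$$ where the coefficients $E_n$ are defined by $$\psi_{A,B}(z)=\frac{zK_{A,B}'(z)}{K_{A,B}(z)}=1+\sum_{n=1}^{\infty}E_nz^n,\qquad K_{A,B}(z)=\begin{cases}\dfrac1A\left((1+Bz)^{A/B}-1\right), & A\ne0,\ B\ne0,\\[2mm] \dfrac1B\log(1+Bz), & A=0,\\[2mm] \dfrac1A\left(e^{Az}-1\right), & B=0.\end{cases}$$ Moreover, the first inequality is sharp, i.e. equality holds for some function in $\mathcal{C}(A,B)$.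
   Context: $\mathbb{D}=\{z\in\mathbb{C}:|z|<1\}$; $\mathcal{A}$ is the class of analytic functions $f$ on $\mathbb{D}$ with $f(0)=0$, $f'(0)=1$. For analytic $F,G$ on $\mathbb{D}$, $F\prec G$ (subordination) means $F=G\circ\omega$ for some analytic $\omega:\mathbb{D}\to\mathbb{D}$ with $\omega(0)=0$. For $-1\le B<A\le1$, $\mathcal{C}(A,B)$ (Janowski convex functions) is the class of $f\in\mathcal{A}$ with $1+\frac{zf''(z)}{f'(z)}\prec\frac{1+Az}{1+Bz}$. The logarithmic coefficients $\gamma_n$ of $f$ are defined by the expansion about the origin $\log\frac{f(z)}{z}=2\sum_{n=1}^{\infty}\gamma_nz^n$, with the branch of the logarithm vanishing at $z=0$. Powers and logarithms of $1+Bz$ are principal branches. Series of nonnegative terms take values in $[0,+\infty]$. *)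

(* Defs.v *)
From Stdlib Require Import Reals.
From Coquelicot Require Import Coquelicot.

Open Scope R_scope.

Definition disc (z : C) : Prop := Cmod z < 1.

(* [C_NormedModule] is forced so that [ex_derive] is complex differentiability;
   by Cauchy's theory this is analyticity on the open disc.  Coquelicot's total
   operator [C_derive] agrees with the complex derivative wherever [ex_derive]
   holds. *)
Definition analytic_disc (f : C -> C) : Prop :=
  forall z : C, disc z -> @ex_derive C_AbsRing C_NormedModule f z.

Definition classA (f : C -> C) : Prop :=
  analytic_disc f /\ f (RtoC 0) = RtoC 0 /\ C_derive f (RtoC 0) = RtoC 1.

Definition subordinate (F G : C -> C) : Prop :=
  analytic_disc F /\ analytic_disc G /\
  exists w : C -> C,
    analytic_disc w /\ (forall z, disc z -> disc (w z)) /\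
    w (RtoC 0) = RtoC 0 /\
    forall z, disc z -> F z = G (w z).

(* A zero z0 of f' in the disc, z0 <> 0, is excluded by the analyticity required
   in [subordinate]: z f''(z) / f'(z) would be unbounded near z0. *)
Definition janowski_convex (A B : R) (f : C -> C) : Prop :=
  classA f /\
  subordinate
    (fun z => 1 + z * C_derive (C_derive f) z / C_derive f z)%C
    (fun z => (1 + A * z) / (1 + B * z))%C.

Definition Cexp (z : C) : C :=
  (exp (Re z) * cos (Im z), exp (Re z) * sin (Im z)).

(* Principal argument, in (-PI, PI] for z <> 0. *)
Definition Carg (z : C) : R :=
  if Rle_dec 0 (Im z) then acos (Re z / Cmod z) else - acos (Re z / Cmod z).

Definition Clog (z : C) : C := (ln (Cmod z), Carg z).

Definition Cpower (z a : C) : C := Cexp (a * Clog z)%C.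

Definition has_expansion (a : nat -> C) (z l : C) : Prop :=
  @is_pseries C_AbsRing C_NormedModule a z l.

(* g is the branch of log (f(z)/z) near 0 that vanishes at 0. *)
Definition is_log_ratio (f g : C -> C) : Prop :=
  g (RtoC 0) = RtoC 0 /\
  locally (RtoC 0) (@ex_derive C_AbsRing C_NormedModule g) /\
  locally' (RtoC 0) (fun z : C => Cexp (g z) = (f z / z)%C).

(* Only gam n with n >= 1 is constrained. *)
Definition log_coefficients (f : C -> C) (gam : nat -> C) : Prop :=
  exists g : C -> C,
    is_log_ratio f g /\
    locally (RtoC 0) (fun z : C =>
      has_expansion
        (fun n => match n with O => RtoC 0 | S _ => (2 * gam n)%C end)
        z (g z)).

(* The case A = B = 0 does not occur under B < A. *)
Definition janowski_K (A B : R) (z : C) : C :=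
  if Req_dec_T A 0 then (/ B * Clog (1 + B * z))%C
  else if Req_dec_T B 0 then (/ A * (Cexp (A * z) - 1))%C
  else (/ A * (Cpower (1 + B * z) (RtoC (A / B)) - 1))%C.

Definition janowski_psi (A B : R) (z : C) : C :=
  (z * C_derive (janowski_K A B) z / janowski_K A B z)%C.

(* The expansion is asked on a punctured neighbourhood of 0, where the quotient
   z K'(z) / K(z) makes sense; only E n with n >= 1 is constrained. *)
Definition psi_coefficients (A B : R) (E : nat -> C) : Prop :=
  locally' (RtoC 0) (fun z : C =>
    has_expansion
      (fun n => match n with O => RtoC 1 | S _ => E n end)
      z (janowski_psi A B z)).

(* Sum over n >= 1 of nonnegative terms: the partial sums are nondecreasing, so
   [Lim_seq] is their limit in [0, +oo]. *)
Definition sum_from1 (a : nat -> R) : Rbar :=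
  Lim_seq (fun N => sum_n_m a 1 N).

(* Main.v *)
Require Import Defs.
From Stdlib Require Import Reals.
From Coquelicot Require Import Coquelicot.
From Stdlib Require Import Lra Lia Wf_nat Classical ClassicalEpsilon FunctionalExtensionality.

(** Let [D = A - B], [h(z) = (1 + Az) / (1 + Bz)] and [q = z K'/K]. The numbers [2 n gam_n]
    are the Taylor coefficients of [z f'/f - 1] and the [E_n] those of [q - 1], so the
    inequalities compare the coefficients of two functions. They follow from the
    subordination [z f'/f = q o om] with [om] holomorphic and [|om(z)| <= |z|]. Rogosinski's
    inequality [rogosinski] turns it into [sum_(k<=n) |2 k gam_k|^2 <= sum_(k<=n) |E_k|^2]
    for every [n]; this is the first inequality, and summation by parts against the weights
    [(n+1)^t / n^2], which do not increase when [t <= 2], gives the second one. The function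
    [K] belongs to the class, and for [f = K] all coefficients agree.

    For the subordination it is better to use the reciprocals [P = f / (z f')] and [Q = K /
    (z K')], for they satisfy linear equations: [z P' = 1 - h(w) P] and [z Q' = 1 - h Q],
    where [w] is the Schwarz function given with [f]. Put [om = Q^(-1) o P]. If [|om(z)| <=
    |z|] fails, then by the lemma of Jack it fails at a point where in addition [z om' = m
    om] with a real [m >= 1]. There the two equations express [h(om)] as a convex
    combination of [q(om)] and [h(w(z))]. But [h] maps discs around [0] to discs or
    half-planes, [q(om)] lies in the closed disc [h(|.| <= |om|)], and [h(w(z))] lies in its
    interior because [|w(z)| <= |z| < |om|]; so [h(om)] would lie in the interior too,
    although it is a boundary point ([janowski_subordination]). That [q(z)] lies in [h(|.|
    <= |z|)] is shown in the same way, with the Moebius map [h^(-1)] in the place of the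
    inverse of [q] ([Qfun_bound]). Both are instances of [subordination_principle], which
    also yields that the composition is defined on the whole disc, by continuity in the
    radius.

    The inverse of [Q] exists because [Q] is injective ([Qfun_inj]). In the coordinate [x =
    X(z) = log(1 + Bz) / B] the unit disc lies in the strip [|Im x| < pi/2], and [dQ/dx = (1
    + Bz) Q'(z)] is [-D] times the integral over [0 <= t <= 1] of [t exp(B x - (A + B)
    X(tz))]. As [Im X(tz)] lies between [0] and [Im x], and [|A|, |B| <= 1], the exponent
    has imaginary part in [(-pi/2, pi/2)]. So [dQ/dx] has negative real part on a convex
    set, and [Q] is injective there.

    The function theory used is derived from Goursat's theorem [goursat_cone]: Taylor
    expansions ([cauchy_taylor]), holomorphy of derivatives ([holo_C_derive]) and of
    difference quotients ([holo_divz]), the maximum principle ([max_principle]), inverses of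
    injective maps ([disc_inv_cder]) and the lemma of Jack ([jack_lemma]). *)

Open Scope R_scope.
Set Bullet Behavior "Strict Subproofs".

(** * Complex derivatives *)

Lemma locally_eps (z : C) (P : C -> Prop) :
  locally z P <-> exists d, 0 < d /\ forall y : C, Cmod (y - z) < d -> P y.
Proof.
  rewrite locally_C; split.
  - intros [d Hd]; exists d; split; [apply cond_pos|]; intros y Hy; apply Hd; exact Hy.
  - intros [d [Hd H]]; exists (mkposreal d Hd); intros y Hy; apply H; exact Hy.
Qed.

Lemma locally'_eps (z : C) (P : C -> Prop) :
  locally' z P <-> exists d, 0 < d /\ forall y : C, Cmod (y - z) < d -> y <> z -> P y.
Proof. unfold locally', within. rewrite locally_eps. reflexivity. Qed.

(** Complex differentiability in the sense of [analytic_disc], with named derivative. *)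
Definition cder (f : C -> C) (z l : C) : Prop :=
  @is_derive C_AbsRing C_NormedModule f z l.

Lemma cder_eps (f : C -> C) (z l : C) :
  cder f z l <->
  forall e, 0 < e -> exists d, 0 < d /\ forall y : C, Cmod (y - z) < d ->
    Cmod (f y - f z - l * (y - z)) <= e * Cmod (y - z).
Proof.
  split.
  - intros [_ H] e He.
    destruct (H z (fun P HP => HP) (mkposreal e He)) as [d Hd].
    exists d; split; [apply cond_pos|]. intros y Hy.
    specialize (Hd y Hy). simpl in Hd.
    replace (l * (y - z))%C with (scal (y - z)%C l) by (apply Cmult_comm).
    exact Hd.
  - intros H; split.
    + apply @is_linear_scal_l.
    + intros x Hx e.
      assert (Hxz : z = x).
      { apply (@is_filter_lim_locally_unique C_AbsRing (AbsRing_NormedModule C_AbsRing)).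
        exact Hx. }
      subst x.
      destruct (H e (cond_pos e)) as [d [Hd Hy]].
      exists (mkposreal d Hd). intros y By. specialize (Hy y By).
      replace (l * (y - z))%C with (scal (y - z)%C l) in Hy by (apply Cmult_comm).
      exact Hy.
Qed.

(** The two normed-module structures on [C] over itself have the same norm, hence the same
    derivatives; the calculus rules below are the general ones for the second structure. *)
Lemma cder_abs (f : C -> C) (z l : C) :
  cder f z l <-> @is_derive C_AbsRing (AbsRing_NormedModule C_AbsRing) f z l.
Proof.
  split; intros [H1 H2]; split.
  - apply is_linear_scal_l.
  - exact H2.
  - apply is_linear_scal_l.
  - exact H2.
Qed.

Lemma cder_ext_near (f g : C -> C) (z l : C) (r : R) :
  0 < r -> (forall y : C, Cmod (y - z) < r -> f y = g y) -> cder f z l -> cder g z l.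
Proof.
  intros Hr E H. rewrite cder_eps in H |- *. intros e He.
  destruct (H e He) as [d [Hd Hy]]. exists (Rmin d r). split.
  apply Rmin_glb_lt; auto.
  intros y Hyz. rewrite <- !E. apply Hy. eapply Rlt_le_trans; [exact Hyz|apply Rmin_l].
  replace (z - z)%C with (RtoC 0) by ring. rewrite Cmod_0; auto.
  eapply Rlt_le_trans; [exact Hyz|apply Rmin_r].
Qed.

Lemma cder_ext (f g : C -> C) (z l : C) : (forall y, f y = g y) -> cder f z l -> cder g z l.
Proof. intros E; apply (cder_ext_near f g z l 1); auto; lra. Qed.

Lemma cder_val (f : C -> C) (z l l' : C) : l = l' -> cder f z l -> cder f z l'.
Proof. now intros ->. Qed.

(** The form in which derivatives of power series and of the inverse are obtained: a
    quadratic remainder. *)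
Lemma cder_quad (f : C -> C) (z l : C) (K r : R) :
  0 < r ->
  (forall y : C, Cmod (y - z) < r ->
     Cmod (f y - f z - l * (y - z)) <= K * Cmod (y - z) ^ 2) ->
  cder f z l.
Proof.
  intros Hr H. rewrite cder_eps. intros e He.
  exists (Rmin r (e / (Rabs K + 1))).
  assert (HK : 0 < Rabs K + 1) by (generalize (Rabs_pos K); lra).
  split. apply Rmin_glb_lt; auto. now apply Rdiv_lt_0_compat.
  intros y Hy.
  eapply Rle_trans; [apply H; eapply Rlt_le_trans; [exact Hy|apply Rmin_l]|].
  assert (H1 : Cmod (y - z) < e / (Rabs K + 1)).
  { eapply Rlt_le_trans; [exact Hy|apply Rmin_r]. }
  assert (H2 : Cmod (y - z) * (Rabs K + 1) < e).
  { apply Rlt_div_r in H1; lra. }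
  generalize (Cmod_ge_0 (y - z)) (Rle_abs K); intros P1 P2. nra.
Qed.

Lemma cder_const (c z : C) : cder (fun _ => c) z 0.
Proof. apply cder_abs. apply @is_derive_const. Qed.

Lemma cder_id (z : C) : cder (fun y => y) z 1.
Proof. apply cder_abs. apply @is_derive_id. Qed.

Lemma cder_plus (f g : C -> C) (z df dg : C) :
  cder f z df -> cder g z dg -> cder (fun y => f y + g y)%C z (df + dg)%C.
Proof. rewrite !cder_abs. intros; now apply @is_derive_plus. Qed.

Lemma cder_minus (f g : C -> C) (z df dg : C) :
  cder f z df -> cder g z dg -> cder (fun y => f y - g y)%C z (df - dg)%C.
Proof. rewrite !cder_abs. intros; now apply @is_derive_minus. Qed.

Lemma cder_mult (f g : C -> C) (z df dg : C) :
  cder f z df -> cder g z dg -> cder (fun y => f y * g y)%C z (df * g z + f z * dg)%C.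
Proof.
  rewrite !cder_abs. intros. apply (@is_derive_mult C_AbsRing); auto.
  intros; apply Cmult_comm.
Qed.

Lemma cder_comp (f g : C -> C) (z df dg : C) :
  cder f (g z) df -> cder g z dg -> cder (fun y => f (g y)) z (df * dg)%C.
Proof.
  rewrite !cder_abs. intros. rewrite Cmult_comm.
  apply (@is_derive_comp C_AbsRing (AbsRing_NormedModule C_AbsRing)); auto.
Qed.

Lemma cder_scal (f : C -> C) (k z df : C) :
  cder f z df -> cder (fun y => k * f y)%C z (k * df)%C.
Proof.
  intros H. eapply cder_val; [|apply cder_mult; [apply cder_const|exact H]]. cbv beta; ring.
Qed.

Lemma Cmod_triang_inv (x y : C) : Cmod x - Cmod y <= Cmod (x - y).
Proof.
  generalize (Cmod_triangle (x - y) y). replace (x - y + y)%C with x by ring. lra.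
Qed.

Lemma Cmod_sub_sym (x y : C) : Cmod (x - y) = Cmod (y - x).
Proof. rewrite <- Cmod_opp. f_equal. ring. Qed.

Lemma cder_Cinv (z : C) : z <> 0%C -> cder Cinv z (- / (z * z))%C.
Proof.
  intros Hz. pose proof (proj1 (Cmod_gt_0 z) Hz) as Pz.
  apply (cder_quad _ _ _ (2 / Cmod z ^ 3) (Cmod z / 2)); [lra|].
  intros y Hy.
  assert (Py : Cmod z / 2 < Cmod y).
  { generalize (Cmod_triang_inv z (z - y)). replace (z - (z - y))%C with y by ring.
    rewrite (Cmod_sub_sym z y). lra. }
  assert (Hy0 : y <> 0%C).
  { apply Cmod_gt_0. lra. }
  replace (/ y - / z - - / (z * z) * (y - z))%C
    with ((y - z) * (y - z) / (y * (z * z)))%C by (field; auto).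
  rewrite Cmod_div by (repeat apply Cmult_neq_0; auto).
  rewrite !Cmod_mult.
  generalize (Cmod_ge_0 (y - z)); intros Pyz.
  set (a := Cmod (y - z)) in *. set (m := Cmod z) in *. set (n := Cmod y) in *.
  replace (2 / m ^ 3 * a ^ 2) with (a * a * (2 / m ^ 3)) by ring.
  unfold Rdiv at 1. apply Rmult_le_compat_l; [nra|].
  replace (2 / m ^ 3) with (/ (m / 2 * (m * m))) by (field; lra).
  apply Rinv_le_contravar. apply Rmult_lt_0_compat; nra.
  apply Rmult_le_compat_r; nra.
Qed.

Lemma cder_inv (f : C -> C) (z df : C) :
  f z <> 0%C -> cder f z df -> cder (fun y => / f y)%C z (- df / (f z * f z))%C.
Proof.
  intros Hz H. eapply cder_val; [|apply (cder_comp Cinv f); [apply cder_Cinv; auto|exact H]].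
  cbv beta; field; auto.
Qed.

Lemma cder_div (f g : C -> C) (z df dg : C) :
  g z <> 0%C -> cder f z df -> cder g z dg ->
  cder (fun y => f y / g y)%C z ((df * g z - f z * dg) / (g z * g z))%C.
Proof.
  intros Hz Hf Hg. eapply cder_val; [|apply cder_mult; [exact Hf|apply cder_inv; [exact Hz|exact Hg]]].
  cbv beta; field; auto.
Qed.

Lemma cder_pow (n : nat) (z : C) : cder (fun y => y ^ n)%C z (INR n * z ^ pred n)%C.
Proof.
  induction n as [|n IH].
  - simpl. eapply cder_val; [|apply cder_const]. ring.
  - eapply cder_ext; [intros y; symmetry; apply Cpow_S|].
    eapply cder_val; [|apply cder_mult; [apply cder_id|exact IH]].
    destruct n; [simpl; ring|]. rewrite (S_INR (S n)), RtoC_plus. simpl pred.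
    rewrite (Cpow_S z n). ring.
Qed.

Lemma ex_cder (f : C -> C) (z : C) :
  @ex_derive C_AbsRing C_NormedModule f z -> cder f z (C_derive f z).
Proof. intros H. apply (C_derive_correct f z z H). Qed.

Lemma cder_unique (f : C -> C) (z l : C) : cder f z l -> C_derive f z = l.
Proof. apply is_C_derive_unique. Qed.

(** Differentiates sums, differences and products down to derivatives found in the context.
    *)
Ltac cder_auto :=
  lazymatch goal with
  | |- cder (fun y => y) _ _ => apply cder_id
  | |- cder (fun y => Cplus (@?f y) (@?g y)) _ _ => apply (cder_plus f g); cder_auto
  | |- cder (fun y => Cminus (@?f y) (@?g y)) _ _ => apply (cder_minus f g); cder_auto
  | |- cder (fun y => Cmult (@?f y) (@?g y)) _ _ => apply (cder_mult f g); cder_auto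
  | |- _ => match goal with
            | |- cder (fun _ => ?c) _ _ => apply cder_const
            | H : cder ?f ?z _ |- cder ?f ?z _ => exact H
            end
  end.

Definition ccont (f : C -> C) (z : C) : Prop :=
  forall e, 0 < e -> exists d, 0 < d /\ forall y : C, Cmod (y - z) < d -> Cmod (f y - f z) < e.

Lemma cder_cont (f : C -> C) (z l : C) : cder f z l -> ccont f z.
Proof.
  intros H e He. rewrite cder_eps in H.
  destruct (H 1 Rlt_0_1) as [d [Hd Hy]].
  pose proof (Cmod_ge_0 l) as Hl.
  exists (Rmin d (e / (Cmod l + 2))). split.
  apply Rmin_glb_lt; auto. apply Rdiv_lt_0_compat; lra.
  intros y Hyz.
  assert (H1 : Cmod (y - z) < d) by (eapply Rlt_le_trans; [exact Hyz|apply Rmin_l]).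
  assert (H2 : Cmod (y - z) < e / (Cmod l + 2)) by (eapply Rlt_le_trans; [exact Hyz|apply Rmin_r]).
  apply Rlt_div_r in H2; [|lra].
  specialize (Hy y H1).
  replace (f y - f z)%C with ((f y - f z - l * (y - z)) + l * (y - z))%C by ring.
  eapply Rle_lt_trans; [apply Cmod_triangle|]. rewrite Cmod_mult.
  generalize (Cmod_ge_0 (y - z)). nra.
Qed.

Lemma Cexp_plus (x y : C) : Cexp (x + y) = (Cexp x * Cexp y)%C.
Proof.
  unfold Cexp; destruct x as [a b], y as [c d]; simpl.
  rewrite exp_plus, cos_plus, sin_plus. apply injective_projections; simpl; ring.
Qed.

Lemma Cexp_0 : Cexp 0 = 1%C.
Proof. unfold Cexp; simpl. rewrite exp_0, cos_0, sin_0. apply injective_projections; simpl; ring. Qed.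

Lemma Cmod_Cexp (x : C) : Cmod (Cexp x) = exp (Re x).
Proof.
  unfold Cmod, Cexp; simpl.
  replace (_ + _) with ((exp (Re x))²).
  apply sqrt_Rsqr; left; apply exp_pos.
  generalize (sin2_cos2 (Im x)); unfold Rsqr; intros H. nra.
Qed.

Lemma Cexp_neq_0 (x : C) : Cexp x <> 0%C.
Proof. apply Cmod_gt_0. rewrite Cmod_Cexp. apply exp_pos. Qed.

Lemma Cexp_opp (x : C) : Cexp (- x) = (/ Cexp x)%C.
Proof.
  assert (H : (Cexp (- x) * Cexp x)%C = 1%C).
  { rewrite <- Cexp_plus. replace (- x + x)%C with (RtoC 0) by ring. apply Cexp_0. }
  pose proof (Cexp_neq_0 x) as Hx.
  replace (Cexp (- x)) with ((Cexp (- x) * Cexp x) * / Cexp x)%C by (field; auto).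
  rewrite H. ring.
Qed.

Lemma derive_0_eps (f : R -> R) (l e : R) : is_derive f 0 l -> 0 < e ->
  exists d, 0 < d /\ forall h, Rabs h < d -> Rabs (f h - f 0 - l * h) <= e * Rabs h.
Proof.
  intros [_ H] He. destruct (H 0 (fun P HP => HP) (mkposreal e He)) as [d Hd].
  exists d. split; [apply cond_pos|]. intros h Hh.
  specialize (Hd h). rewrite <- (Rminus_0_r h) in Hh. specialize (Hd Hh).
  change (Rabs (f h - f 0 - (h - 0) * l) <= e * Rabs (h - 0)) in Hd.
  rewrite Rminus_0_r, (Rmult_comm h) in Hd. exact Hd.
Qed.

Lemma Cmod_le_abs (z : C) : Cmod z <= Rabs (Re z) + Rabs (Im z).
Proof.
  destruct z as [a b]. unfold Cmod; simpl fst; simpl snd. simpl Re; simpl Im.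
  apply Rsqr_incr_0_var; [|generalize (Rabs_pos a) (Rabs_pos b); lra].
  rewrite Rsqr_sqrt by nra.
  rewrite <- (pow2_abs a), <- (pow2_abs b). unfold Rsqr.
  generalize (Rabs_pos a) (Rabs_pos b). nra.
Qed.

Lemma im_le_Cmod (c : C) : Rabs (Im c) <= Cmod c.
Proof. eapply Rle_trans; [|apply Rmax_Cmod]. apply Rmax_r. Qed.

(** By the functional equation only the origin matters, and there the three real derivatives
    of exp, cos and sin suffice. *)
Lemma cder_Cexp (z : C) : cder Cexp z (Cexp z).
Proof.
  assert (H0 : cder Cexp 0 1).
  { rewrite cder_eps. intros e He.
    assert (De : is_derive exp 0 1) by (evar_last; [apply is_derive_exp|apply exp_0]).
    assert (Dc : is_derive cos 0 0) by (evar_last; [apply is_derive_cos|rewrite sin_0; ring]).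
    assert (Ds : is_derive sin 0 1) by (evar_last; [apply is_derive_sin|apply cos_0]).
    set (q := Rmin (e / 20) (1 / 2)).
    assert (Hq : 0 < q) by (apply Rmin_glb_lt; lra).
    assert (Q1 : q <= e / 20) by apply Rmin_l. assert (Q2 : q <= 1 / 2) by apply Rmin_r. clearbody q.
    destruct (derive_0_eps _ _ q De Hq) as (d1 & P1 & F1).
    destruct (derive_0_eps _ _ q Dc Hq) as (d2 & P2 & F2).
    destruct (derive_0_eps _ _ q Ds Hq) as (d3 & P3 & F3).
    exists (Rmin q (Rmin d1 (Rmin d2 d3))). split; [repeat apply Rmin_glb_lt; auto|].
    intros y. replace (y - 0)%C with y by ring. rewrite Cexp_0. destruct y as [a b]. intros Hy.
    apply Rmin_Rgt_l in Hy. destruct Hy as [Hy1 Hy]. apply Rmin_Rgt_l in Hy. destruct Hy as [Hy2 Hy].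
    apply Rmin_Rgt_l in Hy. destruct Hy as [Hy3 Hy4].
    pose proof (re_le_Cmod (a, b)) as Ha. pose proof (im_le_Cmod (a, b)) as Hb.
    simpl in Ha, Hb. set (m := Cmod (a, b)) in *.
    specialize (F1 a ltac:(lra)). specialize (F2 b ltac:(lra)). specialize (F3 b ltac:(lra)).
    rewrite exp_0 in F1. rewrite cos_0 in F2. rewrite sin_0 in F3.
    set (u := exp a - 1 - 1 * a) in *. set (v := cos b - 1 - 0 * b) in *. set (w := sin b - 0 - 1 * b) in *.
    assert (G1 : Rabs u <= q * m) by (eapply Rle_trans; [exact F1|]; apply Rmult_le_compat_l; lra).
    assert (G2 : Rabs v <= q * m) by (eapply Rle_trans; [exact F2|]; apply Rmult_le_compat_l; lra).
    assert (G3 : Rabs w <= q * m) by (eapply Rle_trans; [exact F3|]; apply Rmult_le_compat_l; lra).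
    assert (Hm : 0 <= m) by apply Cmod_ge_0.
    assert (M2 : m * m <= q * m) by (apply Rmult_le_compat_r; lra).
    assert (X : forall x y A B, Rabs x <= A -> Rabs y <= B -> Rabs (x * y) <= A * B).
    { intros. rewrite Rabs_mult. apply Rmult_le_compat; auto; apply Rabs_pos. }
    assert (Y : Rabs (exp a) <= 3).
    { replace (exp a) with (u + (1 + a)) by (unfold u; ring). apply Rabs_le_between in G1. apply Rabs_le_between in Ha.
      apply Rabs_le; nra. }
    assert (Z : Rabs (a + u) <= 2 * m).
    { eapply Rle_trans; [apply Rabs_triang|]. nra. }
    pose proof (X _ _ _ _ Y G2) as X1. pose proof (X _ _ _ _ Y G3) as X2. pose proof (X _ _ _ _ Hb Z) as X3.
    eapply Rle_trans; [apply Cmod_le_abs|]. simpl.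
    replace (exp a * cos b + - (1) + - (1 * a - 0 * b)) with (exp a * v + u) by (unfold u, v; ring).
    replace (exp a * sin b + - 0 + - (1 * b + 0 * a)) with (exp a * w + b * (a + u)) by (unfold u, w; ring).
    eapply Rle_trans; [apply Rplus_le_compat; apply Rabs_triang|]. nra. }
  eapply cder_ext with (f := fun y => (Cexp z * Cexp (y - z))%C).
  - intros y. rewrite <- Cexp_plus. f_equal. ring.
  - eapply cder_val; [|apply cder_scal, (cder_comp Cexp (fun y => (y - z)%C))].
    2:{ cbv beta. replace (z - z)%C with (RtoC 0) by ring. exact H0. }
    2:{ apply cder_minus; [apply cder_id|apply cder_const]. }
    cbv beta. ring.
Qed.

(** * Paths and integrals along an interval *)

(** The target is [C] as a real vector space, since the parameter of a path is real. *)
Definition pder (g : R -> C) (t : R) (l : C) : Prop :=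
  @is_derive R_AbsRing C_R_NormedModule g t l.
Definition pcont (g : R -> C) (t : R) : Prop :=
  forall e, 0 < e -> exists d, 0 < d /\ forall u : R, Rabs (u - t) < d -> Cmod (g u - g t) < e.

Lemma scal_RC (x : R) (z : C) : scal (V := C_R_ModuleSpace) x z = (RtoC x * z)%C.
Proof. destruct z; apply injective_projections; simpl; unfold scal; simpl; unfold mult; simpl; ring. Qed.

Lemma pder_eps (g : R -> C) (t : R) (l : C) :
  pder g t l <->
  forall e, 0 < e -> exists d, 0 < d /\ forall u : R, Rabs (u - t) < d ->
    Cmod (g u - g t - RtoC (u - t) * l) <= e * Rabs (u - t).
Proof.
  split.
  - intros [_ H] e He.
    destruct (H t (fun P HP => HP) (mkposreal e He)) as [d Hd].
    exists d; split; [apply cond_pos|]. intros u Hu.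
    specialize (Hd u Hu). rewrite <- scal_RC, Cmod_norm. exact Hd.
  - intros H; split.
    + apply @is_linear_scal_l.
    + intros x Hx e.
      assert (Hxz : t = x).
      { apply (@is_filter_lim_locally_unique R_AbsRing R_NormedModule). exact Hx. }
      subst x.
      destruct (H e (cond_pos e)) as [d [Hd Hy]].
      exists (mkposreal d Hd). intros u Bu. specialize (Hy u Bu).
      rewrite <- scal_RC, Cmod_norm in Hy. exact Hy.
Qed.

(** The uniform structure given by the modulus, for which the operations of a normed field
    are continuous. *)
Lemma pcont_abs (g : R -> C) (t : R) :
  pcont g t <-> continuous (U := AbsRing_UniformSpace C_AbsRing) g t.
Proof.
  split.
  - intros H. apply (filterlim_locally (U := AbsRing_UniformSpace C_AbsRing)). intros e.
    destruct (H e (cond_pos e)) as [d [Hd Hu]]. exists (mkposreal d Hd). intros u Bu. apply Hu. exact Bu.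
  - intros H e He. 
    destruct (proj1 (filterlim_locally (U := AbsRing_UniformSpace C_AbsRing) g (g t)) H (mkposreal _ He)) as [d Hd].
    exists d; split; [apply cond_pos|]. intros u Hu. exact (Hd u Hu).
Qed.

(** The product uniform structure, to which the Riemann integral refers. *)
Lemma pcont_continuous (g : R -> C) (t : R) :
  pcont g t <-> continuous (U := C_UniformSpace) g t.
Proof.
  split.
  - intros H. apply (filterlim_locally (U := C_UniformSpace)). intros e.
    destruct (H e (cond_pos e)) as [d [Hd Hu]].
    exists (mkposreal d Hd). intros u Bu.
    apply C_NormedModule_mixin_compat1. apply Hu. exact Bu.
  - intros H e He.
    assert (P2 : 0 < sqrt 2) by (apply sqrt_lt_R0; lra).
    assert (He2 : 0 < e / sqrt 2) by (apply Rdiv_lt_0_compat; lra).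
    destruct (proj1 (filterlim_locally (U := C_UniformSpace) g (g t)) H (mkposreal _ He2)) as [d Hd].
    exists d; split; [apply cond_pos|]. intros u Hu.
    specialize (Hd u Hu). apply C_NormedModule_mixin_compat2 in Hd. simpl in Hd.
    replace (sqrt 2 * (e / sqrt 2)) with e in Hd by (field; lra). exact Hd.
Qed.

Lemma pder_cont (g : R -> C) (t : R) (l : C) : pder g t l -> pcont g t.
Proof.
  intros H. apply pcont_continuous.
  apply (@ex_derive_continuous R_AbsRing C_R_NormedModule). exists l; exact H.
Qed.

(** A complex derivative is in particular a real-linear differential; this is what turns the
    chain rule along a path into an instance of the general one. *)
Lemma cder_filterdiff (F : C -> C) (z l : C) : cder F z l ->
  @filterdiff R_AbsRing C_R_NormedModule C_R_NormedModule F (locally z) (fun h => l * h)%C.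
Proof.
  intros H. rewrite cder_eps in H. split.
  - split.
    + intros x y. apply Cmult_plus_distr_l.
    + intros k x. rewrite !scal_RC. transitivity (l * k * x)%C; [apply Cmult_assoc|]. rewrite (Cmult_comm l). symmetry; apply Cmult_assoc.
    + exists (Cmod l + 1). split; [generalize (Cmod_ge_0 l); lra|]. intros x.
      rewrite <- !Cmod_norm, Cmod_mult. apply Rmult_le_compat_r; [apply Cmod_ge_0|lra].
  - intros x Hx e. apply (is_filter_lim_locally_unique (K := R_AbsRing) (V := C_R_NormedModule)) in Hx. subst x.
    apply locally_eps. destruct (H e (cond_pos e)) as (d & Hd & Hy). exists d. split; auto. intros y Yd.
    rewrite <- !Cmod_norm. apply Hy, Yd.
Qed.

Lemma pder_chain (F : C -> C) (g : R -> C) (t : R) (l dg : C) :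
  cder F (g t) l -> pder g t dg -> pder (fun u => F (g u)) t (l * dg)%C.
Proof.
  intros HF Hg. apply cder_filterdiff in HF.
  apply (filterdiff_ext_lin _ (fun h : R => l * scal (V := C_R_ModuleSpace) h dg)%C).
  - apply (filterdiff_comp' (K := R_AbsRing) (U := R_NormedModule) (V := C_R_NormedModule) (W := C_R_NormedModule) g F); auto.
  - intros h. rewrite !scal_RC. transitivity (l * h * dg)%C; [apply Cmult_assoc|].
    rewrite (Cmult_comm l). symmetry; apply Cmult_assoc.
Qed.

Lemma pcont_chain (F : C -> C) (g : R -> C) (t : R) :
  ccont F (g t) -> pcont g t -> pcont (fun u => F (g u)) t.
Proof.
  intros HF Hg e He. destruct (HF e He) as [d [Hd H]]. destruct (Hg d Hd) as [d' [Hd' H']].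
  exists d'; split; auto.
Qed.

Lemma pcont_const (c : C) (t : R) : pcont (fun _ => c) t.
Proof. intros e He; exists 1; split; [lra|]. intros. replace (c - c)%C with (RtoC 0) by ring. now rewrite Cmod_0. Qed.

Lemma pcont_plus (f g : R -> C) (t : R) :
  pcont f t -> pcont g t -> pcont (fun u => f u + g u)%C t.
Proof. rewrite !pcont_abs. apply (continuous_plus (V := AbsRing_NormedModule C_AbsRing)). Qed.

Lemma pcont_minus (f g : R -> C) (t : R) :
  pcont f t -> pcont g t -> pcont (fun u => f u - g u)%C t.
Proof. rewrite !pcont_abs. apply (continuous_minus (V := AbsRing_NormedModule C_AbsRing)). Qed.

Lemma pcont_mult (f g : R -> C) (t : R) :
  pcont f t -> pcont g t -> pcont (fun u => f u * g u)%C t.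
Proof. rewrite !pcont_abs. apply (continuous_mult (K := C_AbsRing)). Qed.

Lemma pder_const (c : C) (t : R) : pder (fun _ => c) t 0.
Proof. apply @is_derive_const. Qed.

Lemma pder_plus (f g : R -> C) (t : R) (df dg : C) :
  pder f t df -> pder g t dg -> pder (fun u => f u + g u)%C t (df + dg)%C.
Proof. intros; now apply (@is_derive_plus R_AbsRing C_R_NormedModule). Qed.

Lemma pder_minus (f g : R -> C) (t : R) (df dg : C) :
  pder f t df -> pder g t dg -> pder (fun u => f u - g u)%C t (df - dg)%C.
Proof. intros; now apply (@is_derive_minus R_AbsRing C_R_NormedModule). Qed.

Lemma pder_scal (f : R -> C) (k : C) (t : R) (df : C) :
  pder f t df -> pder (fun u => k * f u)%C t (k * df)%C.
Proof.
  intros H. apply (pder_chain (fun y => k * y)%C f t k df); auto.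
  eapply cder_val; [|apply cder_scal, cder_id]. ring.
Qed.

Lemma pder_RtoC (t : R) : pder (fun u => RtoC u) t 1.
Proof.
  rewrite pder_eps. intros e He. exists 1; split; [lra|]. intros u _.
  rewrite RtoC_minus. replace (u - t - (u - t) * 1)%C with (RtoC 0) by ring.
  rewrite Cmod_0. generalize (Rabs_pos (u - t)). nra.
Qed.

Lemma pder_val (g : R -> C) (t : R) (l l' : C) : l = l' -> pder g t l -> pder g t l'.
Proof. now intros ->. Qed.

Lemma pder_ext (f g : R -> C) (t : R) (l : C) : (forall u, f u = g u) -> pder f t l -> pder g t l.
Proof. intros; eapply is_derive_ext; eauto. Qed.

Lemma pder_Re (g : R -> C) (t : R) (l : C) : pder g t l -> is_derive (fun u => Re (g u)) t (Re l).
Proof.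
  intros H. unfold is_derive. 
  apply (filterdiff_ext_lin (K := R_AbsRing) (U := R_NormedModule) (V := R_NormedModule)
     (fun u => Re (g u)) (fun y => fst (scal (V := C_R_ModuleSpace) y l))).
  2: reflexivity.
  apply (filterdiff_comp (K := R_AbsRing) (U := R_NormedModule) (V := C_R_NormedModule) (W := R_NormedModule)
    g (fun z : C => Re z) (fun y => scal (V := C_R_ModuleSpace) y l) fst).
  exact H.
  apply (filterdiff_linear (K := R_AbsRing) (U := C_R_NormedModule) (V := R_NormedModule)).
  apply (is_linear_fst (K := R_AbsRing) (U := R_NormedModule) (V := R_NormedModule)).
Qed.

Lemma pder_Im (g : R -> C) (t : R) (l : C) : pder g t l -> is_derive (fun u => Im (g u)) t (Im l).
Proof.
  intros H. unfold is_derive. 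
  apply (filterdiff_ext_lin (K := R_AbsRing) (U := R_NormedModule) (V := R_NormedModule)
     (fun u => Im (g u)) (fun y => snd (scal (V := C_R_ModuleSpace) y l))).
  2: reflexivity.
  apply (filterdiff_comp (K := R_AbsRing) (U := R_NormedModule) (V := C_R_NormedModule) (W := R_NormedModule)
    g (fun z : C => Im z) (fun y => scal (V := C_R_ModuleSpace) y l) snd).
  exact H.
  apply (filterdiff_linear (K := R_AbsRing) (U := C_R_NormedModule) (V := R_NormedModule)).
  apply (is_linear_snd (K := R_AbsRing) (U := R_NormedModule) (V := R_NormedModule)).
Qed.

Lemma mvt_is_derive (f df : R -> R) (a b : R) : a < b ->
  (forall t, a <= t <= b -> is_derive f t (df t)) ->
  exists c, a < c < b /\ f b - f a = df c * (b - a).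
Proof.
  intros Hab H. destruct (MVT_cor2 f df a b Hab) as [c [E Hc]].
  - intros t Ht. now apply is_derive_Reals, H.
  - now exists c.
Qed.

Definition cis (t : R) : C := (cos t, sin t).

Lemma cis_Cexp (t : R) : cis t = Cexp (Ci * t).
Proof.
  unfold cis, Cexp; simpl. 
  replace (0 * t - 1 * 0) with 0 by ring. replace (0 * 0 + 1 * t) with t by ring.
  rewrite exp_0. apply injective_projections; simpl; ring.
Qed.

Lemma Cmod_cis (t : R) : Cmod (cis t) = 1.
Proof. rewrite cis_Cexp, Cmod_Cexp. simpl. replace (0 * t - 1 * 0) with 0 by ring. apply exp_0. Qed.

Lemma pder_cis (t : R) : pder cis t (Ci * cis t)%C.
Proof.
  eapply pder_ext; [intros; symmetry; apply cis_Cexp|].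
  eapply pder_val; [|apply (pder_chain Cexp (fun u => Ci * RtoC u)%C)].
  2: apply cder_Cexp. 2: apply pder_scal, pder_RtoC.
  cbv beta. rewrite <- cis_Cexp. ring.
Qed.

Lemma pcont_cis (t : R) : pcont cis t.
Proof. eapply pder_cont, pder_cis. Qed.

Ltac pcont_auto :=
  repeat first [ solve [auto] | apply pcont_const | apply pcont_cis
               | apply pcont_mult | apply pcont_minus | apply pcont_plus ].

Lemma cis_lip (t u : R) : Cmod (cis t - cis u) <= 2 * Rabs (t - u).
Proof.
  eapply Rle_trans; [apply Cmod_le_abs|]. simpl.
  assert (A : Rabs (cos t + - cos u) <= Rabs (t - u)).
  { destruct (MVT_abs cos (fun x => - sin x) u t) as [c [Hc _]].
    intros; apply derivable_pt_lim_cos. unfold Rminus in Hc at 1. rewrite Hc, Rabs_Ropp.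
    assert (Rabs (sin c) <= 1) by (apply Rabs_le, SIN_bound).
    generalize (Rabs_pos (t - u)). nra. }
  assert (B : Rabs (sin t + - sin u) <= Rabs (t - u)).
  { destruct (MVT_abs sin cos u t) as [c [Hc _]].
    intros; apply derivable_pt_lim_sin. unfold Rminus in Hc at 1. rewrite Hc.
    assert (Rabs (cos c) <= 1) by (apply Rabs_le, COS_bound).
    generalize (Rabs_pos (t - u)). nra. }
  lra.
Qed.

Lemma cis_2PI : cis (2 * PI) = cis 0.
Proof. unfold cis. now rewrite cos_2PI, sin_2PI, cos_0, sin_0. Qed.

Definition Cint (f : R -> C) (a b : R) : C := @RInt C_R_CompleteNormedModule f a b.

Lemma Cint_ex (f : R -> C) (a b : R) :
  a <= b -> (forall t, a <= t <= b -> pcont f t) -> @ex_RInt C_R_CompleteNormedModule f a b.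
Proof.
  intros Hab H. apply ex_RInt_continuous. intros t Ht.
  rewrite Rmin_left, Rmax_right in Ht by auto.
  apply pcont_continuous, H, Ht.
Qed.

Lemma Cint_correct (f : R -> C) (a b : R) :
  a <= b -> (forall t, a <= t <= b -> pcont f t) ->
  @is_RInt C_R_CompleteNormedModule f a b (Cint f a b).
Proof. intros. now apply (@RInt_correct C_R_CompleteNormedModule), Cint_ex. Qed.

Lemma Cint_bound (f : R -> C) (a b M : R) :
  a <= b -> (forall t, a <= t <= b -> pcont f t) ->
  (forall t, a <= t <= b -> Cmod (f t) <= M) ->
  Cmod (Cint f a b) <= (b - a) * M.
Proof.
  intros Hab H HM. rewrite Cmod_norm.
  apply (@norm_RInt_le_const C_R_NormedModule f a b); auto.
  intros t Ht. rewrite <- Cmod_norm. auto.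
  apply Cint_correct; auto.
Qed.

Lemma Cint_FTC (f df : R -> C) (a b : R) :
  a <= b -> (forall t, a <= t <= b -> pder f t (df t)) ->
  (forall t, a <= t <= b -> pcont df t) ->
  Cint df a b = (f b - f a)%C.
Proof.
  intros Hab H1 H2. apply (@is_RInt_unique C_R_CompleteNormedModule).
  apply (@is_RInt_derive C_R_CompleteNormedModule f df);
  intros t Ht; rewrite Rmin_left, Rmax_right in Ht by auto.
  - now apply H1.
  - apply pcont_continuous; auto.
Qed.

Lemma Cint_minus (f g : R -> C) (a b : R) :
  a <= b -> (forall t, a <= t <= b -> pcont f t) -> (forall t, a <= t <= b -> pcont g t) ->
  Cint (fun t => f t - g t)%C a b = (Cint f a b - Cint g a b)%C.
Proof. intros. apply (@RInt_minus C_R_CompleteNormedModule); now apply Cint_ex. Qed.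

Lemma Cint_plus (f g : R -> C) (a b : R) :
  a <= b -> (forall t, a <= t <= b -> pcont f t) -> (forall t, a <= t <= b -> pcont g t) ->
  Cint (fun t => f t + g t)%C a b = (Cint f a b + Cint g a b)%C.
Proof. intros. apply (@RInt_plus C_R_CompleteNormedModule); now apply Cint_ex. Qed.

Lemma Cint_ext (f g : R -> C) (a b : R) :
  (forall t, f t = g t) -> Cint f a b = Cint g a b.
Proof. intros. apply (@RInt_ext C_R_CompleteNormedModule); auto. Qed.

Lemma Cint_Chasles (f : R -> C) (a b c : R) :
  a <= b <= c -> (forall t, a <= t <= c -> pcont f t) ->
  Cint f a c = (Cint f a b + Cint f b c)%C.
Proof.
  intros H Hf. symmetry. apply (@RInt_Chasles C_R_CompleteNormedModule); apply Cint_ex;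
  try lra; intros; apply Hf; lra.
Qed.

Lemma Cint_components (f : R -> C) (a b : R) :
  a <= b -> (forall t, a <= t <= b -> pcont f t) ->
  Cint f a b = (RInt (fun t => Re (f t)) a b, RInt (fun t => Im (f t)) a b).
Proof.
  intros Hab Hf. pose proof (Cint_ex f a b Hab Hf) as H.
  apply (@is_RInt_unique C_R_CompleteNormedModule).
  destruct H as [l Hl].
  apply (@is_RInt_fct_extend_pair R_NormedModule R_NormedModule).
  - apply (@RInt_correct R_CompleteNormedModule). exists (fst l).
    apply (@is_RInt_fct_extend_fst R_NormedModule R_NormedModule f). exact Hl.
  - apply (@RInt_correct R_CompleteNormedModule). exists (snd l).
    apply (@is_RInt_fct_extend_snd R_NormedModule R_NormedModule f). exact Hl.
Qed.

Lemma Cint_components_ex (f : R -> C) (a b : R) :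
  a <= b -> (forall t, a <= t <= b -> pcont f t) ->
  ex_RInt (fun t => Re (f t)) a b /\ ex_RInt (fun t => Im (f t)) a b.
Proof.
  intros Hab Hf. destruct (Cint_ex f a b Hab Hf) as [l Hl]. split.
  - exists (fst l). apply (@is_RInt_fct_extend_fst R_NormedModule R_NormedModule f). exact Hl.
  - exists (snd l). apply (@is_RInt_fct_extend_snd R_NormedModule R_NormedModule f). exact Hl.
Qed.

(** The integral is only real-linear by construction; a complex factor is handled through
    the components. *)
Lemma Cint_scal (k : C) (f : R -> C) (a b : R) :
  a <= b -> (forall t, a <= t <= b -> pcont f t) ->
  Cint (fun t => k * f t)%C a b = (k * Cint f a b)%C.
Proof.
  intros Hab Hf. destruct (Cint_components_ex f a b Hab Hf) as [H1 H2].
  rewrite !Cint_components; auto.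
  2: intros; apply pcont_mult; auto; apply pcont_const.
  destruct k as [p q]. apply injective_projections; simpl.
  - rewrite <- !(@RInt_scal R_CompleteNormedModule) by auto.
    rewrite <- (@RInt_minus R_CompleteNormedModule). reflexivity.
    all: apply (@ex_RInt_scal R_NormedModule); auto.
  - transitivity (RInt (fun t => plus (scal p (Im (f t))) (scal q (Re (f t)))) a b).
    reflexivity.
    rewrite (@RInt_plus R_CompleteNormedModule), !(@RInt_scal R_CompleteNormedModule); auto.
    all: apply (@ex_RInt_scal R_NormedModule); auto.
Qed.

(** * Goursat's theorem *)

Record rect := Rect { xl : R; xr : R; yl : R; yr : R }.

Definition xm (q : rect) := (xl q + xr q) / 2.
Definition ym (q : rect) := (yl q + yr q) / 2.

Definition quarter (b1 b2 : bool) (q : rect) : rect :=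
  Rect (if b1 then xl q else xm q) (if b1 then xm q else xr q)
       (if b2 then yl q else ym q) (if b2 then ym q else yr q).

(** A bad quarter when there is one, an arbitrary rectangle otherwise. *)
Definition bisect_step (Bad : rect -> Prop) (q : rect) : rect :=
  epsilon (inhabits q) (fun q' => Bad q' /\ exists b1 b2, q' = quarter b1 b2 q).

Lemma nested_point (l r : nat -> R) :
  (forall n, l n <= l (S n)) -> (forall n, r (S n) <= r n) -> (forall n, l n <= r n) ->
  exists x, forall n, l n <= x <= r n.
Proof.
  intros Hl Hr Hlr.
  assert (Ml : forall n m, (n <= m)%nat -> l n <= l m).
  { intros n m H; induction H; [lra|]. eapply Rle_trans; [exact IHle|apply Hl]. }
  assert (Mr : forall n m, (n <= m)%nat -> r m <= r n).
  { intros n m H; induction H; [lra|]. eapply Rle_trans; [apply Hr|exact IHle]. }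
  assert (X : forall n m, l n <= r m).
  { intros n m. eapply Rle_trans; [apply (Ml n (max n m)); lia|].
    eapply Rle_trans; [apply Hlr|apply Mr; lia]. }
  destruct (completeness (fun y => exists n, y = l n)) as [x [U L]].
  - exists (r O). intros y [n ->]. apply X.
  - exists (l O). now exists O.
  - exists x. intros n; split.
    + apply U. now exists n.
    + apply L. intros y [m ->]. apply X.
Qed.

(** A defect that always passes to one of the four quarters is concentrated, in arbitrarily
    small rectangles, at some point. *)
Lemma bisection (Bad : rect -> Prop) (q0 : rect) :
  xl q0 <= xr q0 -> yl q0 <= yr q0 ->
  Bad q0 ->
  (forall q, xl q <= xr q -> yl q <= yr q -> Bad q -> exists b1 b2, Bad (quarter b1 b2 q)) ->
  exists x y, xl q0 <= x <= xr q0 /\ yl q0 <= y <= yr q0 /\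
    forall d, 0 < d -> exists q, Bad q /\
      xl q0 <= xl q /\ xl q <= x <= xr q /\ xr q <= xr q0 /\
      yl q0 <= yl q /\ yl q <= y <= yr q /\ yr q <= yr q0 /\
      xr q - xl q < d /\ yr q - yl q < d.
Proof.
  intros Hx Hy HB Hstep.
  set (s := fun n => Nat.iter n (bisect_step Bad) q0).
  assert (Inv : forall n, Bad (s n) /\ xl (s n) <= xr (s n) /\ yl (s n) <= yr (s n)
     /\ xr (s n) - xl (s n) = (xr q0 - xl q0) / 2 ^ n
     /\ yr (s n) - yl (s n) = (yr q0 - yl q0) / 2 ^ n).
  { intros n; induction n as [|n (I1 & I2 & I3 & I4 & I5)].
    - simpl. repeat split; auto; field.
    - assert (E : Bad (s (S n)) /\ exists b1 b2, s (S n) = quarter b1 b2 (s n)).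
      { change (s (S n)) with (bisect_step Bad (s n)). unfold bisect_step. apply epsilon_spec. destruct (Hstep (s n) I2 I3 I1) as (b1 & b2 & H).
        exists (quarter b1 b2 (s n)); split; eauto. }
      destruct E as [E1 (b1 & b2 & E2)]. split; auto. rewrite E2.
      assert (P : 2 ^ n <> 0) by (apply pow_nonzero; lra).
      assert (D1 : (xr q0 - xl q0) / 2 ^ S n = (xr (s n) - xl (s n)) / 2).
      { rewrite I4. simpl. field; auto. }
      assert (D2 : (yr q0 - yl q0) / 2 ^ S n = (yr (s n) - yl (s n)) / 2).
      { rewrite I5. simpl. field; auto. }
      rewrite D1, D2. unfold quarter, xm, ym; destruct b1, b2; simpl; repeat split; lra. }
  assert (Mon : forall n, xl (s n) <= xl (s (S n)) /\ xr (s (S n)) <= xr (s n)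
       /\ yl (s n) <= yl (s (S n)) /\ yr (s (S n)) <= yr (s n)).
  { intros n. destruct (Inv n) as (I1 & I2 & I3 & _).
    assert (E : Bad (s (S n)) /\ exists b1 b2, s (S n) = quarter b1 b2 (s n)).
    { change (s (S n)) with (bisect_step Bad (s n)). unfold bisect_step. apply epsilon_spec. destruct (Hstep (s n) I2 I3 I1) as (b1 & b2 & H).
      exists (quarter b1 b2 (s n)); split; eauto. }
    destruct E as [_ (b1 & b2 & ->)].
    unfold quarter, xm, ym; destruct b1, b2; simpl; repeat split; lra. }
  destruct (nested_point (fun n => xl (s n)) (fun n => xr (s n))) as [x Px];
    try (intros n; destruct (Inv n), (Mon n); tauto).
  destruct (nested_point (fun n => yl (s n)) (fun n => yr (s n))) as [y Py];
    try (intros n; destruct (Inv n), (Mon n); tauto).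
  exists x, y. split; [exact (Px O)|]. split; [exact (Py O)|].
  assert (Sub : forall n, xl q0 <= xl (s n) /\ xr (s n) <= xr q0 /\ yl q0 <= yl (s n) /\ yr (s n) <= yr q0).
  { intros n; induction n as [|n IH]; [simpl; lra|]. specialize (Mon n). lra. }
  intros d Hd.
  set (w := (xr q0 - xl q0) + (yr q0 - yl q0) + 1).
  assert (Hw : 0 < w) by (unfold w; lra).
  destruct (Pow_x_infinity 2 ltac:(rewrite Rabs_pos_eq; lra) (w / d + 1)) as [N HN].
  specialize (HN N (le_n N)). rewrite Rabs_pos_eq in HN by (apply pow_le; lra).
  assert (Q : w / 2 ^ N < d).
  { assert (0 < w / d) by now apply Rdiv_lt_0_compat.
    apply Rlt_div_l; [lra|]. 
    assert (w / d < 2 ^ N) by lra. apply Rlt_div_l in H0; lra. }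
  assert (P2 : 0 < 2 ^ N) by (apply pow_lt; lra).
  destruct (Inv N) as (I1 & I2 & I3 & I4 & I5).
  exists (s N). specialize (Px N). specialize (Py N). specialize (Sub N).
  split; [exact I1|].
  repeat split; try lra.
  - rewrite I4. eapply Rle_lt_trans; [|exact Q]. apply Rmult_le_compat_r; [|unfold w; lra].
    left; now apply Rinv_0_lt_compat.
  - rewrite I5. eapply Rle_lt_trans; [|exact Q]. apply Rmult_le_compat_r; [|unfold w; lra].
    left; now apply Rinv_0_lt_compat.
Qed.

(** Along any path the affine part of [phi] at [c] integrates to the increment of its
    primitive, so only the remainder contributes to the error. *)
Lemma side_estimate (phi : C -> C) (c l : C) (e rho L : R) (g dg : R -> C) (p q : R) :
  p <= q -> 0 <= e -> 0 <= rho -> 0 <= L ->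
  (forall t, p <= t <= q -> pder g t (dg t)) ->
  (forall t, p <= t <= q -> pcont dg t) ->
  (forall t, p <= t <= q -> pcont (fun u => phi (g u)) t) ->
  (forall t, p <= t <= q -> Cmod (dg t) <= L) ->
  (forall t, p <= t <= q -> Cmod (g t - c) <= rho) ->
  (forall t, p <= t <= q -> Cmod (phi (g t) - phi c - l * (g t - c)) <= e * Cmod (g t - c)) ->
  let G := fun y => (phi c * y + l / 2 * ((y - c) * (y - c)))%C in
  Cmod (Cint (fun t => phi (g t) * dg t)%C p q - (G (g q) - G (g p))) <= (q - p) * (e * rho * L).
Proof.
  intros Hpq He Hrho HL Hg Hdg Hphi HdL Hrh Hrem G.
  assert (Cg : forall t, p <= t <= q -> pcont g t) by (intros; eapply pder_cont; eauto).
  rewrite <- (Cint_FTC (fun t => G (g t)) (fun t => (phi c + l * (g t - c)) * dg t)%C); auto.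
  - rewrite <- Cint_minus; auto.
    + rewrite (Cint_ext _ (fun t => (phi (g t) - phi c - l * (g t - c)) * dg t)%C) by (intros; ring).
      apply Cint_bound; auto.
      * intros; pcont_auto.
      * intros t Ht. rewrite Cmod_mult. apply Rmult_le_compat; auto; try apply Cmod_ge_0.
        eapply Rle_trans; [apply Hrem; auto|]. apply Rmult_le_compat_l; auto.
    + intros; pcont_auto.
    + intros; pcont_auto.
  - intros t Ht. apply (pder_chain G); auto. unfold G.
    eapply cder_val; [|cder_auto]. cbv beta. field.
  - intros; pcont_auto.
Qed.

(** The segment from the apex [a] to the point of parameter [t] of the circle of radius [r].
    With [a] inside the circle the images of [s = 1] and of small [s] are the circle and a
    small closed curve around [a], and no branch of the logarithm is needed to parametrise
    the region between them. *)
Definition cone (a : C) (r s t : R) : C := (a + RtoC s * (RtoC r * cis t - a))%C.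

Lemma pder_cone_s (a : C) (r s t : R) : pder (fun u => cone a r u t) s (RtoC r * cis t - a)%C.
Proof.
  unfold cone. eapply pder_val; [|apply pder_plus; [apply pder_const|]].
  2: eapply pder_ext; [intros u; apply Cmult_comm|apply pder_scal, pder_RtoC].
  ring.
Qed.

Lemma pder_cone_t (a : C) (r s t : R) : pder (fun u => cone a r s u) t (RtoC s * (RtoC r * (Ci * cis t)))%C.
Proof.
  unfold cone. eapply pder_val; [|apply pder_plus; [apply pder_const|]].
  2: apply pder_scal, pder_minus; [apply pder_scal, pder_cis|apply pder_const].
  ring.
Qed.

Lemma pcont_dcone_t (r s t : R) : pcont (fun u => RtoC s * (RtoC r * (Ci * cis u)))%C t.
Proof. pcont_auto. Qed.

Lemma cone_lip (a : C) (r s t s' t' : R) :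
  0 <= r -> 0 <= s' <= 1 ->
  Cmod (cone a r s t - cone a r s' t') <= (2 * r + Cmod a) * (Rabs (s - s') + Rabs (t - t')).
Proof.
  intros Hr Hs. unfold cone.
  replace (a + s * (r * cis t - a) - (a + s' * (r * cis t' - a)))%C
    with (RtoC (s - s') * (r * cis t - a) + RtoC s' * (RtoC r * (cis t - cis t')))%C
    by (rewrite RtoC_minus; ring).
  eapply Rle_trans; [apply Cmod_triangle|]. rewrite !Cmod_mult, !Cmod_R.
  rewrite (Rabs_pos_eq s'), (Rabs_pos_eq r) by lra.
  assert (H1 : Cmod (r * cis t - a) <= r + Cmod a).
  { eapply Rle_trans; [apply Cmod_triangle|]. rewrite Cmod_opp, Cmod_mult, Cmod_cis, Cmod_R, Rabs_pos_eq; lra. }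
  pose proof (cis_lip t t') as H2.
  pose proof (Rabs_pos (s - s')). pose proof (Rabs_pos (t - t')). pose proof (Cmod_ge_0 a).
  pose proof (Cmod_ge_0 (cis t - cis t')).
  assert (s' * (r * Cmod (cis t - cis t')) <= r * (2 * Rabs (t - t'))).
  { assert (r * Cmod (cis t - cis t') <= r * (2 * Rabs (t - t'))) by (apply Rmult_le_compat_l; lra).
    assert (0 <= r * Cmod (cis t - cis t')) by (apply Rmult_le_pos; lra). nra. }
  nra.
Qed.

Definition coneH (phi : C -> C) (a : C) (r t s s' : R) : C :=
  Cint (fun u => phi (cone a r u t) * (RtoC r * cis t - a))%C s s'.
Definition coneV (phi : C -> C) (a : C) (r s t t' : R) : C :=
  Cint (fun u => phi (cone a r s u) * (RtoC s * (RtoC r * (Ci * cis u))))%C t t'.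
(** The integral of [phi] along the image of the boundary of a rectangle of parameters. *)
Definition coneI (phi : C -> C) (a : C) (r : R) (q : rect) : C :=
  (coneH phi a r (yl q) (xl q) (xr q) + coneV phi a r (xr q) (yl q) (yr q)
   - coneH phi a r (yr q) (xl q) (xr q) - coneV phi a r (xl q) (yl q) (yr q))%C.

(** If the contour integral were nonzero, it would exceed a fixed multiple of the squared
    size of the rectangle, and this passes to a quarter by additivity. At the limit point
    [phi] is affine up to [o(|z - c|)], and the contour integral of an affine function
    vanishes; the rest is [o] of the squared size. *)
Lemma goursat_cone (phi : C -> C) (a : C) (r : R) (q0 : rect) :
  0 <= r -> 0 <= xl q0 -> xl q0 <= xr q0 -> xr q0 <= 1 -> yl q0 <= yr q0 ->
  (forall s t, xl q0 <= s <= xr q0 -> yl q0 <= t <= yr q0 -> exists l, cder phi (cone a r s t) l) ->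
  coneI phi a r q0 = 0%C.
Proof.
  intros Hr Hx0 Hx Hx1 Hy Hphi.
  assert (PH : forall s t, xl q0 <= s <= xr q0 -> yl q0 <= t <= yr q0 ->
             pcont (fun u => phi (cone a r u t)) s).
  { intros s t Hs Ht. destruct (Hphi s t Hs Ht) as [l Hl].
    apply (pcont_chain phi). eapply cder_cont; eauto. eapply pder_cont, pder_cone_s. }
  assert (PV : forall s t, xl q0 <= s <= xr q0 -> yl q0 <= t <= yr q0 ->
             pcont (fun u => phi (cone a r s u)) t).
  { intros s t Hs Ht. destruct (Hphi s t Hs Ht) as [l Hl].
    apply (pcont_chain phi). eapply cder_cont; eauto. eapply pder_cont, pder_cone_t. }
  apply NNPP. intros Hne.
  apply Cmod_gt_0 in Hne. set (I0 := Cmod (coneI phi a r q0)) in *.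
  set (w := fun q => (xr q - xl q) ^ 2 + (yr q - yl q) ^ 2).
  assert (Hw0 : 0 <= w q0) by (unfold w; nra).
  (* half of what is needed, and with w + 1 in place of w to allow a degenerate rectangle *)
  set (kap := I0 / (2 * (w q0 + 1))).
  assert (Hkap : 0 < kap) by (unfold kap; apply Rdiv_lt_0_compat; lra).
  set (Bad := fun q => (xl q0 <= xl q /\ xr q <= xr q0 /\ yl q0 <= yl q /\ yr q <= yr q0) /\
                       kap * w q < Cmod (coneI phi a r q)).
  destruct (bisection Bad q0) as (x & y & Bx & By & Hloc); auto.
  - split; [lra|]. fold I0. unfold kap.
    replace (I0 / (2 * (w q0 + 1)) * w q0) with (I0 * (w q0 / (2 * (w q0 + 1)))) by (field; lra).
    assert (w q0 / (2 * (w q0 + 1)) < 1) by (apply Rlt_div_l; lra). nra.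
  - intros q Qx Qy [Hin HB].
    assert (Sum : coneI phi a r q = (coneI phi a r (quarter true true q) + coneI phi a r (quarter true false q)
       + coneI phi a r (quarter false true q) + coneI phi a r (quarter false false q))%C).
    { unfold coneI, quarter; simpl.
      assert (M1 : xl q <= xm q <= xr q) by (unfold xm; lra).
      assert (M2 : yl q <= ym q <= yr q) by (unfold ym; lra).
      assert (CH : forall t, yl q <= t <= yr q -> coneH phi a r t (xl q) (xr q) =
         (coneH phi a r t (xl q) (xm q) + coneH phi a r t (xm q) (xr q))%C).
      { intros t Ht. apply Cint_Chasles; auto. intros u Hu. pcont_auto.
        apply PH; lra. }
      assert (CV : forall s, xl q <= s <= xr q -> coneV phi a r s (yl q) (yr q) =
         (coneV phi a r s (yl q) (ym q) + coneV phi a r s (ym q) (yr q))%C).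
      { intros s Hs. apply Cint_Chasles; auto. intros u Hu. pcont_auto.
        apply PV; lra. }
      rewrite (CH (yl q)), (CH (yr q)), (CV (xl q)), (CV (xr q)) by lra. ring. }
    apply NNPP. intros Hno.
    assert (Small : forall b1 b2, Cmod (coneI phi a r (quarter b1 b2 q)) <= kap * (w q / 4)).
    { intros b1 b2. apply Rnot_lt_le. intros Hlt. apply Hno. exists b1, b2. split.
      - unfold quarter, xm, ym; destruct b1, b2; simpl; lra.
      - replace (w (quarter b1 b2 q)) with (w q / 4); auto.
        unfold w, quarter, xm, ym; destruct b1, b2; simpl; field. }
    pose proof (Small true true). pose proof (Small true false).
    pose proof (Small false true). pose proof (Small false false).
    apply (Rlt_irrefl (kap * w q)). eapply Rlt_le_trans; [exact HB|]. rewrite Sum.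
    eapply Rle_trans; [apply Cmod_triangle|].
    eapply Rle_trans; [apply Rplus_le_compat_r, Cmod_triangle|].
    eapply Rle_trans; [apply Rplus_le_compat_r, Rplus_le_compat_r, Cmod_triangle|]. lra.
  - set (L := 2 * r + Cmod a).
    assert (HL : 0 <= L) by (unfold L; generalize (Cmod_ge_0 a); lra).
    destruct (Hphi x y Bx By) as [l Hl]. set (c := cone a r x y) in *.
    set (e := kap / (8 * (L * L + 1))).
    assert (He : 0 < e) by (apply Rdiv_lt_0_compat; nra).
    rewrite cder_eps in Hl. destruct (Hl e He) as [d [Hd Hrem]].
    destruct (Hloc (d / (2 * (L + 1)))) as [q (HB & Q1 & Q2 & Q3 & Q4 & Q5 & Q6 & Q7 & Q8)].
    { apply Rdiv_lt_0_compat; lra. }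
    destruct HB as [_ HB].
    set (ds := xr q - xl q) in *. set (dt := yr q - yl q) in *.
    set (rho := L * (ds + dt)).
    assert (Hrho : 0 <= rho) by (unfold rho, ds, dt; apply Rmult_le_pos; lra).
    assert (Near : forall s t, xl q <= s <= xr q -> yl q <= t <= yr q -> Cmod (cone a r s t - c) <= rho).
    { intros s t Hs Ht. eapply Rle_trans; [apply cone_lip; lra|]. fold L. unfold rho.
      apply Rmult_le_compat_l; auto. unfold ds, dt.
      assert (Rabs (s - x) <= xr q - xl q) by (apply Rabs_le; lra).
      assert (Rabs (t - y) <= yr q - yl q) by (apply Rabs_le; lra). lra. }
    assert (Hrd : rho < d).
    { unfold rho. assert (ds + dt < d / (L + 1)).
      { replace (d / (L + 1)) with (d / (2 * (L + 1)) + d / (2 * (L + 1))) by (field; lra). lra. }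
      assert (0 <= ds + dt) by (unfold ds, dt; lra).
      assert ((ds + dt) * (L + 1) < d).
      { apply Rlt_div_r; lra. } nra. }
    assert (LH : forall t, Cmod (r * cis t - a) <= L).
    { intros t. eapply Rle_trans; [apply Cmod_triangle|]. rewrite Cmod_opp, Cmod_mult, Cmod_cis, Cmod_R, Rabs_pos_eq; unfold L; lra. }
    assert (LV : forall s t, 0 <= s <= 1 -> Cmod (s * (r * (Ci * cis t))) <= L).
    { intros s t Hs. rewrite !Cmod_mult, Cmod_cis, Cmod_Ci, !Cmod_R, !Rabs_pos_eq; try lra.
      unfold L. generalize (Cmod_ge_0 a). nra. }
    assert (EH : forall t, yl q <= t <= yr q -> 
      let G := fun y => (phi c * y + l / 2 * ((y - c) * (y - c)))%C in
      Cmod (coneH phi a r t (xl q) (xr q) - (G (cone a r (xr q) t) - G (cone a r (xl q) t))) <= ds * (e * rho * L)).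
    { intros t Ht G. apply (side_estimate phi c l e rho L (fun u => cone a r u t) (fun _ => r * cis t - a)%C); try lra; auto.
      - intros; apply pder_cone_s.
      - intros; apply pcont_const.
      - intros; apply PH; lra.
      - intros s Hs. apply Hrem. eapply Rle_lt_trans; [apply Near|]; auto. }
    assert (EV : forall s, xl q <= s <= xr q ->
      let G := fun y => (phi c * y + l / 2 * ((y - c) * (y - c)))%C in
      Cmod (coneV phi a r s (yl q) (yr q) - (G (cone a r s (yr q)) - G (cone a r s (yl q)))) <= dt * (e * rho * L)).
    { intros s Hs G. apply (side_estimate phi c l e rho L (fun u => cone a r s u) (fun u => s * (r * (Ci * cis u)))%C); try lra; auto.
      - intros; apply pder_cone_t.
      - intros; apply pcont_dcone_t.
      - intros; apply PV; lra.
      - intros; apply LV; lra.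
      - intros t Ht. apply Hrem. eapply Rle_lt_trans; [apply Near|]; auto. }
    set (G := fun y => (phi c * y + l / 2 * ((y - c) * (y - c)))%C) in *. cbv zeta in EH, EV.
    pose proof (EH (yl q) ltac:(lra)) as E1. pose proof (EH (yr q) ltac:(lra)) as E2.
    pose proof (EV (xl q) ltac:(lra)) as E3. pose proof (EV (xr q) ltac:(lra)) as E4.
    assert (Tot : Cmod (coneI phi a r q) <= 2 * (ds + dt) * (e * rho * L)).
    { unfold coneI. set (h1 := coneH phi a r (yl q) (xl q) (xr q)) in *.
      set (h2 := coneH phi a r (yr q) (xl q) (xr q)) in *.
      set (v1 := coneV phi a r (xl q) (yl q) (yr q)) in *.
      set (v2 := coneV phi a r (xr q) (yl q) (yr q)) in *.
      set (g11 := G (cone a r (xl q) (yl q))) in *. set (g21 := G (cone a r (xr q) (yl q))) in *.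
      set (g12 := G (cone a r (xl q) (yr q))) in *. set (g22 := G (cone a r (xr q) (yr q))) in *.
      replace (h1 + v2 - h2 - v1)%C with
        ((h1 - (g21 - g11)) + (v2 - (g22 - g21)) + (- (h2 - (g22 - g12)) + - (v1 - (g12 - g11))))%C by ring.
      eapply Rle_trans; [apply Cmod_triangle|].
      eapply Rle_trans; [apply Rplus_le_compat; apply Cmod_triangle|]. rewrite !Cmod_opp. lra. }
    apply (Rlt_irrefl (kap * w q)). eapply Rlt_le_trans; [exact HB|].
    eapply Rle_trans; [exact Tot|].
    unfold rho. replace (w q) with (ds ^ 2 + dt ^ 2) by reflexivity.
    replace (2 * (ds + dt) * (e * (L * (ds + dt)) * L)) with (2 * e * (L * L) * (ds + dt) ^ 2) by ring.
    assert (B1 : (ds + dt) ^ 2 <= 2 * (ds ^ 2 + dt ^ 2)) by (generalize (pow2_ge_0 (ds - dt)); clearbody ds dt; clear; intros; nra).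
    assert (B2 : 4 * e * (L * L) <= kap).
    { unfold e. replace (4 * (kap / (8 * (L * L + 1))) * (L * L)) with (kap * ((L * L) / (2 * (L * L + 1)))) by (field; nra).
      assert ((L * L) / (2 * (L * L + 1)) <= 1) by (apply Rle_div_l; nra). nra. }
    assert (0 <= ds ^ 2 + dt ^ 2) by nra. assert (0 <= 2 * e * (L * L)) by nra. nra.
Qed.

(** * Cauchy's formula and Taylor series *)

Fixpoint csum (f : nat -> C) (n : nat) : C :=
  match n with O => 0%C | S m => (csum f m + f m)%C end.

Lemma csum_ext (f g : nat -> C) n : (forall k, (k < n)%nat -> f k = g k) -> csum f n = csum g n.
Proof.
  induction n as [|n IH]; intros H; simpl; auto. rewrite IH, H; auto.
Qed.

Lemma csum_minus (f g : nat -> C) n : csum (fun k => f k - g k)%C n = (csum f n - csum g n)%C.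
Proof. induction n as [|n IH]; simpl; [ring|rewrite IH; ring]. Qed.

Lemma csum_scal (c : C) (f : nat -> C) n : csum (fun k => c * f k)%C n = (c * csum f n)%C.
Proof. induction n as [|n IH]; simpl; [ring|rewrite IH; ring]. Qed.

Lemma csum_split (f : nat -> C) n : csum f (S n) = (f O + csum (fun k => f (S k)) n)%C.
Proof. induction n as [|n IH]; simpl in *; [ring|rewrite IH; ring]. Qed.

Lemma csum_geom (q : C) n : ((1 - q) * csum (fun k => q ^ k) n = 1 - q ^ n)%C.
Proof. induction n as [|n IH]; [simpl; ring|]. simpl csum. rewrite Cpow_S, Cmult_plus_distr_l, IH. ring. Qed.

(** Convergence of a power series through the partial sums [csum], which have [n] terms. *)
Definition pser (a : nat -> C) (z l : C) : Prop :=
  forall e, 0 < e -> exists N, forall n, (N <= n)%nat ->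
    Cmod (csum (fun k => a k * z ^ k)%C n - l) < e.

Lemma pow_n_Cpow (z : C) k : @pow_n C_Ring z k = Cpow z k.
Proof. induction k as [|k IH]; [reflexivity|]. rewrite Cpow_S, <- IH. reflexivity. Qed.

Lemma sum_n_csum (f : nat -> C) n : @sum_n C_AbelianMonoid f n = csum f (S n).
Proof.
  induction n as [|n IH].
  - rewrite sum_O. simpl. ring.
  - rewrite sum_Sn, IH. reflexivity.
Qed.

Lemma has_expansion_pser (a : nat -> C) (z l : C) : has_expansion a z l <-> pser a z l.
Proof.
  unfold has_expansion, is_pseries, is_series.
  assert (E : forall n, @sum_n C_AbelianMonoid
     (fun k => scal (pow_n (K := C_Ring) z k) (a k)) n = csum (fun k => a k * z ^ k)%C (S n)).
  { intros n. rewrite sum_n_csum. apply csum_ext. intros k _.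
    rewrite pow_n_Cpow. apply Cmult_comm. }
  split.
  - intros H e He.
    pose proof (proj1 (filterlim_locally (U := C_UniformSpace) _ l) H) as HB.
    assert (P2 : 0 < sqrt 2) by (apply sqrt_lt_R0; lra).
    assert (He2 : 0 < e / sqrt 2) by (apply Rdiv_lt_0_compat; lra).
    destruct (HB (mkposreal _ He2)) as [N HN]. exists (S N). intros n Hn.
    destruct n as [|n]; [lia|]. specialize (HN n ltac:(lia)).
    apply C_NormedModule_mixin_compat2 in HN. simpl pos in HN.
    replace (sqrt 2 * (e / sqrt 2)) with e in HN by (field; lra).
    rewrite <- E. exact HN.
  - intros H. apply (filterlim_locally (U := C_UniformSpace)). intros e.
    destruct (H e (cond_pos e)) as [N HN]. exists N. intros n Hn.
    apply C_NormedModule_mixin_compat1. specialize (HN (S n) ltac:(lia)).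
    rewrite <- E in HN. exact HN.
Qed.

Definition holo (R : R) (F : C -> C) : Prop := forall z : C, Cmod z < R -> exists l, cder F z l.

Lemma holo_ccont R F z : holo R F -> Cmod z < R -> ccont F z.
Proof. intros H Hz. destruct (H z Hz) as [l Hl]. eapply cder_cont; eauto. Qed.

Lemma holo_der R F z : holo R F -> Cmod z < R -> cder F z (C_derive F z).
Proof. intros H Hz. apply ex_cder. exact (H z Hz). Qed.

Lemma holo_path R F r t : holo R F -> 0 <= r < R -> pcont (fun u => F (RtoC r * cis u)%C) t.
Proof.
  intros H Hr. apply (pcont_chain F (fun u => RtoC r * cis u)%C).
  - apply (holo_ccont R); auto. rewrite Cmod_mult, Cmod_cis, Cmod_R, Rabs_pos_eq; lra.
  - pcont_auto.
Qed.

Lemma Cmod_rcis r t : 0 <= r -> Cmod (RtoC r * cis t) = r.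
Proof. intros. rewrite Cmod_mult, Cmod_cis, Cmod_R, Rabs_pos_eq; lra. Qed.

(** The difference quotient of [F] at [a] is bounded near [a], so its integral over the
    curves [s = constant], which does not depend on [s], tends to [0] with [s]. *)
Lemma cauchy_difference_quotient (F : C -> C) (R r : R) (a : C) :
  holo R F -> 0 < r < R -> Cmod a < r ->
  Cint (fun t => (F (r * cis t) - F a) / (r * cis t - a) * (r * (Ci * cis t)))%C 0 (2 * PI) = 0%C.
Proof.
  intros HF Hr Ha. pose proof PI_RGT_0 as HPI.
  set (phi := fun z => ((F z - F a) / (z - a))%C).
  pose proof (Cmod_ge_0 a) as Pa.
  assert (Hne : forall t, (RtoC r * cis t - a <> 0)%C).
  { intros t. apply Cmod_gt_0. pose proof (Cmod_triang_inv (r * cis t) a) as H.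
    rewrite Cmod_rcis in H; lra. }
  assert (Hdiff : forall s t, 0 < s <= 1 -> (cone a r s t - a <> 0)%C /\ Cmod (cone a r s t) < R).
  { intros s t Hs. split.
    - unfold cone. replace (a + s * (r * cis t - a) - a)%C with (s * (r * cis t - a))%C by ring.
      apply Cmult_neq_0; auto. intros H. apply (f_equal Re) in H. simpl in H. lra.
    - unfold cone. replace (a + s * (r * cis t - a))%C with (RtoC (1 - s) * a + RtoC s * (r * cis t))%C
        by (rewrite RtoC_minus; ring).
      eapply Rle_lt_trans; [apply Cmod_triangle|]. rewrite (Cmod_mult _ a), (Cmod_mult s), Cmod_rcis, !Cmod_R, !Rabs_pos_eq by lra.
      nra. }
  assert (Hphi : forall s t, 0 < s <= 1 -> exists l, cder phi (cone a r s t) l).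
  { intros s t Hs. destruct (Hdiff s t Hs) as [D1 D2]. destruct (HF _ D2) as [l Hl].
    eexists. unfold phi. apply (cder_div (fun z => F z - F a)%C (fun z => z - a)%C); auto.
    - cder_auto.
    - cder_auto. }
  assert (Heq : forall s, 0 < s <= 1 -> coneV phi a r 1 0 (2 * PI) = coneV phi a r s 0 (2 * PI)).
  { intros s Hs.
    assert (G : coneI phi a r (Rect s 1 0 (2 * PI)) = 0%C).
    { apply goursat_cone; simpl; try lra. intros; apply Hphi; lra. }
    unfold coneI in G; simpl in G.
    assert (HH : coneH phi a r (2 * PI) s 1 = coneH phi a r 0 s 1).
    { unfold coneH, cone. rewrite cis_2PI. reflexivity. }
    rewrite HH in G.
    set (h := coneH phi a r 0 s 1) in *. set (v1 := coneV phi a r 1 0 (2 * PI)) in *.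
    set (v := coneV phi a r s 0 (2 * PI)) in *.
    replace v1 with ((h + v1 - h - v) + v)%C by ring. rewrite G. ring. }
  destruct (HF a ltac:(lra)) as [l Hl]. pose proof (proj1 (cder_eps F a l) Hl 1 Rlt_0_1) as [d [Hd HFd]].
  set (M := Cmod l + 1). assert (HM : 0 < M) by (unfold M; generalize (Cmod_ge_0 l); lra).
  assert (Bd : forall s, 0 < s <= 1 -> s * (2 * r) < d ->
      Cmod (coneV phi a r 1 0 (2 * PI)) <= s * (2 * PI * (M * r))).
  { intros s Hs Hsd. rewrite (Heq s Hs).
    replace (s * (2 * PI * (M * r))) with ((2 * PI - 0) * (M * (s * r))) by ring.
    apply Cint_bound; [lra| |].
    - intros t _. apply pcont_mult; [|pcont_auto].
      destruct (Hphi s t Hs) as [l' Hl']. apply (pcont_chain phi).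
      eapply cder_cont; eauto. eapply pder_cont, pder_cone_t.
    - intros t _. rewrite Cmod_mult. apply Rmult_le_compat; try apply Cmod_ge_0.
      + destruct (Hdiff s t Hs) as [D1 D2]. unfold phi. rewrite Cmod_div by auto.
        apply Cmod_gt_0 in D1. apply Rle_div_l; [lra|].
        assert (Dn : Cmod (cone a r s t - a) < d).
        { unfold cone. replace (a + s * (r * cis t - a) - a)%C with (s * (r * cis t - a))%C by ring.
          rewrite Cmod_mult, Cmod_R, Rabs_pos_eq by lra.
          eapply Rle_lt_trans; [|exact Hsd]. apply Rmult_le_compat_l; [lra|].
          eapply Rle_trans; [apply Cmod_triangle|]. rewrite Cmod_opp, Cmod_rcis; lra. }
        specialize (HFd _ Dn).
        set (y := cone a r s t) in *.
        replace (F y - F a)%C with ((F y - F a - l * (y - a)) + l * (y - a))%C by ring.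
        eapply Rle_trans; [apply Cmod_triangle|]. rewrite (Cmod_mult l). unfold M. lra.
      + rewrite !Cmod_mult, Cmod_cis, Cmod_Ci, !Cmod_R, !Rabs_pos_eq; lra. }
  assert (Z : coneV phi a r 1 0 (2 * PI) = 0%C).
  { apply Cmod_eq_0. apply Rle_antisym; [|apply Cmod_ge_0].
    apply Rnot_lt_le. intros Hpos. set (I := Cmod (coneV phi a r 1 0 (2 * PI))) in *.
    set (B := 2 * PI * (M * r)) in *. assert (HB : 0 < B).
    { unfold B. apply Rmult_lt_0_compat; [lra|]. apply Rmult_lt_0_compat; lra. }
    set (s := Rmin 1 (Rmin (d / (4 * r)) (I / (2 * B)))).
    assert (S1 : 0 < d / (4 * r)) by (apply Rdiv_lt_0_compat; lra).
    assert (S2 : 0 < I / (2 * B)) by (apply Rdiv_lt_0_compat; lra).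
    assert (Hs : 0 < s) by (unfold s; repeat apply Rmin_glb_lt; lra).
    assert (s <= 1) by apply Rmin_l.
    assert (s <= d / (4 * r)) by (eapply Rle_trans; [apply Rmin_r|apply Rmin_l]).
    assert (s <= I / (2 * B)) by (eapply Rle_trans; [apply Rmin_r|apply Rmin_r]).
    assert (I <= s * B).
    { apply Bd; [lra|]. apply Rle_lt_trans with (d / (4 * r) * (2 * r)).
      apply Rmult_le_compat_r; lra. replace (d / (4 * r) * (2 * r)) with (d / 2) by (field; lra). lra. }
    assert (s * B <= I / (2 * B) * B) by (apply Rmult_le_compat_r; lra).
    replace (I / (2 * B) * B) with (I / 2) in * by (field; lra). lra. }
  rewrite <- Z. unfold coneV. apply Cint_ext. intros t. unfold phi, cone.
  replace (a + 1 * (r * cis t - a))%C with (r * cis t)%C by ring. ring.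
Qed.

Lemma polar (z : C) : exists t, 0 <= t <= 2 * PI /\ z = (RtoC (Cmod z) * cis t)%C.
Proof.
  pose proof PI_RGT_0 as HPI.
  destruct (Ceq_dec z 0) as [->|Hz].
  { exists 0. split; [lra|]. rewrite Cmod_0. ring. }
  apply Cmod_gt_0 in Hz. set (r := Cmod z) in *. destruct z as [x y].
  assert (Hxy : r * r = x * x + y * y).
  { unfold r, Cmod; simpl. rewrite sqrt_sqrt; [ring|]. clear; nra. }
  assert (Hu : -1 <= x / r <= 1).
  { pose proof (re_le_Cmod (x, y)) as H. simpl in H. fold r in H. apply Rabs_le_between in H.
    split; [apply Rle_div_r|apply Rle_div_l]; lra. }
  assert (Hs : sqrt (1 - (x / r)²) = Rabs y / r).
  { replace (1 - (x / r)²) with ((Rabs y / r)²).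
    apply sqrt_Rsqr. apply Rle_div_r; generalize (Rabs_pos y); lra.
    rewrite !Rsqr_div' , <- Rsqr_abs. unfold Rsqr. rewrite Hxy. field. nra. }
  pose proof (acos_bound (x / r)) as [B1 B2].
  destruct (Rle_dec 0 y) as [Hy|Hy].
  - exists (acos (x / r)). split; [lra|]. unfold cis.
    rewrite cos_acos, sin_acos, Hs, Rabs_pos_eq by auto.
    apply injective_projections; simpl; field; lra.
  - exists (2 * PI - acos (x / r)). split; [lra|]. unfold cis.
    replace (2 * PI - acos (x / r)) with (- acos (x / r) + 2 * INR 1 * PI) by (simpl; ring).
    rewrite cos_period, sin_period, cos_neg, sin_neg, cos_acos, sin_acos, Hs, Rabs_left by lra.
    apply injective_projections; simpl; field; lra.
Qed.

Lemma pcont_Cmod (g : R -> C) t : pcont g t -> continuity_pt (fun u => Cmod (g u)) t.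
Proof.
  intros H e He. destruct (H e He) as [d [Hd Hu]]. exists d. split; auto.
  intros u [_ Hut]. simpl in *. unfold R_dist in *.
  specialize (Hu u Hut). eapply Rle_lt_trans; [|exact Hu].
  apply Rabs_le. pose proof (Cmod_triang_inv (g u) (g t)). pose proof (Cmod_triang_inv (g t) (g u)).
  rewrite (Cmod_sub_sym (g t)) in H1. lra.
Qed.

Lemma circle_max (F : C -> C) (R r : R) : holo R F -> 0 <= r < R ->
  exists z0 : C, Cmod z0 = r /\ forall z : C, Cmod z = r -> Cmod (F z) <= Cmod (F z0).
Proof.
  intros HF Hr. pose proof PI_RGT_0.
  destruct (continuity_ab_maj (fun t => Cmod (F (r * cis t)%C)) 0 (2 * PI)) as [t0 [Ht0 B]]; [lra| |].
  - intros t _. apply pcont_Cmod. eapply holo_path; eauto.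
  - exists (r * cis t0)%C. split; [apply Cmod_rcis; lra|].
    intros z Hz. destruct (polar z) as [t [Ht E]]. rewrite Hz in E. rewrite E. now apply Ht0.
Qed.

Lemma circle_min (F : C -> C) (R r : R) : holo R F -> 0 <= r < R ->
  exists z0 : C, Cmod z0 = r /\ forall z : C, Cmod z = r -> Cmod (F z0) <= Cmod (F z).
Proof.
  intros HF Hr. pose proof PI_RGT_0.
  destruct (continuity_ab_min (fun t => Cmod (F (r * cis t)%C)) 0 (2 * PI)) as [t0 [Ht0 B]]; [lra| |].
  - intros t _. apply pcont_Cmod. eapply holo_path; eauto.
  - exists (r * cis t0)%C. split; [apply Cmod_rcis; lra|].
    intros z Hz. destruct (polar z) as [t [Ht E]]. rewrite Hz in E. rewrite E. now apply Ht0.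
Qed.

(** The [n]-th Fourier coefficient on the circle of radius [r], divided by [r^n]. *)
Definition taylor_coef (F : C -> C) (r : R) (n : nat) : C :=
  (/ RtoC (2 * PI) * Cint (fun t => F (r * cis t) * / (r * cis t) ^ n)%C 0 (2 * PI))%C.

Lemma rcis_neq_0 r t : 0 < r -> (RtoC r * cis t <> 0)%C.
Proof. intros. apply Cmod_gt_0. rewrite Cmod_rcis; lra. Qed.

Lemma RtoC_neq_0 x : x <> 0 -> RtoC x <> 0%C.
Proof. intros H E. apply H. now apply RtoC_inj. Qed.

Lemma cder_inv_pow n (z : C) : z <> 0%C -> cder (fun y => / y ^ n)%C z (- (INR n * / (z ^ n * z)))%C.
Proof.
  intros Hz. eapply cder_val; [|apply cder_inv; [now apply Cpow_nz|apply cder_pow]].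
  cbv beta. pose proof (Cpow_nz z n Hz). destruct n as [|n]; [simpl; field; auto|].
  pose proof (Cpow_nz z n Hz).
  simpl pred. rewrite (Cpow_S z n). field. auto.
Qed.

Lemma pcont_inv_pow r n t : 0 < r -> pcont (fun u => / (r * cis u) ^ n)%C t.
Proof.
  intros Hr. apply (pcont_chain (fun y => / y ^ n)%C (fun u => r * cis u)%C).
  - eapply cder_cont, cder_inv_pow. now apply rcis_neq_0.
  - pcont_auto.
Qed.

Lemma Cint_inv_pow r n : 0 < r -> (0 < n)%nat ->
  Cint (fun t => / (r * cis t) ^ n)%C 0 (2 * PI) = 0%C.
Proof.
  intros Hr Hn. pose proof PI_RGT_0.
  assert (HnC : RtoC (INR n) <> 0%C) by (apply RtoC_neq_0, not_0_INR; lia).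
  assert (HCi : Ci <> 0%C) by (apply Cmod_gt_0; rewrite Cmod_Ci; lra).
  rewrite (Cint_FTC (fun t => - / (INR n * Ci) * / (r * cis t) ^ n)%C).
  - rewrite cis_2PI. ring.
  - lra.
  - intros t _. eapply pder_val; [|apply pder_scal].
    2: apply (pder_chain (fun y => / y ^ n)%C (fun u => r * cis u)%C).
    2: apply cder_inv_pow; now apply rcis_neq_0.
    2: apply pder_scal, pder_cis.
    pose proof (rcis_neq_0 r t Hr) as H1. set (z := (r * cis t)%C) in *.
    replace (r * (Ci * cis t))%C with (Ci * z)%C by (unfold z; ring).
    pose proof (Cpow_nz z n H1). field. auto.
  - intros; now apply pcont_inv_pow.
Qed.

Lemma Cint_const (c : C) a b : a <= b -> Cint (fun _ => c) a b = (RtoC (b - a) * c)%C.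
Proof.
  intros. rewrite (Cint_FTC (fun t => c * RtoC t)%C); auto.
  - rewrite RtoC_minus; ring.
  - intros. eapply pder_val; [|apply pder_scal, pder_RtoC]. ring.
  - intros; apply pcont_const.
Qed.

Lemma pcont_csum (f : nat -> R -> C) n t : (forall k, (k < n)%nat -> pcont (f k) t) ->
  pcont (fun u => csum (fun k => f k u) n) t.
Proof.
  induction n as [|n IH]; intros H; simpl; [apply pcont_const|].
  apply pcont_plus; auto.
Qed.

Lemma Cint_csum (f : nat -> R -> C) n a b : a <= b -> (forall k t, pcont (f k) t) ->
  Cint (fun t => csum (fun k => f k t) n) a b = csum (fun k => Cint (f k) a b) n.
Proof.
  intros Hab H. induction n as [|n IH]; simpl.
  - rewrite Cint_const by auto. ring.
  - rewrite Cint_plus; auto. now rewrite IH. intros; now apply pcont_csum.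
Qed.

Lemma taylor_coef_bound F R r n M : holo R F -> 0 < r < R ->
  (forall z : C, Cmod z = r -> Cmod (F z) <= M) -> Cmod (taylor_coef F r n) * r ^ n <= M.
Proof.
  intros HF Hr HM. pose proof PI_RGT_0. unfold taylor_coef.
  assert (H2 : RtoC (2 * PI) <> 0%C) by (apply RtoC_neq_0; lra).
  rewrite Cmod_mult, Cmod_inv, Cmod_R, Rabs_pos_eq by (auto; lra).
  assert (Pr : 0 < r ^ n) by (apply pow_lt; lra).
  assert (B : Cmod (Cint (fun t => F (r * cis t) * / (r * cis t) ^ n)%C 0 (2 * PI)) <= (2 * PI - 0) * (M / r ^ n)).
  { apply Cint_bound; [lra| |].
    - intros; apply pcont_mult; [eapply holo_path; eauto; lra|apply pcont_inv_pow; lra].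
    - intros t _. rewrite Cmod_mult, Cmod_inv, Cmod_pow, Cmod_rcis by (try apply Cpow_nz, rcis_neq_0; lra).
      apply Rmult_le_compat_r; [left; now apply Rinv_0_lt_compat|]. apply HM, Cmod_rcis; lra. }
  apply Rle_trans with (/ (2 * PI) * ((2 * PI - 0) * (M / r ^ n)) * r ^ n).
  - apply Rmult_le_compat_r; [lra|]. apply Rmult_le_compat_l; auto.
    left; apply Rinv_0_lt_compat; lra.
  - right. field. lra.
Qed.

(** Expand [z / (z - a)] in powers of [a / z] under the integral of the difference quotient,
    which is [0]: the partial sums of the series differ from [F a] by an integral of size
    [(|a| / r)^N]. *)
Lemma cauchy_taylor (F : C -> C) (R r : R) (a : C) :
  holo R F -> 0 < r < R -> Cmod a < r -> pser (taylor_coef F r) a (F a).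
Proof.
  intros HF Hr Ha. pose proof PI_RGT_0 as HPI. pose proof (Cmod_ge_0 a) as Pa.
  assert (H2 : RtoC (2 * PI) <> 0%C) by (apply RtoC_neq_0; lra).
  destruct (circle_max F R r HF ltac:(lra)) as [z0 [Hz0 HM]].
  set (M := Cmod (F z0)) in *.
  assert (Hza : forall t, (RtoC r * cis t - a <> 0)%C).
  { intros t. apply Cmod_gt_0. pose proof (Cmod_triang_inv (r * cis t) a) as H.
    rewrite Cmod_rcis in H; lra. }
  set (v := fun t => ((F (r * cis t) - F a) * (r * cis t) / (r * cis t - a))%C).
  assert (Cz : forall t, pcont (fun u => r * cis u)%C t).
  { intros; pcont_auto. }
  assert (CF : forall t, pcont (fun u => F (r * cis u))%C t) by (intros; eapply holo_path; eauto; lra).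
  assert (Cv : forall t, pcont v t).
  { intros t. unfold v. apply pcont_mult.
    - pcont_auto.
    - apply (pcont_chain Cinv (fun u => r * cis u - a)%C).
      + eapply cder_cont, cder_Cinv, Hza.
      + pcont_auto. }
  assert (Cn : forall n t, pcont (fun u => / (r * cis u) ^ n)%C t) by (intros; apply pcont_inv_pow; lra).
  assert (Iv : Cint v 0 (2 * PI) = 0%C).
  { pose proof (cauchy_difference_quotient F R r a HF Hr Ha) as Z.
    assert (HCi : Ci <> 0%C) by (apply Cmod_gt_0; rewrite Cmod_Ci; lra).
    rewrite (Cint_ext _ (fun t => Ci * v t)%C) in Z.
    2:{ intros t. unfold v. field. apply Hza. }
    rewrite Cint_scal in Z by (auto; lra).
    replace (Cint v 0 (2 * PI)) with (/ Ci * (Ci * Cint v 0 (2 * PI)))%C by (field; auto).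
    rewrite Z. ring. }
  assert (Key : forall N, (0 < N)%nat -> (csum (fun k => taylor_coef F r k * a ^ k) N - F a
      = - (/ RtoC (2 * PI) * Cint (fun t => v t * (a ^ N * / (r * cis t) ^ N)) 0 (2 * PI)))%C).
  { intros N HN.
    assert (E1 : (csum (fun k => taylor_coef F r k * a ^ k) N - F a =
        / RtoC (2 * PI) * csum (fun k => Cint (fun t => a ^ k * ((F (r * cis t) - F a) * / (r * cis t) ^ k)) 0 (2 * PI)) N)%C).
    { rewrite <- csum_scal.
      transitivity (csum (fun k => taylor_coef F r k * a ^ k - (if Nat.eqb k 0 then F a else 0%C))%C N).
      - rewrite csum_minus. f_equal. destruct N as [|N]; [lia|]. clear.
        induction N as [|N IH]; [simpl; ring|]. simpl in *. rewrite <- IH. ring.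
      - apply csum_ext. intros k _. rewrite Cint_scal; [|lra|].
        2: intros; pcont_auto.
        rewrite (Cint_ext _ (fun t => F (r * cis t) * / (r * cis t) ^ k - F a * / (r * cis t) ^ k)%C)
          by (intros; ring).
        rewrite Cint_minus; [|lra| |].
        2,3: intros; pcont_auto.
        rewrite (Cint_scal (F a)); [|lra|auto].
        unfold taylor_coef. destruct k as [|k].
        + simpl Nat.eqb. cbv iota. rewrite (Cint_ext (fun t => / (r * cis t) ^ 0)%C (fun _ => 1%C)).
          2:{ intros; simpl. field. }
          rewrite Cint_const by lra. rewrite Rminus_0_r. simpl Cpow. field. auto.
        + simpl Nat.eqb. cbv iota. rewrite Cint_inv_pow by (lra || lia). ring. }
    rewrite E1. rewrite <- Cint_csum; [|lra|].
    2: intros; pcont_auto.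
    rewrite (Cint_ext _ (fun t => v t - v t * (a ^ N * / (r * cis t) ^ N))%C).
    - rewrite Cint_minus; [rewrite Iv; ring|lra|auto|].
      intros; pcont_auto.
    - intros t. pose proof (rcis_neq_0 r t ltac:(lra)) as Hz. pose proof (Hza t) as Hza'.
      unfold v. set (z := (r * cis t)%C) in *.
      assert (Gm := csum_geom (a / z)%C N).
      rewrite (csum_ext _ (fun k => (F z - F a) * (a / z) ^ k)%C).
      2:{ intros k _. unfold Cdiv. rewrite Cpow_mult_l, Cpow_inv by auto. ring. }
      rewrite csum_scal.
      replace (a ^ N * / z ^ N)%C with ((a / z) ^ N)%C by (unfold Cdiv; rewrite Cpow_mult_l, Cpow_inv by auto; ring).
      transitivity ((F z - F a) * z / (z - a) * (1 - (a / z) ^ N))%C; [|ring].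
      rewrite <- Gm. set (S := csum _ N). field. auto. }
  set (Mv := (M + Cmod (F a)) * r / (r - Cmod a)).
  assert (HMv : 0 <= Mv).
  { unfold Mv. apply Rle_div_r; [lra|]. rewrite Rmult_0_l. apply Rmult_le_pos; [|lra].
    generalize (Cmod_ge_0 (F z0)) (Cmod_ge_0 (F a)); unfold M; lra. }
  assert (Bv : forall t, Cmod (v t) <= Mv).
  { intros t. unfold v, Mv. rewrite Cmod_div, Cmod_mult, Cmod_rcis by (auto; lra).
    pose proof (Cmod_triang_inv (r * cis t) a) as T. rewrite Cmod_rcis in T by lra.
    unfold Rdiv. apply Rmult_le_compat.
    - apply Rmult_le_pos; [apply Cmod_ge_0|lra].
    - left; apply Rinv_0_lt_compat. apply Cmod_gt_0, Hza.
    - apply Rmult_le_compat_r; [lra|]. eapply Rle_trans; [apply Cmod_triangle|].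
      rewrite Cmod_opp. pose proof (HM (r * cis t)%C (Cmod_rcis r t ltac:(lra))). lra.
    - apply Rinv_le_contravar; lra. }
  assert (Bd : forall N, (0 < N)%nat -> Cmod (csum (fun k => taylor_coef F r k * a ^ k)%C N - F a) <= Mv * (Cmod a / r) ^ N).
  { intros N HN. rewrite Key by auto. rewrite Cmod_opp, Cmod_mult, Cmod_inv, Cmod_R, Rabs_pos_eq by (auto; lra).
    apply Rle_trans with (/ (2 * PI) * ((2 * PI - 0) * (Mv * (Cmod a / r) ^ N))).
    - apply Rmult_le_compat_l; [left; apply Rinv_0_lt_compat; lra|].
      apply Cint_bound; [lra| |].
      + intros; pcont_auto.
      + intros t _. rewrite !Cmod_mult, Cmod_inv, !Cmod_pow, Cmod_rcis by (try apply Cpow_nz, rcis_neq_0; lra).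
        apply Rmult_le_compat; auto; try apply Cmod_ge_0.
        * apply Rmult_le_pos; [apply pow_le; lra|]. left; apply Rinv_0_lt_compat, pow_lt; lra.
        * unfold Rdiv. rewrite Rpow_mult_distr, pow_inv. lra.
    - right; field. lra. }
  intros e He.
  destruct (pow_lt_1_zero (Cmod a / r)) with (y := e / (Mv + 1)) as [N HN].
  - rewrite Rabs_pos_eq. apply Rlt_div_l; lra. apply Rle_div_r; lra.
  - apply Rdiv_lt_0_compat; lra.
  - exists (S N). intros n Hn. eapply Rle_lt_trans; [apply Bd; lia|].
    specialize (HN n ltac:(lia)).
    assert (0 <= Cmod a / r) by (apply Rle_div_r; lra).
    rewrite Rabs_pos_eq in HN by now apply pow_le.
    apply Rlt_div_r in HN; [|lra].
    assert (0 <= (Cmod a / r) ^ n) by now apply pow_le. lra.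
Qed.

(** * Power series, derivatives and the maximum principle *)

Lemma le_div_r a b c : 0 < c -> a * c <= b -> a <= b / c.
Proof. intros Hc H. now apply Rle_div_r. Qed.

Lemma pser_unique a (z l l' : C) : pser a z l -> pser a z l' -> l = l'.
Proof.
  intros H H'. apply NNPP. intros Hne.
  assert (Hp : 0 < Cmod (l - l')) by (apply Cmod_gt_0; intros E; apply Hne;
    replace l with ((l - l') + l')%C by ring; rewrite E; ring).
  destruct (H (Cmod (l - l') / 2) ltac:(lra)) as [N HN].
  destruct (H' (Cmod (l - l') / 2) ltac:(lra)) as [N' HN'].
  specialize (HN (max N N') ltac:(lia)). specialize (HN' (max N N') ltac:(lia)).
  set (s := csum _ _) in *.
  pose proof (Cmod_triangle (l - s) (s - l')) as T.
  replace (l - s + (s - l'))%C with (l - l')%C in T by ring.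
  rewrite (Cmod_sub_sym l s) in T. lra.
Qed.

Lemma pser_ext a b z l : (forall n, a n = b n) -> pser a z l -> pser b z l.
Proof.
  intros E H e He. destruct (H e He) as [N HN]. exists N. intros n Hn.
  rewrite (csum_ext _ (fun k => a k * z ^ k)%C); auto. intros; now rewrite E.
Qed.

Lemma pser_minus a b z l m : pser a z l -> pser b z m -> pser (fun n => a n - b n)%C z (l - m)%C.
Proof.
  intros Ha Hb e He. destruct (Ha (e / 2) ltac:(lra)) as [N HN]. destruct (Hb (e / 2) ltac:(lra)) as [N' HN'].
  exists (max N N'). intros n Hn. specialize (HN n ltac:(lia)). specialize (HN' n ltac:(lia)).
  rewrite (csum_ext _ (fun k => a k * z ^ k - b k * z ^ k)%C) by (intros; ring).
  rewrite csum_minus. set (s := csum (fun k => a k * z ^ k)%C n) in *. set (s' := csum (fun k => b k * z ^ k)%C n) in *.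
  replace (s - s' - (l - m))%C with ((s - l) + - (s' - m))%C by ring.
  eapply Rle_lt_trans; [apply Cmod_triangle|]. rewrite Cmod_opp. lra.
Qed.

Lemma csum_pow_0 a n : csum (fun k => a k * 0 ^ k)%C (S n) = a O.
Proof.
  rewrite csum_split. simpl Cpow at 1.
  rewrite (csum_ext _ (fun k => 0 * a (S k))%C).
  - rewrite csum_scal. ring.
  - intros k _. rewrite Cpow_S. ring.
Qed.

Lemma pser_0 a l : pser a 0 l -> l = a O.
Proof.
  intros H. apply (pser_unique a 0); auto.
  intros e He. exists 1%nat. intros [|n] Hn; [lia|]. rewrite csum_pow_0.
  replace (a O - a O)%C with (RtoC 0) by ring. now rewrite Cmod_0.
Qed.

Lemma pser_coef_bound a z l : pser a z l -> exists M, 0 < M /\ forall n, Cmod (a n) * Cmod z ^ n <= M.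
Proof.
  intros H. destruct (H 1 Rlt_0_1) as [N HN].
  assert (Fin : forall m, exists M, 0 < M /\ forall n, (n < m)%nat -> Cmod (a n) * Cmod z ^ n <= M).
  { intros m; induction m as [|m [M [HM0 HM]]].
    - exists 1. split; [lra|]. intros; lia.
    - exists (Rmax M (Cmod (a m) * Cmod z ^ m)). split; [eapply Rlt_le_trans; [exact HM0|apply Rmax_l]|].
      intros n Hn. destruct (Nat.eq_dec n m) as [->|].
      + apply Rmax_r.
      + eapply Rle_trans; [apply HM; lia|apply Rmax_l]. }
  destruct (Fin N) as [M [HM0 HM]]. exists (Rmax M 2). split; [eapply Rlt_le_trans; [exact HM0|apply Rmax_l]|].
  intros n. destruct (Nat.lt_ge_cases n N) as [Hn|Hn].
  - eapply Rle_trans; [apply HM; auto|apply Rmax_l].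
  - eapply Rle_trans; [|apply Rmax_r]. pose proof (HN n Hn) as H1. pose proof (HN (S n) ltac:(lia)) as H2.
    simpl in H2. rewrite <- Cmod_pow, <- Cmod_mult.
    set (s := csum _ n) in *. set (u := (a n * z ^ n)%C) in *.
    replace u with ((s + u - l) + - (s - l))%C by ring.
    eapply Rle_trans; [apply Cmod_triangle|]. rewrite Cmod_opp. lra.
Qed.

Lemma csum_geom_bound (f : nat -> C) K q n : 0 <= K -> 0 <= q < 1 ->
  (forall k, Cmod (f k) <= K * q ^ k) -> Cmod (csum f n) <= K / (1 - q).
Proof.
  intros HK Hq Hf.
  assert (B : Cmod (csum f n) <= K * (1 - q ^ n) / (1 - q)).
  { induction n as [|n IH]; simpl.
    - rewrite Cmod_0. apply Rle_div_r; lra.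
    - eapply Rle_trans; [apply Cmod_triangle|]. specialize (Hf n).
      replace (K * (1 - q * q ^ n) / (1 - q)) with (K * (1 - q ^ n) / (1 - q) + K * q ^ n) by (field; lra).
      lra. }
  eapply Rle_trans; [exact B|]. unfold Rdiv. apply Rmult_le_compat_r.
  - left; apply Rinv_0_lt_compat; lra.
  - assert (0 <= q ^ n) by (apply pow_le; lra). nra.
Qed.

Lemma csum_geom_ex (f : nat -> C) K q : 0 <= q < 1 ->
  (forall k, Cmod (f k) <= K * q ^ k) ->
  exists l, forall e, 0 < e -> exists N, forall n, (N <= n)%nat -> Cmod (csum f n - l) < e.
Proof.
  intros Hq Hf.
  destruct (@ex_series_le R_AbsRing C_R_CompleteNormedModule f (fun k => K * q ^ k)) as [l Hl].
  - intros k. rewrite <- Cmod_norm. apply Hf.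
  - apply (@ex_series_scal R_AbsRing R_NormedModule). apply ex_series_geom. rewrite Rabs_pos_eq; lra.
  - exists l. intros e He.
    pose proof (proj1 (filterlim_locally (U := C_UniformSpace) _ l) Hl) as HB.
    assert (P2 : 0 < sqrt 2) by (apply sqrt_lt_R0; lra).
    assert (He2 : 0 < e / sqrt 2) by (apply Rdiv_lt_0_compat; lra).
    destruct (HB (mkposreal _ He2)) as [N HN]. exists (S N). intros n Hn.
    destruct n as [|n]; [lia|]. specialize (HN n ltac:(lia)).
    apply C_NormedModule_mixin_compat2 in HN. simpl pos in HN.
    replace (sqrt 2 * (e / sqrt 2)) with e in HN by (field; lra).
    rewrite <- sum_n_csum. exact HN.
Qed.

Lemma limit_dist_le (u : nat -> C) (l c : C) B :
  (forall e, 0 < e -> exists N, forall n, (N <= n)%nat -> Cmod (u n - l) < e) ->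
  (exists N, forall n, (N <= n)%nat -> Cmod (u n - c) <= B) -> Cmod (l - c) <= B.
Proof.
  intros H [N' HB]. apply Rnot_lt_le. intros Hlt.
  destruct (H (Cmod (l - c) - B) ltac:(lra)) as [N HN].
  specialize (HN (max N N') ltac:(lia)). specialize (HB (max N N') ltac:(lia)).
  set (x := u (max N N')) in *.
  pose proof (Cmod_triangle (l - x) (x - c)) as T. replace (l - x + (x - c))%C with (l - c)%C in T by ring.
  rewrite (Cmod_sub_sym l x) in T. lra.
Qed.

Lemma pser_tail a z l M rho n : 0 < rho -> 0 <= M ->
  (forall k, Cmod (a k) * rho ^ k <= M) -> Cmod z <= rho / 2 -> pser a z l ->
  Cmod (l - csum (fun k => a k * z ^ k)%C n) <= 2 * M * (Cmod z / rho) ^ n.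
Proof.
  intros Hr HM Ha Hz H. pose proof (Cmod_ge_0 z) as Pz.
  set (q := Cmod z / rho). assert (Hq : 0 <= q <= 1 / 2).
  { unfold q; split; [apply Rle_div_r; lra|apply Rle_div_l; lra]. }
  assert (Pq : 0 <= q ^ n) by (apply pow_le; lra).
  apply (limit_dist_le _ _ _ _ H). exists n. intros m Hm.
  assert (T : forall k, Cmod (a k * z ^ k) <= M * q ^ k).
  { intros k. rewrite Cmod_mult, Cmod_pow. unfold q, Rdiv. rewrite Rpow_mult_distr, pow_inv.
    assert (0 < rho ^ k) by (apply pow_lt; lra). specialize (Ha k).
    assert (0 <= Cmod z ^ k) by (apply pow_le; lra).
    replace (M * (Cmod z ^ k * / rho ^ k)) with ((M / rho ^ k) * Cmod z ^ k) by (field; lra).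
    apply Rmult_le_compat_r; auto. apply Rle_div_r; auto. }
  assert (B : Cmod (csum (fun k => a k * z ^ k)%C m - csum (fun k => a k * z ^ k)%C n) <= 2 * M * (q ^ n - q ^ m)).
  { induction Hm as [|m Hm IH].
    - unfold Rminus. replace (csum _ n - csum _ n)%C with (RtoC 0) by ring. rewrite Cmod_0. nra.
    - simpl csum. set (s := csum _ m) in *. set (s' := csum (fun k => a k * z ^ k)%C n) in *.
      replace (s + a m * z ^ m - s')%C with ((s - s') + a m * z ^ m)%C by ring.
      eapply Rle_trans; [apply Cmod_triangle|]. specialize (T m). simpl pow.
      assert (0 <= q ^ m) by (apply pow_le; lra).
      assert (0 <= M * q ^ m * (1 / 2 - q)) by (repeat apply Rmult_le_pos; lra). lra. }
  assert (0 <= q ^ m) by (apply pow_le; lra). nra.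
Qed.

(** Bernoulli's inequality for [1 / p]. *)
Lemma index_mult_pow_bound p k : 0 < p < 1 -> INR k * p ^ k <= p / (1 - p).
Proof.
  intros Hp. assert (P : 0 < p ^ k) by (apply pow_lt; lra).
  assert (H1 : 0 < / p) by (apply Rinv_0_lt_compat; lra).
  assert (H2 : 1 < / p) by (rewrite <- Rinv_1; apply Rinv_lt_contravar; lra).
  pose proof (poly k (/ p - 1) ltac:(lra)) as B.
  replace (1 + (/ p - 1)) with (/ p) in B by ring. rewrite pow_inv in B.
  apply (Rmult_le_compat_r (p ^ k)) in B; [|lra]. rewrite Rinv_l in B by lra.
  assert (H3 : INR k * p ^ k * (/ p - 1) <= 1) by nra.
  replace (p / (1 - p)) with (/ (/ p - 1)) by (field; lra).
  apply Rmult_le_reg_r with (/ p - 1); [lra|]. rewrite Rinv_l by lra. exact H3.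
Qed.

(** [p] is the arithmetic mean of [1, 1, q], hence at least their geometric mean. *)
Lemma cube_above q : 0 <= q < 1 -> exists p, 0 < p < 1 /\ q <= p * p * p.
Proof.
  intros Hq. exists ((2 + q) / 3). split; [lra|].
  assert (0 <= (1 - q) * (1 - q) * (8 + q)) by (repeat apply Rmult_le_pos; lra). nra.
Qed.

(** Taylor's formula of order one for [z^k], with the crude constant [k^2]; the factor
    [rho^2] is on the left to avoid a negative exponent for [k < 2]. *)
Lemma pow_rem_bound (z w : C) rho k : Cmod z <= rho -> Cmod w <= rho ->
  Cmod (z ^ k - w ^ k) <= INR k * rho ^ pred k * Cmod (z - w) /\
  Cmod (z ^ k - w ^ k - INR k * w ^ pred k * (z - w)) * rho ^ 2 <= INR k * INR k * rho ^ k * Cmod (z - w) ^ 2.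
Proof.
  intros Hz Hw. pose proof (Cmod_ge_0 z) as Pz.
  assert (Pr : 0 <= rho) by lra. set (h := Cmod (z - w)). assert (Ph : 0 <= h) by apply Cmod_ge_0.
  induction k as [|k [I1 I2]].
  - simpl. split.
    + replace (1 - 1)%C with (RtoC 0) by ring. rewrite Cmod_0. lra.
    + replace (1 - 1 - 0 * 1 * (z - w))%C with (RtoC 0) by ring. rewrite Cmod_0. lra.
  - pose proof (pos_INR k) as Pk. rewrite S_INR. simpl pred.
    assert (Prk : 0 <= rho ^ k) by (apply pow_le; lra).
    assert (E0 : INR k * rho ^ pred k * rho = INR k * rho ^ k).
    { destruct k; [simpl; ring|simpl pred; simpl pow; ring]. }
    assert (Wk : Cmod (w ^ k) <= rho ^ k).
    { rewrite Cmod_pow. apply pow_incr. split; auto. apply Cmod_ge_0. }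
    split.
    + rewrite !Cpow_S. replace (z * z ^ k - w * w ^ k)%C with (z * (z ^ k - w ^ k) + (z - w) * w ^ k)%C by ring.
      eapply Rle_trans; [apply Cmod_triangle|]. rewrite !Cmod_mult. fold h.
      assert (Cmod z * Cmod (z ^ k - w ^ k) <= rho * (INR k * rho ^ pred k * h)).
      { apply Rmult_le_compat; auto; apply Cmod_ge_0. }
      assert (h * Cmod (w ^ k) <= h * rho ^ k) by (apply Rmult_le_compat_l; auto).
      replace ((INR k + 1) * rho ^ k * h) with (INR k * rho ^ pred k * rho * h + h * rho ^ k) by (rewrite E0; ring). lra.
    + rewrite !Cpow_S.
      replace (z * z ^ k - w * w ^ k - (INR k + 1)%R * w ^ k * (z - w))%C with
        (z * (z ^ k - w ^ k - INR k * w ^ pred k * (z - w)) + INR k * w ^ pred k * (z - w) * (z - w))%C.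
      2:{ rewrite RtoC_plus. destruct k; [simpl; ring|]. simpl pred. rewrite !Cpow_S. ring. }
      apply Rle_trans with ((rho * Cmod (z ^ k - w ^ k - INR k * w ^ pred k * (z - w)) + INR k * rho ^ pred k * h * h) * rho ^ 2).
      * apply Rmult_le_compat_r; [nra|]. eapply Rle_trans; [apply Cmod_triangle|]. rewrite !Cmod_mult, Cmod_R, (Rabs_pos_eq (INR k)) by auto.
        fold h. apply Rplus_le_compat.
        -- apply Rmult_le_compat_r; auto. apply Cmod_ge_0.
        -- apply Rmult_le_compat_r; auto. apply Rmult_le_compat_r; auto. apply Rmult_le_compat_l; auto.
           rewrite Cmod_pow. apply pow_incr. split; auto. apply Cmod_ge_0.
      * set (X := Cmod (z ^ k - w ^ k - INR k * w ^ pred k * (z - w))) in *.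
        replace ((rho * X + INR k * rho ^ pred k * h * h) * rho ^ 2) with
          (rho * (X * rho ^ 2) + (INR k * rho ^ pred k * rho) * rho * h ^ 2) by ring.
        rewrite E0. simpl pow. simpl pow in I2.
        assert (rho * (X * (rho * (rho * 1))) <= rho * (INR k * INR k * rho ^ k * (h * (h * 1)))) by (apply Rmult_le_compat_l; auto).
        assert (0 <= rho * rho ^ k * (h * h)).
        { repeat apply Rmult_le_pos; auto. }
        nra.
Qed.

(** Differentiation term by term: the remainders of order one of the terms sum to [O(|y -
    z0|^2)]. *)
Lemma pser_cder a F M rho z0 : 0 <= M ->
  (forall k, Cmod (a k) * rho ^ k <= M) -> (forall z : C, Cmod z < rho -> pser a z (F z)) ->
  Cmod z0 < rho -> exists d, cder F z0 d /\ pser (fun n => INR (S n) * a (S n))%C z0 d.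
Proof.
  intros HM Ha HF Hz. pose proof (Cmod_ge_0 z0) as Pz0.
  set (r1 := (Cmod z0 + rho) / 2). assert (Hr1 : Cmod z0 < r1 < rho) by (unfold r1; lra).
  assert (Hq : 0 <= r1 / rho < 1).
  { split; [apply Rle_div_r; lra|apply Rlt_div_l; lra]. }
  (* one factor p^k makes the series geometric, the other two absorb the factors k *)
  destruct (cube_above _ Hq) as [p [Hp Hqp]].
  set (Kp := p / (1 - p)). assert (HKp : 0 <= Kp) by (apply Rle_div_r; lra).
  assert (A3 : forall k, Cmod (a k) * r1 ^ k <= M * (p ^ k * p ^ k * p ^ k)).
  { intros k. rewrite <- !Rpow_mult_distr.
    assert (E : r1 ^ k = rho ^ k * (r1 / rho) ^ k) by (rewrite <- Rpow_mult_distr; f_equal; field; lra).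
    rewrite E, <- Rmult_assoc. apply Rmult_le_compat; auto.
    - apply Rmult_le_pos; [apply Cmod_ge_0|apply pow_le; lra].
    - apply pow_le; lra.
    - apply pow_incr; lra. }
  assert (Pk : forall k, 0 < p ^ k) by (intros; apply pow_lt; lra).
  assert (Pr : forall k, 0 < r1 ^ k) by (intros; apply pow_lt; lra).
  assert (A2 : forall k, INR k * INR k * (Cmod (a k) * r1 ^ k) <= M * Kp * Kp * p ^ k).
  { intros k. pose proof (index_mult_pow_bound p k Hp) as B. fold Kp in B. pose proof (pos_INR k) as PI.
    eapply Rle_trans; [apply Rmult_le_compat_l; [nra|apply A3]|].
    replace (INR k * INR k * (M * (p ^ k * p ^ k * p ^ k))) with (M * ((INR k * p ^ k) * (INR k * p ^ k)) * p ^ k) by ring.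
    specialize (Pk k). rewrite (Rmult_assoc M Kp Kp).
    apply Rmult_le_compat_r; [lra|]. apply Rmult_le_compat_l; auto.
    apply Rmult_le_compat; auto; apply Rmult_le_pos; auto; lra. }
  assert (A1 : forall k, INR k * (Cmod (a k) * r1 ^ k) <= M * Kp * Kp * p ^ k).
  { intros [|k].
    - simpl INR. rewrite Rmult_0_l. specialize (Pk O). apply Rmult_le_pos; [|lra]. now repeat (apply Rmult_le_pos; [|assumption]).
    - eapply Rle_trans; [|apply A2]. apply Rmult_le_compat_r.
      + apply Rmult_le_pos; [apply Cmod_ge_0|left; apply Pr].
      + rewrite S_INR. pose proof (pos_INR k). nra. }
  destruct (csum_geom_ex (fun k => INR (S k) * a (S k) * z0 ^ k)%C (M * Kp * Kp * p / r1) p) as [d Hd]; [lra| |].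
  { intros k. rewrite !Cmod_mult, Cmod_R, Rabs_pos_eq, Cmod_pow by apply pos_INR.
    specialize (A1 (S k)). simpl pow in A1.
    apply Rle_trans with (INR (S k) * Cmod (a (S k)) * r1 ^ k).
    - apply Rmult_le_compat_l; [apply Rmult_le_pos; [apply pos_INR|apply Cmod_ge_0]|]. apply pow_incr; lra.
    - replace (M * Kp * Kp * p / r1 * p ^ k) with ((M * Kp * Kp * (p * p ^ k)) / r1) by (field; lra).
      apply le_div_r; lra. }
  exists d. split; [|exact Hd].
  apply (cder_quad _ _ _ (M * Kp * Kp / (1 - p) / r1 ^ 2) (r1 - Cmod z0)); [lra|].
  intros y Hy.
  assert (Hy1 : Cmod y < r1).
  { pose proof (Cmod_triangle (y - z0) z0) as T. replace (y - z0 + z0)%C with y in T by ring. lra. }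
  set (h := Cmod (y - z0)) in *.
  replace (F y - F z0 - d * (y - z0))%C with ((F y - F z0 - d * (y - z0)) - 0)%C by ring.
  apply (limit_dist_le (fun n => csum (fun k => a k * y ^ k)%C (S n) - csum (fun k => a k * z0 ^ k)%C (S n)
     - csum (fun k => INR (S k) * a (S k) * z0 ^ k)%C n * (y - z0))%C).
  - intros e He.
    destruct (HF y ltac:(lra) (e / 3) ltac:(lra)) as [N1 H1].
    destruct (HF z0 ltac:(lra) (e / 3) ltac:(lra)) as [N2 H2].
    assert (Ph : 0 <= h) by apply Cmod_ge_0.
    destruct (Hd (e / 3 / (h + 1)) ltac:(apply Rdiv_lt_0_compat; lra)) as [N3 H3].
    exists (max N1 (max N2 N3)). intros n Hn.
    specialize (H1 (S n) ltac:(lia)). specialize (H2 (S n) ltac:(lia)). specialize (H3 n ltac:(lia)).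
    set (s1 := csum (fun k => a k * y ^ k)%C (S n)) in *. set (s2 := csum (fun k => a k * z0 ^ k)%C (S n)) in *.
    set (s3 := csum (fun k => INR (S k) * a (S k) * z0 ^ k)%C n) in *.
    replace (s1 - s2 - s3 * (y - z0) - (F y - F z0 - d * (y - z0)))%C with
      ((s1 - F y) + (- (s2 - F z0) + - ((s3 - d) * (y - z0))))%C by ring.
    eapply Rle_lt_trans; [apply Cmod_triangle|].
    eapply Rle_lt_trans; [apply Rplus_le_compat_l, Cmod_triangle|]. rewrite !Cmod_opp, Cmod_mult. fold h.
    assert (Cmod (s3 - d) * h <= e / 3).
    { apply Rle_trans with (e / 3 / (h + 1) * h).
      - apply Rmult_le_compat_r; lra.
      - replace (e / 3 / (h + 1) * h) with (e / 3 * (h / (h + 1))) by (field; lra).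
        assert (h / (h + 1) <= 1) by (apply Rle_div_l; lra). nra. }
    lra.
  - exists O. intros n _.
    assert (E : (csum (fun k => a k * y ^ k) (S n) - csum (fun k => a k * z0 ^ k) (S n)
     - csum (fun k => INR (S k) * a (S k) * z0 ^ k) n * (y - z0) - 0)%C =
       csum (fun k => a k * (y ^ k - z0 ^ k - INR k * z0 ^ pred k * (y - z0)))%C (S n)).
    { rewrite (csum_ext (fun k => a k * (y ^ k - z0 ^ k - INR k * z0 ^ pred k * (y - z0)))%C
        (fun k => (a k * y ^ k - a k * z0 ^ k) - (y - z0) * (INR k * a k * z0 ^ pred k))%C) by (intros; ring).
      rewrite csum_minus, csum_minus, csum_scal.
      rewrite (csum_split (fun k => INR k * a k * z0 ^ pred k)%C). simpl pred. simpl INR at 2. ring. }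
    rewrite E.
    assert (Ph2 : 0 <= h ^ 2) by apply pow2_ge_0.
    eapply Rle_trans; [apply (csum_geom_bound _ (M * Kp * Kp / r1 ^ 2 * h ^ 2) p)|].
    + apply Rmult_le_pos; auto. apply Rle_div_r; [apply Pr|]. rewrite Rmult_0_l.
      apply Rmult_le_pos; [now apply Rmult_le_pos|auto].
    + lra.
    + intros k. rewrite Cmod_mult.
      destruct (pow_rem_bound y z0 r1 k ltac:(lra) ltac:(lra)) as [_ B]. fold h in B.
      replace (M * Kp * Kp / r1 ^ 2 * h ^ 2 * p ^ k) with ((M * Kp * Kp * p ^ k * h ^ 2) / r1 ^ 2)
        by (field; lra).
      apply le_div_r; [apply Pr|].
      set (X := Cmod (y ^ k - z0 ^ k - INR k * z0 ^ pred k * (y - z0))) in *.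
      apply Rle_trans with (Cmod (a k) * (INR k * INR k * r1 ^ k * h ^ 2)).
      * rewrite Rmult_assoc. apply Rmult_le_compat_l; [apply Cmod_ge_0|exact B].
      * specialize (A2 k). nra.
    + right. field. lra.
Qed.

Lemma holo_pser R F r : holo R F -> 0 < r < R ->
  exists a M, 0 <= M /\ (forall k, Cmod (a k) * r ^ k <= M) /\ forall z : C, Cmod z < r -> pser a z (F z).
Proof.
  intros HF Hr. destruct (circle_max F R r HF ltac:(lra)) as [z0 [_ HM]].
  exists (taylor_coef F r), (Cmod (F z0)). split; [apply Cmod_ge_0|]. split.
  - intros k. apply (taylor_coef_bound F R); auto.
  - intros z Hz. apply (cauchy_taylor F R); auto.
Qed.

Lemma derived_coef_bound a M r r' : 0 <= M -> 0 < r' < r -> (forall k, Cmod (a k) * r ^ k <= M) ->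
  exists M', 0 <= M' /\ forall k, Cmod (INR (S k) * a (S k)) * r' ^ k <= M'.
Proof.
  intros HM Hr Ha. set (q := r' / r). assert (Hq : 0 < q < 1).
  { unfold q; split; [apply Rdiv_lt_0_compat; lra|apply Rlt_div_l; lra]. }
  assert (HK : 0 <= q / (1 - q)) by (apply Rle_div_r; lra).
  exists (M * (q / (1 - q)) / r'). split.
  - apply Rle_div_r; [lra|]. rewrite Rmult_0_l. now apply Rmult_le_pos.
  - intros k. apply le_div_r; [lra|]. rewrite Cmod_mult, Cmod_R, Rabs_pos_eq by apply pos_INR.
    pose proof (index_mult_pow_bound q (S k) Hq) as B. specialize (Ha (S k)).
    replace (INR (S k) * Cmod (a (S k)) * r' ^ k * r') with ((Cmod (a (S k)) * r ^ S k) * (INR (S k) * q ^ S k)).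
    + apply Rmult_le_compat; auto.
      * apply Rmult_le_pos; [apply Cmod_ge_0|apply pow_le; lra].
      * apply Rmult_le_pos; [apply pos_INR|apply pow_le; lra].
    + unfold q, Rdiv. rewrite Rpow_mult_distr, pow_inv.
      assert (r ^ S k <> 0) by (apply pow_nonzero; lra).
      replace (r' ^ S k) with (r' ^ k * r') by (simpl; ring). field. auto.
Qed.

(** The derivative is again the sum of a power series on a smaller disc. *)
Lemma holo_C_derive R F : holo R F -> holo R (C_derive F).
Proof.
  intros HF z Hz. pose proof (Cmod_ge_0 z).
  destruct (holo_pser R F ((Cmod z + 2 * R) / 3) HF) as (a & M & HM & Ha & HS); [lra|].
  set (r := (Cmod z + 2 * R) / 3) in *.
  destruct (derived_coef_bound a M r ((2 * Cmod z + R) / 3) HM) as (M' & HM' & Hb); [unfold r; lra|auto|].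
  set (r' := (2 * Cmod z + R) / 3) in *.
  destruct (pser_cder (fun n => INR (S n) * a (S n))%C (C_derive F) M' r' z HM' Hb) as [d [Hd _]].
  - intros y Hy. destruct (pser_cder a F M r y HM Ha HS) as [d [D1 D2]]; [unfold r, r' in *; lra|].
    rewrite (cder_unique _ _ _ D1). exact D2.
  - unfold r'; lra.
  - now exists d.
Qed.

(** The quotient [(F(z) - F(0)) / z], with its removable singularity filled in. *)
Definition divz (F : C -> C) (z : C) : C :=
  if Ceq_dec z 0 then C_derive F 0 else ((F z - F 0%C) / z)%C.

Lemma divz_eq F (z : C) : F z = (F 0%C + z * divz F z)%C.
Proof.
  unfold divz. destruct (Ceq_dec z 0) as [->|Hz]; [ring|field; auto].
Qed.

Lemma pser_shift a (z l : C) : z <> 0%C -> pser a z l -> pser (fun n => a (S n)) z ((l - a O) / z)%C.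
Proof.
  intros Hz H e He. pose proof (proj1 (Cmod_gt_0 z) Hz) as Pz.
  destruct (H (e * Cmod z) ltac:(nra)) as [N HN]. exists N. intros n Hn.
  specialize (HN (S n) ltac:(lia)). rewrite csum_split in HN. simpl Cpow at 1 in HN.
  rewrite (csum_ext (fun k => a (S k) * z ^ S k)%C (fun k => z * (a (S k) * z ^ k))%C) in HN
    by (intros; rewrite Cpow_S; ring).
  rewrite csum_scal in HN. set (s := csum _ n) in *.
  replace (a O * 1 + z * s - l)%C with (z * (s - (l - a O) / z))%C in HN by (field; auto).
  rewrite Cmod_mult in HN. nra.
Qed.

(** At the origin the quotient is the sum of the shifted Taylor series. *)
Lemma holo_divz R F : holo R F -> holo R (divz F).
Proof.
  intros HF z Hz. destruct (Ceq_dec z 0) as [->|Hz0].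
  - rewrite Cmod_0 in Hz.
    destruct (holo_pser R F (R / 2) HF ltac:(lra)) as (a & M & HM & Ha & HS).
    assert (a0 : F 0%C = a O). { apply pser_0, HS. rewrite Cmod_0; lra. }
    destruct (pser_cder a F M (R / 2) 0 HM Ha HS) as [d [D1 D2]]; [rewrite Cmod_0; lra|].
    assert (a1 : d = a 1%nat). { rewrite (pser_0 _ _ D2). simpl. ring. }
    destruct (pser_cder (fun n => a (S n)) (divz F) (M / (R / 2)) (R / 2) 0) as [d' [D' _]].
    + apply Rle_div_r; lra.
    + intros k. apply le_div_r; [lra|]. specialize (Ha (S k)). simpl pow in Ha. lra.
    + intros y Hy. unfold divz. destruct (Ceq_dec y 0) as [->|Hy0].
      * rewrite (cder_unique _ _ _ D1), a1. intros e He. exists 1%nat. intros [|n] Hn; [lia|].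
        rewrite (csum_pow_0 (fun n => a (S n))).
        replace (a 1%nat - a 1%nat)%C with (RtoC 0) by ring. now rewrite Cmod_0.
      * rewrite a0. apply pser_shift; auto.
    + rewrite Cmod_0; lra.
    + now exists d'.
  - destruct (HF z Hz) as [l Hl]. eexists.
    apply (cder_ext_near (fun y => (F y - F 0%C) / y)%C _ _ _ (Cmod z)).
    + now apply Cmod_gt_0.
    + intros y Hy. unfold divz. destruct (Ceq_dec y 0) as [->|]; auto.
      exfalso. replace (0 - z)%C with (- z)%C in Hy by ring. rewrite Cmod_opp in Hy. lra.
    + apply cder_div; [exact Hz0| |apply cder_id]. apply cder_minus; [exact Hl|apply cder_const].
Qed.

Lemma holo_mult R F G : holo R F -> holo R G -> holo R (fun z => F z * G z)%C.
Proof. intros HF HG z Hz. destruct (HF z Hz), (HG z Hz). eexists. apply cder_mult; eauto. Qed.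

Lemma holo_plus R F G : holo R F -> holo R G -> holo R (fun z => F z + G z)%C.
Proof. intros HF HG z Hz. destruct (HF z Hz), (HG z Hz). eexists. apply cder_plus; eauto. Qed.

Lemma holo_minus R F G : holo R F -> holo R G -> holo R (fun z => F z - G z)%C.
Proof. intros HF HG z Hz. destruct (HF z Hz), (HG z Hz). eexists. apply cder_minus; eauto. Qed.

Lemma holo_const R c : holo R (fun _ => c).
Proof. intros z _. eexists. apply cder_const. Qed.

Lemma holo_id R : holo R (fun z => z).
Proof. intros z _. eexists. apply cder_id. Qed.

Lemma holo_inv R F : holo R F -> (forall z : C, Cmod z < R -> F z <> 0%C) -> holo R (fun z => / F z)%C.
Proof. intros HF Hn z Hz. destruct (HF z Hz). eexists. apply cder_inv; eauto. Qed.

Lemma holo_pow R F n : holo R F -> holo R (fun z => F z ^ n)%C.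
Proof.
  intros HF z Hz. destruct (HF z Hz) as [l Hl]. eexists. apply (cder_comp (fun y => y ^ n)%C F); eauto.
  apply cder_pow.
Qed.

Lemma pow_le_const_imp (x K : R) : 0 <= x -> (forall n : nat, x ^ n <= K) -> x <= 1.
Proof.
  intros Hx H. apply Rnot_lt_le. intros H1.
  destruct (Pow_x_infinity x ltac:(rewrite Rabs_pos_eq; lra) (K + 1)) as [N HN].
  specialize (HN N (le_n N)). rewrite Rabs_pos_eq in HN by now apply pow_le. specialize (H N). lra.
Qed.

(** The Taylor series gives [|F(a)| <= M / (1 - |a| / r)]. Applied to the powers of [F] this
    is [(|F(a)| / M)^n <= 1 / (1 - |a| / r)] for all [n], which forces [|F(a)| <= M]. *)
Lemma max_principle R F r M (a : C) : holo R F -> 0 < r < R ->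
  (forall z : C, Cmod z = r -> Cmod (F z) <= M) -> Cmod a <= r -> Cmod (F a) <= M.
Proof.
  intros HF Hr HM Ha.
  destruct (Req_dec (Cmod a) r) as [E|E]; [now apply HM|].
  assert (Ha' : Cmod a < r) by lra. clear Ha E. pose proof (Cmod_ge_0 a) as Pa.
  assert (HM0 : 0 <= M).
  { eapply Rle_trans; [|apply (HM (r * cis 0)%C), Cmod_rcis; lra]. apply Cmod_ge_0. }
  assert (Hq : 0 <= Cmod a / r < 1) by (split; [apply Rle_div_r; lra|apply Rlt_div_l; lra]).
  set (q := Cmod a / r) in *.
  assert (B : forall n, Cmod (F a) ^ n <= M ^ n / (1 - q)).
  { intros n. rewrite <- Cmod_pow.
    pose proof (holo_pow R F n HF) as HFn.
    pose proof (cauchy_taylor _ R r a HFn Hr Ha') as S. simpl in S.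
    replace (F a ^ n)%C with (F a ^ n - 0)%C by ring.
    apply (limit_dist_le _ _ _ _ S). exists O. intros m _.
    replace (csum (fun k => taylor_coef (fun z => F z ^ n)%C r k * a ^ k)%C m - 0)%C with
     (csum (fun k => taylor_coef (fun z => F z ^ n)%C r k * a ^ k)%C m) by ring.
    apply csum_geom_bound; auto; [now apply pow_le|].
    intros k. rewrite Cmod_mult, Cmod_pow. unfold q, Rdiv. rewrite Rpow_mult_distr, pow_inv.
    assert (Pr : 0 < r ^ k) by (apply pow_lt; lra).
    pose proof (taylor_coef_bound (fun z => F z ^ n)%C R r k (M ^ n) HFn Hr) as A.
    assert (A' : Cmod (taylor_coef (fun z => F z ^ n)%C r k) * r ^ k <= M ^ n).
    { apply A. intros z Hz. rewrite Cmod_pow. apply pow_incr. split; [apply Cmod_ge_0|auto]. }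
    assert (0 <= Cmod a ^ k) by now apply pow_le.
    replace (M ^ n * (Cmod a ^ k * / r ^ k)) with (M ^ n / r ^ k * Cmod a ^ k) by (field; lra).
    apply Rmult_le_compat_r; auto. apply Rle_div_r; auto. }
  destruct (Req_dec M 0) as [->|HMn].
  - specialize (B 1%nat). simpl in B. rewrite Rmult_0_l in B. unfold Rdiv in B. lra.
  - assert (HMp : 0 < M) by lra. pose proof (Cmod_ge_0 (F a)) as PF.
    assert (X : Cmod (F a) / M <= 1).
    { apply (pow_le_const_imp _ (/ (1 - q))); [apply Rle_div_r; lra|].
      intros n. specialize (B n). unfold Rdiv. rewrite Rpow_mult_distr, pow_inv.
      assert (0 < M ^ n) by now apply pow_lt. fold (Rdiv (Cmod (F a) ^ n) (M ^ n)).
      apply Rle_div_l; auto. unfold Rdiv in B. lra. }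
    apply Rle_div_l in X; lra.
Qed.

(** The maximum principle for [w(z) / z] on circles of radius close to [1]. *)
Lemma schwarz R (w : C -> C) : holo 1 w -> (forall z : C, Cmod z < 1 -> Cmod (w z) <= R) -> 0 <= R ->
  w 0%C = 0%C -> forall z : C, Cmod z < 1 -> Cmod (w z) <= R * Cmod z.
Proof.
  intros Hw Hb HR H0 z Hz. pose proof (holo_divz 1 w Hw) as Hd.
  pose proof (Cmod_ge_0 z) as Pz.
  assert (B : forall r, Cmod z < r < 1 -> Cmod (divz w z) <= R / r).
  { intros r Hr. apply (max_principle 1 (divz w) r); auto; try lra.
    intros y Hy. unfold divz. destruct (Ceq_dec y 0) as [->|Hy0]; [rewrite Cmod_0 in Hy; lra|].
    rewrite H0. replace (w y - 0)%C with (w y) by ring. rewrite Cmod_div, Hy by auto.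
    unfold Rdiv. apply Rmult_le_compat_r; [left; apply Rinv_0_lt_compat; lra|]. apply Hb; lra. }
  rewrite (divz_eq w z), H0. replace (0 + z * divz w z)%C with (divz w z * z)%C by ring.
  rewrite Cmod_mult. apply Rmult_le_compat_r; auto.
  apply Rnot_lt_le. intros Hlt. set (X := Cmod (divz w z)) in *.
  assert (HX : 0 < X) by lra.
  assert (Hx1 : R / X < 1) by (apply Rlt_div_l; lra).
  set (r := (1 + Rmax (Cmod z) (R / X)) / 2).
  assert (Hm : Rmax (Cmod z) (R / X) < 1) by (apply Rmax_lub_lt; auto).
  pose proof (Rmax_l (Cmod z) (R / X)). pose proof (Rmax_r (Cmod z) (R / X)).
  specialize (B r ltac:(unfold r; lra)).
  assert (Hr : R / X < r) by (unfold r; lra).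
  assert (0 < r) by (unfold r; lra).
  clearbody r. apply Rlt_div_l in Hr; [|lra]. apply Rle_div_r in B; [|lra]. lra.
Qed.

(** * Injective maps, the lemma of Jack and subordination *)

(** A local property of scale [d] around each point of a closed disc holds with a common
    scale on a neighbourhood of the disc. *)
Lemma disc_compact (Q : R -> C -> Prop) (sigma : R) : 0 <= sigma ->
  (forall d d' y, d' <= d -> Q d y -> Q d' y) ->
  (forall z : C, Cmod z <= sigma -> exists d, 0 < d /\ forall y : C, Cmod (y - z) < d -> Q d y) ->
  exists e, 0 < e /\ forall y : C, Cmod y < sigma + e -> Q e y.
Proof.
  intros Hs Hmon Hloc.
  assert (Hd : forall z : C, exists d : posreal,
     (Cmod z <= sigma -> forall y : C, Cmod (y - z) < 4 * d -> Q d y) /\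
     (sigma < Cmod z -> 2 * d <= Cmod z - sigma)).
  { intros z. destruct (Rle_lt_dec (Cmod z) sigma) as [H|H].
    - destruct (Hloc z H) as [d [Hd HQ]]. assert (Hd4 : 0 < d / 4) by lra.
      exists (mkposreal _ Hd4). simpl. split; [|lra]. intros _ y Hy. apply (Hmon d); [lra|]. apply HQ; lra.
    - assert (Hp : 0 < (Cmod z - sigma) / 2) by lra. exists (mkposreal _ Hp). simpl. split; lra. }
  set (delta := fun x y => proj1_sig (constructive_indefinite_description _ (Hd (x, y)))).
  destruct (compactness_value_2d (- sigma) sigma (- sigma) sigma delta) as [d Hcomp].
  exists d. split; [apply cond_pos|]. intros y Hy.
  assert (Hy' : exists y' : C, Cmod y' <= sigma /\ Cmod (y - y') < d).
  { destruct (Rle_lt_dec (Cmod y) sigma) as [H|H].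
    - exists y. split; auto. replace (y - y)%C with (RtoC 0) by ring. rewrite Cmod_0. apply cond_pos.
    - assert (Py : Cmod y <> 0) by lra.
      exists (RtoC (sigma / Cmod y) * y)%C. split.
      + rewrite Cmod_mult, Cmod_R, Rabs_pos_eq by (apply le_div_r; lra). right; field; auto.
      + replace (y - RtoC (sigma / Cmod y) * y)%C with (RtoC (1 - sigma / Cmod y) * y)%C by (rewrite RtoC_minus; ring).
        rewrite Cmod_mult, Cmod_R, Rabs_pos_eq.
        * replace ((1 - sigma / Cmod y) * Cmod y) with (Cmod y - sigma) by (field; auto). lra.
        * assert (sigma / Cmod y <= 1) by (apply Rle_div_l; lra). lra. }
  destruct Hy' as [y' [Hy1 Hy2]].
  apply NNPP. intros HnQ.
  pose proof (re_le_Cmod y') as R1. pose proof (im_le_Cmod y') as R2.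
  apply Rabs_le_between in R1. apply Rabs_le_between in R2.
  apply (Hcomp (Re y') (Im y')); [lra|lra|].
  intros (u & v & _ & _ & H1 & H2 & H3). apply HnQ.
  unfold delta in H1, H2, H3.
  destruct (constructive_indefinite_description _ (Hd (u, v))) as [d0 [D1 D2]]. simpl in H1, H2, H3.
  assert (T : Cmod (y' - (u, v)) < 2 * d0).
  { eapply Rle_lt_trans; [apply Cmod_le_abs|]. destruct y' as [a b]. simpl in *. unfold Rminus in *. lra. }
  destruct (Rle_lt_dec (Cmod (u, v)) sigma) as [H|H].
  - apply (Hmon d0); [exact H3|]. apply D1; auto.
    replace (y - (u, v))%C with ((y - y') + (y' - (u, v)))%C by ring.
    eapply Rle_lt_trans; [apply Cmod_triangle|]. pose proof (cond_pos d0). lra.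
  - exfalso. specialize (D2 H). pose proof (Cmod_triang_inv (u, v) ((u, v) - y')) as T2.
    replace ((u, v) - ((u, v) - y'))%C with y' in T2 by ring. rewrite (Cmod_sub_sym (u, v)) in T2. lra.
Qed.

Lemma disc_min_pos (F : C -> C) sigma : holo 1 F -> 0 <= sigma < 1 ->
  (forall z : C, Cmod z <= sigma -> F z <> 0%C) ->
  exists m, 0 < m /\ forall z : C, Cmod z <= sigma -> m <= Cmod (F z).
Proof.
  intros HF Hs Hne.
  destruct (disc_compact (fun m y => m <= Cmod (F y)) sigma) as [e [He H]]; [lra|intros; lra| |].
  - intros z Hz. pose proof (proj1 (Cmod_gt_0 _) (Hne z Hz)) as P.
    destruct (holo_ccont 1 F z HF ltac:(lra) (Cmod (F z) / 2) ltac:(lra)) as [d [Hd HC]].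
    exists (Rmin d (Cmod (F z) / 2)). split; [apply Rmin_glb_lt; lra|].
    intros y Hy. specialize (HC y (Rlt_le_trans _ _ _ Hy (Rmin_l _ _))).
    pose proof (Cmod_triang_inv (F z) (F z - F y)) as T.
    replace (F z - (F z - F y))%C with (F y) in T by ring. rewrite (Cmod_sub_sym (F z)) in T.
    eapply Rle_trans; [apply Rmin_r|]. lra.
  - exists e. split; auto. intros z Hz. apply H. lra.
Qed.

Lemma image_disc_closed (F : C -> C) sigma (v : C) : holo 1 F -> 0 <= sigma < 1 ->
  (forall e, 0 < e -> exists z : C, Cmod z <= sigma /\ Cmod (F z - v) < e) ->
  exists z : C, Cmod z <= sigma /\ F z = v.
Proof.
  intros HF Hs H. apply NNPP. intros Hno.
  destruct (disc_min_pos (fun z => F z - v)%C sigma) as [m [Hm Hmin]]; auto.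
  - apply holo_minus; auto. apply holo_const.
  - intros z Hz E. apply Hno. exists z. split; auto. replace (F z) with ((F z - v) + v)%C by ring. rewrite E. ring.
  - destruct (H m Hm) as [z [Hz Hlt]]. specialize (Hmin z Hz). lra.
Qed.

(** If [Q] misses the value [v] near [z0], then [1 / (Q - v)] is holomorphic there and its
    value at [z0] is at most its maximum on a small circle. Since [Q - Q(z0)] has no zero on
    that circle, this fails for [v] close to [Q(z0)]. *)
Lemma injective_open (Q : C -> C) (z0 : C) r0 : holo 1 Q ->
  (forall z z' : C, Cmod z < 1 -> Cmod z' < 1 -> Q z = Q z' -> z = z') ->
  Cmod z0 < 1 -> 0 < r0 ->
  exists e, 0 < e /\ forall v : C, Cmod (v - Q z0) < e ->
    exists z : C, Cmod z < 1 /\ Cmod (z - z0) < r0 /\ Q z = v.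
Proof.
  intros HQ Hinj Hz0 Hr0.
  set (r1 := Rmin r0 (1 - Cmod z0)).
  assert (Hr1 : 0 < r1) by (apply Rmin_glb_lt; lra).
  assert (Hr1a : r1 <= r0) by apply Rmin_l. assert (Hr1b : r1 <= 1 - Cmod z0) by apply Rmin_r.
  clearbody r1.
  assert (Hin : forall y : C, Cmod y < r1 -> Cmod (z0 + y) < 1).
  { intros y Hy. eapply Rle_lt_trans; [apply Cmod_triangle|]. lra. }
  set (F := fun y => Q (z0 + y)%C).
  assert (HF : holo r1 F).
  { intros y Hy. destruct (HQ (z0 + y)%C (Hin y Hy)) as [l Hl]. eexists.
    apply (cder_comp Q (fun y => z0 + y)%C); eauto. apply cder_plus; [apply cder_const|apply cder_id]. }
  assert (F0 : F 0%C = Q z0) by (unfold F; f_equal; ring).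
  destruct (circle_min (fun y => F y - Q z0)%C r1 (r1 / 2)) as [y1 [Hy1 Hmin]]; [|lra|].
  { apply holo_minus; auto. apply holo_const. }
  set (m := Cmod (F y1 - Q z0)) in *.
  assert (Hm : 0 < m).
  { apply Cmod_gt_0. intros E.
    assert (E' : (z0 + y1)%C = z0).
    { apply Hinj; auto. apply Hin; lra. fold (F y1).
      replace (F y1) with ((F y1 - Q z0) + Q z0)%C by ring. rewrite E. ring. }
    assert (y1 = 0%C) by (replace y1 with ((z0 + y1) - z0)%C by ring; rewrite E'; ring).
    subst y1. rewrite Cmod_0 in Hy1. lra. }
  exists (m / 2). split; [lra|]. intros v Hv. apply NNPP. intros Hno.
  assert (Hne : forall y : C, Cmod y < r1 -> (F y - v)%C <> 0%C).
  { intros y Hy E. apply Hno. exists (z0 + y)%C. split; [now apply Hin|]. split.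
    - replace (z0 + y - z0)%C with y by ring. lra.
    - fold (F y). replace (F y) with ((F y - v) + v)%C by ring. rewrite E. ring. }
  assert (B : Cmod (/ (F 0%C - v)) <= / (m / 2)).
  { apply (max_principle r1 (fun y => / (F y - v))%C (r1 / 2)).
    - apply holo_inv; auto. apply holo_minus; auto. apply holo_const.
    - lra.
    - intros y Hy. rewrite Cmod_inv by (apply Hne; lra). apply Rinv_le_contravar; [lra|].
      specialize (Hmin y Hy). pose proof (Cmod_triang_inv (F y - Q z0) (v - Q z0)) as T.
      replace (F y - Q z0 - (v - Q z0))%C with (F y - v)%C in T by ring. lra.
    - rewrite Cmod_0; lra. }
  assert (Hn0 : (F 0%C - v)%C <> 0%C) by (apply Hne; rewrite Cmod_0; lra).
  rewrite Cmod_inv, F0 in B by auto. rewrite F0 in Hn0. rewrite (Cmod_sub_sym (Q z0)) in B.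
  apply Rinv_lt_contravar in Hv.
  - lra.
  - apply Rmult_lt_0_compat; [|lra]. rewrite Cmod_sub_sym. now apply Cmod_gt_0.
Qed.

Definition disc_inv (Q : C -> C) (v : C) : C := epsilon (inhabits (RtoC 0)) (fun z : C => Cmod z < 1 /\ Q z = v).

Lemma disc_inv_spec Q (z : C) : (forall z z' : C, Cmod z < 1 -> Cmod z' < 1 -> Q z = Q z' -> z = z') ->
  Cmod z < 1 -> disc_inv Q (Q z) = z.
Proof.
  intros Hinj Hz. assert (H : Cmod (disc_inv Q (Q z)) < 1 /\ Q (disc_inv Q (Q z)) = Q z).
  { unfold disc_inv. apply epsilon_spec. now exists z. }
  destruct H. now apply Hinj.
Qed.

(** The inverse is continuous by [injective_open], and then the increment of [Q] is
    comparable with that of its argument. *)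
Lemma disc_inv_cder (Q : C -> C) (z0 : C) : holo 1 Q ->
  (forall z z' : C, Cmod z < 1 -> Cmod z' < 1 -> Q z = Q z' -> z = z') ->
  Cmod z0 < 1 -> C_derive Q z0 <> 0%C ->
  cder (disc_inv Q) (Q z0) (/ C_derive Q z0).
Proof.
  intros HQ Hinj Hz0 Hl. pose proof (holo_der 1 Q z0 HQ Hz0) as HD.
  set (l := C_derive Q z0) in *. pose proof (proj1 (Cmod_gt_0 l) Hl) as Pl.
  rewrite cder_eps in HD |- *. intros e He.
  set (m := Cmod l) in *.
  set (e' := Rmin (m / 2) (e * m * m / 2)).
  assert (Hem : 0 < e * m * m) by (repeat apply Rmult_lt_0_compat; auto).
  assert (He' : 0 < e') by (apply Rmin_glb_lt; lra).
  assert (E1 : e' <= m / 2) by apply Rmin_l. assert (E2 : e' <= e * m * m / 2) by apply Rmin_r.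
  clearbody e'.
  destruct (HD e' He') as [d [Hd Hrem]].
  destruct (injective_open Q z0 d HQ Hinj Hz0 Hd) as [e0 [He0 Hop]].
  exists e0. split; auto. intros v Hv. destruct (Hop v Hv) as [y [Hy [Hyd <-]]].
  rewrite !disc_inv_spec by auto. specialize (Hrem y Hyd).
  replace (y - z0 - / l * (Q y - Q z0))%C with (- (/ l * (Q y - Q z0 - l * (y - z0))))%C by (field; auto).
  rewrite Cmod_opp, Cmod_mult, Cmod_inv by auto. fold m.
  set (a := Cmod (y - z0)) in *. set (b := Cmod (Q y - Q z0)) in *.
  set (x := Cmod (Q y - Q z0 - l * (y - z0))) in *.
  assert (Pa : 0 <= a) by apply Cmod_ge_0.
  assert (L : m * a - x <= b).
  { pose proof (Cmod_triang_inv (l * (y - z0)) (l * (y - z0) - (Q y - Q z0))) as T.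
    replace (l * (y - z0) - (l * (y - z0) - (Q y - Q z0)))%C with (Q y - Q z0)%C in T by ring.
    rewrite (Cmod_sub_sym (l * (y - z0))), (Cmod_mult l) in T. fold m a b x in T. exact T. }
  assert (La : m / 2 * a <= b) by nra.
  apply Rmult_le_reg_l with m; auto. rewrite <- Rmult_assoc, Rinv_r, Rmult_1_l by lra.
  apply Rle_trans with (e * m * m / 2 * a); [nra|]. nra.
Qed.

Lemma pder_Cmod2 (g : R -> C) (t : R) (l : C) : pder g t l ->
  is_derive (fun u => Cmod (g u) ^ 2) t (2 * (Re (g t) * Re l + Im (g t) * Im l)).
Proof.
  intros H. pose proof (pder_Re _ _ _ H) as H1. pose proof (pder_Im _ _ _ H) as H2.
  apply (is_derive_ext (fun u => Re (g u) * Re (g u) + Im (g u) * Im (g u))).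
  - intros u. rewrite Cmod2_alt. simpl. unfold Re, Im. ring.
  - evar_last.
    + apply (is_derive_plus (K := R_AbsRing) (V := R_NormedModule)); apply (is_derive_mult (K := R_AbsRing)); eauto; intros; apply Rmult_comm.
    + unfold plus, mult; simpl. unfold Re, Im. ring.
Qed.

Lemma derive_pos_increase (u : R -> R) t l : is_derive u t l -> 0 < l ->
  forall d, 0 < d -> exists s, 0 < s < d /\ u t < u (t + s).
Proof.
  intros H Hl d Hd. apply is_derive_Reals in H. destruct (H (l / 2) ltac:(lra)) as [dl Hdl].
  set (s := Rmin d dl / 2). pose proof (cond_pos dl).
  assert (0 < Rmin d dl) by (apply Rmin_glb_lt; lra).
  pose proof (Rmin_l d dl). pose proof (Rmin_r d dl).
  exists s. assert (Hs : 0 < s < d /\ s < dl) by (unfold s; lra). split; [lra|].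
  specialize (Hdl s ltac:(lra)). rewrite (Rabs_pos_eq s) in Hdl by lra. specialize (Hdl ltac:(lra)).
  apply Rabs_def2 in Hdl. destruct Hdl as [_ Hdl].
  assert (l / 2 < (u (t + s) - u t) / s) by lra.
  assert (Hs0 : 0 < s) by lra. clearbody s.
  apply Rlt_div_r in H4; [|lra]. assert (0 < l / 2 * s) by (apply Rmult_lt_0_compat; lra). lra.
Qed.

(** Let [G(z) = F(z) / z], and let [z0] be a maximum point of [|G|] on the circle through
    [z1], hence on the closed disc. Then [|G|] does not increase in any direction that
    points into the disc, which makes [z0 G'(z0) / G(z0)] real and nonnegative; the
    multiplier [m] is [1] plus this number. *)
Lemma jack_lemma R0 (F : C -> C) (z1 : C) : holo R0 F -> F 0%C = 0%C -> z1 <> 0%C -> Cmod z1 < R0 ->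
  Cmod z1 < Cmod (F z1) ->
  exists z0 m, Cmod z0 = Cmod z1 /\ Cmod z0 < Cmod (F z0) /\ 1 <= m /\
    (z0 * C_derive F z0)%C = (RtoC m * F z0)%C.
Proof.
  intros HF F0 Hz1 HzR Hgt. pose proof (proj1 (Cmod_gt_0 _) Hz1) as Pz1.
  set (r := Cmod z1) in *. pose proof (holo_divz R0 F HF) as HG. set (G := divz F) in *.
  assert (FG : forall z, F z = (z * G z)%C).
  { intros z. rewrite (divz_eq F z), F0. fold G. ring. }
  destruct (circle_max G R0 r HG ltac:(lra)) as [z0 [Hz0 Hmax]].
  assert (MP : forall z : C, Cmod z <= r -> Cmod (G z) <= Cmod (G z0)).
  { intros z Hz. apply (max_principle R0 G r); auto; lra. }
  assert (G1 : 1 < Cmod (G z0)).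
  { eapply Rlt_le_trans; [|apply (Hmax z1); reflexivity]. rewrite FG, Cmod_mult in Hgt. fold r in Hgt. nra. }
  assert (HG0 : G z0 <> 0%C) by (apply Cmod_gt_0; lra).
  assert (Hz00 : z0 <> 0%C) by (apply Cmod_gt_0; lra).
  pose proof (holo_der R0 G z0 HG ltac:(lra)) as DG. set (l := C_derive G z0) in *.
  set (k := (z0 * l / G z0)%C).
  assert (Hl : l = (k * G z0 / z0)%C) by (unfold k; field; auto).
  (* the direction z0 (-1 + ic) points into the disc whatever c is *)
  assert (Dir : forall c : R, Re (k * (-1, c)%R) <= 0).
  { intros c. apply Rnot_lt_le. intros Hpos.
    set (eta := ((-1, c)%R : C)) in *.
    assert (Dp : is_derive (fun s => Cmod (G (z0 * (1 + eta * RtoC s))%C) ^ 2) 0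
       (2 * (Cmod (G z0) ^ 2 * Re (k * eta)))).
    { evar_last.
      - apply (pder_Cmod2 (fun s => G (z0 * (1 + eta * RtoC s))%C) 0 (l * (z0 * (0 + eta * 1)))%C).
        apply (pder_chain G (fun s => z0 * (1 + eta * RtoC s))%C).
        + replace (z0 * (1 + eta * 0))%C with z0 by ring. exact DG.
        + apply pder_scal, pder_plus; [apply pder_const|apply pder_scal, pder_RtoC].
      - cbv beta. replace (z0 * (1 + eta * 0))%C with z0 by ring.
        replace (l * (z0 * (0 + eta * 1)))%C with (G z0 * (k * eta))%C by (rewrite Hl; field; auto).
        rewrite Cmod2_alt. destruct (k * eta)%C as [p q]. destruct (G z0) as [x y]. simpl. ring. }
    assert (Pc : 0 < 1 / (1 + c ^ 2)) by (apply Rdiv_lt_0_compat; nra).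
    destruct (derive_pos_increase _ _ _ Dp) with (d := 1 / (1 + c ^ 2)) as [s [Hs Hlt]]; auto.
    { apply Rmult_lt_0_compat; [lra|]. apply Rmult_lt_0_compat; auto. apply pow_lt; lra. }
    rewrite Rplus_0_l in Hlt. replace (z0 * (1 + eta * 0))%C with z0 in Hlt by ring.
    assert (Hin : Cmod (z0 * (1 + eta * s)) <= r).
    { rewrite Cmod_mult, Hz0. 
      assert (Cmod (1 + eta * s) <= 1).
      { apply Rsqr_incr_0_var; [|lra]. rewrite !Rsqr_pow2, Cmod2_alt. simpl.
        assert (s * (1 + c ^ 2) < 1).
        { destruct Hs as [Hs1 Hs2]. apply Rlt_div_r in Hs2; [lra|nra]. }
        simpl in H. nra. }
      nra. }
    specialize (MP _ Hin). apply (Rlt_irrefl (Cmod (G z0) ^ 2)). eapply Rlt_le_trans; [exact Hlt|].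
    apply pow_incr. split; auto. apply Cmod_ge_0. }
  assert (Hk : Im k = 0 /\ 0 <= Re k).
  { destruct k as [p q]. simpl in *. split.
    - pose proof (Dir ((p + 1) / q)) as D1. pose proof (Dir (- (p + 1) / q)) as D2.
      destruct (Req_dec q 0) as [|Hq]; auto. exfalso.
      replace (q * (- (p + 1) / q)) with (- (p + 1)) in D2 by (field; auto).
      replace (q * ((p + 1) / q)) with (p + 1) in D1 by (field; auto). lra.
    - pose proof (Dir 0). lra. }
  destruct Hk as [Hk1 Hk2].
  exists z0, (1 + Re k). split; auto. split; [|split; [lra|]].
  - rewrite FG, Cmod_mult, Hz0. nra.
  - assert (DF : cder F z0 (1 * G z0 + z0 * l)%C).
    { apply (cder_ext (fun z => z * G z)%C); [intros; symmetry; apply FG|].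
      apply cder_mult; [apply cder_id|exact DG]. }
    rewrite (cder_unique _ _ _ DF), FG, Hl.
    replace (RtoC (1 + Re k)) with (1 + k)%C.
    + field; auto.
    + destruct k as [p q]. simpl in *. subst q. apply injective_projections; simpl; ring.
Qed.

(** Continuity in the radius. On a disc that [P] maps into [U], [jack_lemma] for [g o P]
    gives [|g(P(z))| <= |z|], for a violation would produce a point that the last hypothesis
    excludes. The largest such disc cannot have radius [rho < 1]: by the closedness
    hypothesis its boundary is still mapped into [U], and then so is a neighbourhood of it.
    *)
Lemma subordination_principle (P g g' : C -> C) (U : C -> Prop) :
  holo 1 P ->
  (forall v, U v -> exists d, 0 < d /\ forall v' : C, Cmod (v' - v) < d -> U v') ->
  (forall v, U v -> cder g v (g' v)) ->
  U (P 0%C) -> g (P 0%C) = 0%C ->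
  (forall sigma v, 0 <= sigma < 1 ->
     (forall e, 0 < e -> exists v', U v' /\ Cmod (g v') <= sigma /\ Cmod (v' - v) < e) -> U v) ->
  (forall (z : C) m, Cmod z < 1 -> U (P z) -> 1 <= m -> Cmod z < Cmod (g (P z)) ->
     (z * (g' (P z) * C_derive P z))%C = (RtoC m * g (P z))%C -> False) ->
  forall z : C, Cmod z < 1 -> U (P z) /\ Cmod (g (P z)) <= Cmod z.
Proof.
  intros HP Hop Hg HU0 Hg0 Hcl Hjack.
  assert (Cl : forall rho, rho <= 1 -> (forall z : C, Cmod z < rho -> U (P z)) ->
     forall z : C, Cmod z < rho -> Cmod (g (P z)) <= Cmod z).
  { intros rho Hrho HU z Hz. apply Rnot_lt_le. intros Hlt.
    assert (Hz0 : z <> 0%C).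
    { intros ->. rewrite Hg0 in Hlt. lra. }
    assert (DF : forall y : C, Cmod y < rho -> cder (fun y => g (P y)) y (g' (P y) * C_derive P y)%C).
    { intros y Hy. apply (cder_comp g P); auto. apply (holo_der 1); auto. lra. }
    destruct (jack_lemma rho (fun y => g (P y)) z) as (z0 & m & E1 & E2 & Hm & E3); auto.
    - intros y Hy. eexists. now apply DF.
    - assert (Hz0' : Cmod z0 < rho) by lra.
      rewrite (cder_unique _ _ _ (DF z0 Hz0')) in E3.
      apply (Hjack z0 m); auto. lra. }
  assert (All : forall z : C, Cmod z < 1 -> U (P z)).
  { apply NNPP. intros Hno.
    destruct (completeness (fun rho => rho <= 1 /\ forall z : C, Cmod z < rho -> U (P z))) as [rho [Ub Lb]].
    - exists 1. intros x [Hx _]; auto.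
    - exists 0. split; [lra|]. intros z Hz. pose proof (Cmod_ge_0 z). lra.
    - assert (R0 : 0 <= rho).
      { apply Ub. split; [lra|]. intros z Hz. pose proof (Cmod_ge_0 z). lra. }
      assert (R1 : rho <= 1) by (apply Lb; intros x [Hx _]; auto).
      assert (Hin : forall z : C, Cmod z < rho -> U (P z)).
      { intros z Hz. apply NNPP. intros HnU.
        assert (rho <= Cmod z); [|lra]. apply Lb. intros x [_ Hx].
        apply Rnot_lt_le. intros Hlt. now apply HnU, Hx. }
      assert (R2 : rho < 1).
      { apply Rnot_le_lt. intros H. apply Hno. intros z Hz. apply Hin. lra. }
      assert (Hcl' : forall z : C, Cmod z <= rho -> U (P z)).
      { intros z Hz. destruct (Req_dec (Cmod z) rho) as [E|E]; [|apply Hin; lra].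
        destruct (Ceq_dec z 0) as [->|Hz0]; auto.
        apply (Hcl rho); [lra|]. intros e He. apply Cmod_gt_0 in Hz0.
        destruct (holo_ccont 1 P z HP ltac:(lra) e He) as [d [Hd HC]].
        set (s := Rmin (1 / 2) (d / (2 * Cmod z))).
        assert (S1 : 0 < d / (2 * Cmod z)) by (apply Rdiv_lt_0_compat; lra).
        assert (S2 : 0 < s) by (apply Rmin_glb_lt; lra).
        assert (S3 : s <= 1 / 2) by apply Rmin_l.
        assert (S4 : s <= d / (2 * Cmod z)) by apply Rmin_r.
        clearbody s.
        assert (S5 : s * Cmod z <= d / 2).
        { apply Rle_trans with (d / (2 * Cmod z) * Cmod z).
          apply Rmult_le_compat_r; lra. right; field; lra. }
        assert (Hsz : Cmod (RtoC (1 - s) * z) = (1 - s) * Cmod z).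
        { rewrite Cmod_mult, Cmod_R, Rabs_pos_eq; lra. }
        assert (Hlt : Cmod (RtoC (1 - s) * z) < rho) by (rewrite Hsz; nra).
        exists (P (RtoC (1 - s) * z)%C). split; [now apply Hin|]. split.
        - eapply Rle_trans; [apply (Cl rho R1 Hin); auto|]. lra.
        - apply HC. rewrite RtoC_minus. replace ((1 - s) * z - z)%C with (- (s * z))%C by ring.
          rewrite Cmod_opp, Cmod_mult, Cmod_R, Rabs_pos_eq by lra. lra. }
      destruct (disc_compact (fun _ y => Cmod y < 1 -> U (P y)) rho R0) as [e [He HQ]]; auto.
      + intros z Hz. destruct (Hop (P z) (Hcl' z Hz)) as [d [Hd HUd]].
        destruct (holo_ccont 1 P z HP ltac:(lra) d Hd) as [d' [Hd' HC]].
        exists d'. split; auto.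
      + assert (rho + Rmin e (1 - rho) <= rho).
        { apply Ub. pose proof (Rmin_l e (1 - rho)). pose proof (Rmin_r e (1 - rho)).
          split; [lra|]. intros z Hz. apply HQ; lra. }
        assert (0 < Rmin e (1 - rho)) by (apply Rmin_glb_lt; lra). lra. }
  intros z Hz. split; auto. apply (Cl 1); auto. lra.
Qed.

(** * Rogosinski's inequality *)

Fixpoint rsum (f : nat -> R) (n : nat) : R :=
  match n with O => 0 | S m => rsum f m + f m end.

Lemma rsum_split f n : rsum f (S n) = f O + rsum (fun k => f (S k)) n.
Proof. induction n as [|n IH]; simpl in *; [ring|rewrite IH; ring]. Qed.

Lemma rsum_ext f g n : (forall k, (k < n)%nat -> f k = g k) -> rsum f n = rsum g n.
Proof. induction n as [|n IH]; intros H; simpl; auto. rewrite IH, H; auto. Qed.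

Lemma rsum_scal c f n : rsum (fun k => c * f k) n = c * rsum f n.
Proof. induction n as [|n IH]; simpl; [ring|rewrite IH; ring]. Qed.

Lemma mean_zero R H r : holo R H -> 0 < r < R -> H 0%C = 0%C ->
  Cint (fun t => H (r * cis t)%C) 0 (2 * PI) = 0%C.
Proof.
  intros HH Hr H0. pose proof PI_RGT_0.
  assert (HCi : Ci <> 0%C) by (apply Cmod_gt_0; rewrite Cmod_Ci; lra).
  assert (Z := cauchy_difference_quotient H R r 0 HH Hr ltac:(rewrite Cmod_0; lra)).
  rewrite (Cint_ext _ (fun t => Ci * H (r * cis t))%C) in Z.
  - rewrite Cint_scal in Z; [|lra|intros; eapply holo_path; eauto; lra].
    replace (Cint _ 0 (2 * PI)) with (/ Ci * (Ci * Cint (fun t => H (r * cis t)%C) 0 (2 * PI)))%C by (field; auto).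
    rewrite Z. ring.
  - intros t. rewrite H0. pose proof (rcis_neq_0 r t ltac:(lra)) as Hz.
    replace (r * (Ci * cis t))%C with (Ci * (r * cis t))%C by ring.
    set (z := (r * cis t)%C) in *. field.
    replace (z - 0)%C with z by ring. exact Hz.
Qed.

(** The squared norm of [F] in the space of square integrable functions on the circle of
    radius [r]. *)
Definition mean_sq (r : R) (F : C -> C) : R :=
  / (2 * PI) * RInt (fun t => Cmod (F (r * cis t)%C) ^ 2) 0 (2 * PI).

Lemma mean_sq_ex R F r : holo R F -> 0 <= r < R -> ex_RInt (fun t => Cmod (F (r * cis t)%C) ^ 2) 0 (2 * PI).
Proof.
  intros HF Hr. apply (@ex_RInt_continuous R_CompleteNormedModule). intros t _.
  apply continuity_pt_filterlim.
  apply (continuity_pt_comp (fun t => Cmod (F (r * cis t)%C)) (fun x => x ^ 2)).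
  - apply pcont_Cmod. eapply holo_path; eauto.
  - apply derivable_continuous_pt, derivable_pt_pow.
Qed.

Lemma mean_sq_ge_0 R F r : holo R F -> 0 <= r < R -> 0 <= mean_sq r F.
Proof.
  intros HF Hr. pose proof PI_RGT_0. unfold mean_sq. apply Rmult_le_pos.
  - left; apply Rinv_0_lt_compat; lra.
  - apply RInt_ge_0; [lra|eapply mean_sq_ex; eauto|]. intros; apply pow2_ge_0.
Qed.

Lemma mean_sq_mono R F G r : holo R F -> holo R G -> 0 <= r < R ->
  (forall z : C, Cmod z = r -> Cmod (F z) <= Cmod (G z)) -> mean_sq r F <= mean_sq r G.
Proof.
  intros HF HG Hr H. pose proof PI_RGT_0. unfold mean_sq. apply Rmult_le_compat_l.
  - left; apply Rinv_0_lt_compat; lra.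
  - apply RInt_le; [lra|eapply mean_sq_ex; eauto|eapply mean_sq_ex; eauto|].
    intros t _. apply pow_incr. split; [apply Cmod_ge_0|]. apply H, Cmod_rcis; lra.
Qed.

Lemma mean_sq_ext F G r : (forall z, F z = G z) -> mean_sq r F = mean_sq r G.
Proof. intros H. unfold mean_sq. f_equal. apply RInt_ext. intros; now rewrite H. Qed.

(** Constants are orthogonal to functions that vanish at the origin, by the mean value
    property. *)
Lemma mean_sq_split R c H r : holo R H -> 0 < r < R -> H 0%C = 0%C ->
  mean_sq r (fun z => c + H z)%C = Cmod c ^ 2 + mean_sq r H.
Proof.
  intros HH Hr H0. pose proof PI_RGT_0. unfold mean_sq.
  pose proof (mean_sq_ex R H r HH ltac:(lra)) as E2.
  assert (Cp : forall t, pcont (fun u => Cconj c * H (r * cis u))%C t).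
  { intros; apply pcont_mult; [apply pcont_const|eapply holo_path; eauto; lra]. }
  destruct (Cint_components_ex (fun u => Cconj c * H (r * cis u))%C 0 (2 * PI) ltac:(lra)) as [E1 _]; auto.
  assert (Z : RInt (fun t => Re (Cconj c * H (r * cis t))%C) 0 (2 * PI) = 0).
  { assert (Z : Cint (fun u => Cconj c * H (r * cis u))%C 0 (2 * PI) = 0%C).
    { rewrite Cint_scal; [|lra|intros; eapply holo_path; eauto; lra].
      rewrite (mean_zero R); auto. ring. }
    rewrite Cint_components in Z by (auto; lra). apply (f_equal fst) in Z. exact Z. }
  assert (E3 : ex_RInt (fun t => plus (scal 2 (Re (Cconj c * H (r * cis t))%C)) (Cmod (H (r * cis t)%C) ^ 2)) 0 (2 * PI)).
  { apply (@ex_RInt_plus R_NormedModule); auto. apply (@ex_RInt_scal R_NormedModule); auto. }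
  assert (E : RInt (fun t => Cmod (c + H (r * cis t))%C ^ 2) 0 (2 * PI)
    = RInt (fun t => plus (Cmod c ^ 2) (plus (scal 2 (Re (Cconj c * H (r * cis t))%C)) (Cmod (H (r * cis t)%C) ^ 2))) 0 (2 * PI)).
  { apply RInt_ext. intros t _. rewrite !Cmod2_alt. unfold plus, scal; simpl. unfold mult; simpl.
    destruct c as [x y], (H _) as [p q]. unfold Re, Im; simpl. ring. }
  rewrite E, (@RInt_plus R_CompleteNormedModule), (@RInt_plus R_CompleteNormedModule), (@RInt_scal R_CompleteNormedModule), Z, RInt_const; auto.
  - unfold plus, scal; simpl. unfold mult; simpl. field. lra.
  - apply (@ex_RInt_scal R_NormedModule); auto.
  - apply ex_RInt_const.
Qed.

Lemma holo_csum R (f : nat -> C -> C) n : (forall k, holo R (f k)) -> holo R (fun z => csum (fun k => f k z) n).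
Proof.
  intros Hf. induction n as [|n IH]; simpl; [apply holo_const|]. now apply holo_plus.
Qed.

Lemma holo_poly_comp (w : C -> C) a n : holo 1 w -> holo 1 (fun z => csum (fun k => a k * w z ^ k)%C n).
Proof.
  intros Hw. apply (holo_csum 1 (fun k z => a k * w z ^ k)%C).
  intros k. apply holo_mult; [apply holo_const|now apply holo_pow].
Qed.

(** Littlewood's inequality for polynomials [G(x) = a0 + x G1(x)]: the terms of [G o w = a0
    + w (G1 o w)] are orthogonal, and [|w| <= 1] lets the factor [w] be dropped. *)
Lemma littlewood_subordination (w : C -> C) r n : forall a, holo 1 w -> (forall z : C, Cmod z < 1 -> Cmod (w z) <= 1) ->
  w 0%C = 0%C -> 0 < r < 1 ->
  mean_sq r (fun z => csum (fun k => a k * w z ^ k)%C n) <= rsum (fun k => Cmod (a k) ^ 2) n.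
Proof.
  induction n as [|n IH]; intros a Hw Hb H0 Hr.
  - simpl. unfold mean_sq. rewrite (RInt_ext _ (fun _ => 0)).
    + rewrite RInt_const. unfold scal; simpl; unfold mult; simpl. lra.
    + intros. rewrite Cmod_0. simpl. ring.
  - rewrite rsum_split.
    rewrite (mean_sq_ext _ (fun z => a O + w z * csum (fun k => a (S k) * w z ^ k) n)%C).
    + rewrite (mean_sq_split 1).
      * apply Rplus_le_compat_l. eapply Rle_trans; [|apply (IH (fun k => a (S k))); auto].
        apply (mean_sq_mono 1).
        -- apply holo_mult; auto. now apply holo_poly_comp.
        -- now apply holo_poly_comp.
        -- lra.
        -- intros z Hz. rewrite Cmod_mult. specialize (Hb z ltac:(lra)).
           pose proof (Cmod_ge_0 (csum (fun k => a (S k) * w z ^ k)%C n)). nra.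
      * apply holo_mult; auto. now apply holo_poly_comp.
      * lra.
      * rewrite H0. ring.
    + intros z. rewrite csum_split. simpl Cpow at 1. rewrite <- csum_scal.
      rewrite (csum_ext (fun k => a (S k) * w z ^ S k)%C (fun k => w z * (a (S k) * w z ^ k))%C); [ring|].
      intros; rewrite Cpow_S; ring.
Qed.

Lemma zero_of_linear_bound (G : C -> C) K d : ccont G 0 -> 0 < d ->
  (forall z : C, 0 < Cmod z < d -> Cmod (G z) <= K * Cmod z) -> G 0%C = 0%C.
Proof.
  intros HC Hd HK. apply NNPP. intros Hne. apply Cmod_gt_0 in Hne.
  set (m := Cmod (G 0%C)) in *.
  destruct (HC (m / 2) ltac:(lra)) as [d' [Hd' H]].
  pose proof (Rabs_pos K) as PK.
  assert (S1 : 0 < m / (4 * (Rabs K + 1))) by (apply Rdiv_lt_0_compat; lra).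
  set (s := Rmin (d / 2) (Rmin (d' / 2) (m / (4 * (Rabs K + 1))))).
  assert (Hs : 0 < s) by (repeat apply Rmin_glb_lt; lra).
  assert (Hs1 : s <= d / 2) by apply Rmin_l.
  assert (Hs2 : s <= d' / 2) by (eapply Rle_trans; [apply Rmin_r|apply Rmin_l]).
  assert (Hs3 : s <= m / (4 * (Rabs K + 1))) by (eapply Rle_trans; [apply Rmin_r|apply Rmin_r]).
  clearbody s. assert (Ms : Cmod s = s) by (rewrite Cmod_R; apply Rabs_pos_eq; lra).
  specialize (HK s). rewrite Ms in HK. specialize (HK ltac:(lra)).
  specialize (H s). replace (s - 0)%C with (RtoC s) in H by ring. rewrite Ms in H. specialize (H ltac:(lra)).
  pose proof (Cmod_triang_inv (G 0%C) (G s)) as T. rewrite (Cmod_sub_sym (G 0%C)) in T. fold m in T.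
  assert (K * s <= m / 4).
  { pose proof (Rle_abs K). apply Rle_trans with ((Rabs K + 1) * (m / (4 * (Rabs K + 1)))).
    - nra.
    - right; field; lra. }
  lra.
Qed.

(** Bessel's inequality, again by splitting off one coefficient at a time: [F = c0 + z divz
    F]. *)
Lemma bessel_taylor r n : forall F c, holo 1 F -> 0 < r < 1 ->
  (exists K d, 0 < d /\ forall z : C, 0 < Cmod z < d -> Cmod (F z - csum (fun k => c k * z ^ k)%C n) <= K * Cmod z ^ n) ->
  rsum (fun k => Cmod (c k) ^ 2 * r ^ (2 * k)) n <= mean_sq r F.
Proof.
  induction n as [|n IH]; intros F c HF Hr (K & d & Hd & HK).
  - simpl. apply (mean_sq_ge_0 1); auto; lra.
  - assert (F0 : F 0%C = c O).
    { assert (E : (F 0%C - csum (fun k => c k * 0 ^ k) (S n))%C = 0%C).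
      { apply (zero_of_linear_bound (fun z => F z - csum (fun k => c k * z ^ k)%C (S n))%C (Rabs K) (Rmin d 1)).
        - apply (holo_ccont 1); [|rewrite Cmod_0; lra]. apply holo_minus; auto.
          apply (holo_poly_comp (fun z => z)), holo_id.
        - apply Rmin_glb_lt; lra.
        - intros z Hz. pose proof (Rmin_l d 1). pose proof (Rmin_r d 1).
          eapply Rle_trans; [apply HK; lra|]. pose proof (Rle_abs K). simpl pow.
          assert (Cmod z ^ n <= 1) by (rewrite <- (pow1 n); apply pow_incr; lra).
          assert (0 <= Cmod z ^ n) by (apply pow_le; lra). pose proof (Rabs_pos K).
          assert (Cmod z * Cmod z ^ n <= Cmod z) by nra.
          assert (0 <= Cmod z * Cmod z ^ n) by nra. nra. }
      rewrite csum_pow_0 in E. replace (F 0%C) with ((F 0%C - c O) + c O)%C by ring. rewrite E. ring. }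
    rewrite rsum_split. change (r ^ (2 * 0)) with 1. rewrite Rmult_1_r.
    rewrite (mean_sq_ext F (fun z => c O + z * divz F z)%C).
    2:{ intros z. rewrite (divz_eq F z) at 1. now rewrite F0. }
    rewrite (mean_sq_split 1); [|apply holo_mult; [apply holo_id|now apply holo_divz]|lra|ring].
    apply Rplus_le_compat_l.
    assert (E : mean_sq r (fun z => z * divz F z)%C = r ^ 2 * mean_sq r (divz F)).
    { unfold mean_sq. rewrite (RInt_ext _ (fun t => scal (r ^ 2) (Cmod (divz F (r * cis t)%C) ^ 2))).
      - rewrite (@RInt_scal R_CompleteNormedModule).
        + unfold scal; simpl; unfold mult; simpl. ring.
        + apply (mean_sq_ex 1); [now apply holo_divz|lra].
      - intros t _. rewrite Cmod_mult, Cmod_rcis by lra. unfold scal; simpl; unfold mult; simpl. ring. }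
    rewrite E.
    rewrite (rsum_ext _ (fun k => r ^ 2 * (Cmod (c (S k)) ^ 2 * r ^ (2 * k)))).
    2:{ intros k _. replace (2 * S k)%nat with (2 + 2 * k)%nat by lia. rewrite pow_add. ring. }
    rewrite rsum_scal. apply Rmult_le_compat_l; [apply pow2_ge_0|].
    apply (IH (divz F) (fun k => c (S k))); auto; [now apply holo_divz|].
    exists K, d. split; auto. intros z Hz. specialize (HK z Hz).
    assert (Hz0 : z <> 0%C) by (apply Cmod_gt_0; lra).
    rewrite csum_split in HK. rewrite (divz_eq F z), F0 in HK. simpl Cpow at 1 in HK.
    rewrite (csum_ext (fun k => c (S k) * z ^ S k)%C (fun k => z * (c (S k) * z ^ k))%C) in HK by (intros; rewrite Cpow_S; ring).
    rewrite csum_scal in HK. set (s := csum _ n) in *.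
    replace (c O + z * divz F z - (c O * 1 + z * s))%C with (z * (divz F z - s))%C in HK by ring.
    rewrite Cmod_mult in HK. simpl pow in HK.
    apply Rmult_le_reg_l with (Cmod z); [lra|]. lra.
Qed.

Lemma bernoulli_le (r : R) m : 0 <= r <= 1 -> 1 - INR m * (1 - r) <= r ^ m.
Proof.
  intros Hr. induction m as [|m IH]; [simpl; lra|]. rewrite S_INR. simpl pow.
  assert (0 <= r ^ m) by (apply pow_le; lra). assert (r ^ m <= 1) by (rewrite <- (pow1 m); apply pow_incr; lra).
  nra.
Qed.

(** The polynomial [sum_(k<n) a_k w^k] has the same Taylor coefficients of order less than
    [n] as the series in [c]. Combine the two preceding inequalities on the circle of radius
    [r] and let [r] tend to [1]. *)
Theorem rogosinski (w : C -> C) a c n : holo 1 w -> (forall z : C, Cmod z < 1 -> Cmod (w z) <= 1) ->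
  w 0%C = 0%C ->
  (exists K d, 0 < d /\ forall z : C, 0 < Cmod z < d ->
     Cmod (csum (fun k => a k * w z ^ k)%C n - csum (fun k => c k * z ^ k)%C n) <= K * Cmod z ^ n) ->
  rsum (fun k => Cmod (c k) ^ 2) n <= rsum (fun k => Cmod (a k) ^ 2) n.
Proof.
  intros Hw Hb H0 HK.
  set (B := rsum (fun k => Cmod (a k) ^ 2) n).
  assert (H1 : forall r, 0 < r < 1 -> rsum (fun k => Cmod (c k) ^ 2 * r ^ (2 * k)) n <= B).
  { intros r Hr. eapply Rle_trans; [|apply (littlewood_subordination w r); auto].
    apply bessel_taylor; auto. now apply holo_poly_comp. }
  set (D := rsum (fun k => Cmod (c k) ^ 2 * INR (2 * k)) n).
  assert (H2 : forall r, 0 < r < 1 -> rsum (fun k => Cmod (c k) ^ 2) n - (1 - r) * D <= B).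
  { intros r Hr. eapply Rle_trans; [|apply (H1 r Hr)]. unfold D. rewrite <- rsum_scal. clear - Hr.
    induction n as [|n IH]; [simpl; lra|]. cbn [rsum].
    pose proof (Rmult_le_compat_l _ _ _ (pow2_ge_0 (Cmod (c n))) (bernoulli_le r (2 * n) ltac:(lra))). lra. }
  apply Rnot_lt_le. intros Hlt. set (X := rsum (fun k => Cmod (c k) ^ 2) n) in *.
  pose proof (Rabs_pos D) as PD.
  assert (HS : 0 < Rmin (1 / 2) ((X - B) / (2 * (Rabs D + 1)))).
  { apply Rmin_glb_lt; [lra|]. apply Rdiv_lt_0_compat; lra. }
  pose proof (Rmin_l (1 / 2) ((X - B) / (2 * (Rabs D + 1)))) as S1.
  pose proof (Rmin_r (1 / 2) ((X - B) / (2 * (Rabs D + 1)))) as S2.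
  set (s := Rmin _ _) in *. clearbody s.
  specialize (H2 (1 - s) ltac:(lra)). replace (1 - (1 - s)) with s in H2 by ring.
  assert (s * (Rabs D + 1) <= (X - B) / 2).
  { apply Rle_trans with ((X - B) / (2 * (Rabs D + 1)) * (Rabs D + 1)).
    - apply Rmult_le_compat_r; lra.
    - right; field; lra. }
  pose proof (Rle_abs D). nra.
Qed.

(** * The functions K and Q *)

Lemma Clog_right (w : C) : 0 < Re w -> Clog w = (ln (Cmod w), atan (Im w / Re w)).
Proof.
  intros Hw. destruct w as [a b]. simpl in Hw. unfold Clog. f_equal. unfold Carg.
  simpl Re; simpl Im. pose proof PI_RGT_0.
  assert (E : cos (atan (b / a)) = a / Cmod (a, b)).
  { rewrite cos_atan. unfold Cmod; simpl fst; simpl snd.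
    replace (a ^ 2 + b ^ 2) with (a ^ 2 * (1 + (b / a)²)) by (unfold Rsqr; field; lra).
    rewrite sqrt_mult by (unfold Rsqr; nra). rewrite sqrt_pow2 by lra.
    assert (0 < sqrt (1 + (b / a)²)) by (apply sqrt_lt_R0; generalize (Rle_0_sqr (b / a)); lra).
    field. lra. }
  rewrite <- E. pose proof (atan_bound (b / a)) as B. destruct (Rle_dec 0 b) as [Hb|Hb].
  - apply acos_cos. split; [|lra].
    destruct (Req_dec b 0) as [->|Hb0]; [unfold Rdiv; rewrite Rmult_0_l, atan_0; lra|].
    rewrite <- atan_0. left. apply atan_increasing. apply Rdiv_lt_0_compat; lra.
  - rewrite <- cos_neg, acos_cos; [ring|]. split; [|lra].
    assert (atan (b / a) < atan 0).
    { apply atan_increasing. apply Rlt_div_l; lra. }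
    rewrite atan_0 in H0. lra.
Qed.

Lemma Cexp_Clog (w : C) : 0 < Re w -> Cexp (Clog w) = w.
Proof.
  intros Hw. rewrite Clog_right by auto. destruct w as [a b]. simpl in Hw.
  assert (Pm : 0 < Cmod (a, b)).
  { eapply Rlt_le_trans; [|apply (re_le_Cmod (a, b))]. simpl. rewrite Rabs_pos_eq; lra. }
  unfold Cexp; simpl Re; simpl Im. rewrite exp_ln by auto. rewrite cos_atan, sin_atan.
  assert (E : Cmod (a, b) = a * sqrt (1 + (b / a)²)).
  { unfold Cmod; simpl fst; simpl snd.
    replace (a ^ 2 + b ^ 2) with (a ^ 2 * (1 + (b / a)²)) by (unfold Rsqr; field; lra).
    rewrite sqrt_mult by (unfold Rsqr; nra). rewrite sqrt_pow2 by lra. reflexivity. }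
  assert (0 < sqrt (1 + (b / a)²)) by (apply sqrt_lt_R0; generalize (Rle_0_sqr (b / a)); lra).
  rewrite E. apply injective_projections; simpl; field; lra.
Qed.

Lemma Clog_Cexp (x : C) : Rabs (Im x) < PI / 2 -> Clog (Cexp x) = x.
Proof.
  intros Hx. apply Rabs_lt_between in Hx. destruct x as [a b]. simpl in Hx.
  assert (Hc : 0 < cos b) by (apply cos_gt_0; lra).
  pose proof (exp_pos a).
  rewrite Clog_right.
  - rewrite Cmod_Cexp. unfold Cexp; simpl. rewrite ln_exp.
    replace (exp a * sin b / (exp a * cos b)) with (tan b) by (unfold tan; field; lra).
    rewrite atan_tan by lra. reflexivity.
  - simpl. now apply Rmult_lt_0_compat.
Qed.

Lemma Clog_strip (w : C) : 0 < Re w -> Rabs (Im (Clog w)) < PI / 2.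
Proof.
  intros Hw. rewrite Clog_right by auto. simpl. pose proof (atan_bound (Im w / Re w)).
  apply Rabs_def1; lra.
Qed.

(** [Clog] inverts [Cexp] on the strip [|Im x| < pi / 2]. The map [z -> exp(x0 + rho z)] is
    injective on the unit disc for small [rho], so the derivative of its inverse applies. *)
Lemma cder_Clog (w : C) : 0 < Re w -> cder Clog w (/ w).
Proof.
  intros Hw. set (x0 := Clog w). pose proof (Clog_strip w Hw) as Hs. fold x0 in Hs.
  set (rho := (PI / 2 - Rabs (Im x0)) / 2). assert (Hrho : 0 < rho) by (unfold rho; lra).
  assert (Hrc : RtoC rho <> 0%C) by (apply RtoC_neq_0; lra).
  set (Q := fun z => Cexp (x0 + RtoC rho * z)%C).
  assert (Hin : forall z : C, Cmod z < 1 -> Rabs (Im (x0 + RtoC rho * z)) < PI / 2).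
  { intros z Hz. pose proof (im_le_Cmod z) as Hi. 
    replace (Im (x0 + RtoC rho * z)) with (Im x0 + rho * Im z) by (destruct z, x0; simpl; ring).
    eapply Rle_lt_trans; [apply Rabs_triang|]. rewrite Rabs_mult, (Rabs_pos_eq rho) by lra.
    assert (rho * Rabs (Im z) < rho * 1) by (apply Rmult_lt_compat_l; lra).
    unfold rho in *. lra. }
  assert (DQ : forall z, cder Q z (Cexp (x0 + RtoC rho * z) * RtoC rho)%C).
  { intros z. eapply cder_val; [|apply (cder_comp Cexp (fun z => x0 + RtoC rho * z)%C)].
    2: apply cder_Cexp. 2: cder_auto.
    cbv beta. ring. }
  assert (HQ : holo 1 Q) by (intros z _; eexists; apply DQ).
  assert (Hinv : forall z : C, Cmod z < 1 -> Clog (Q z) = (x0 + RtoC rho * z)%C).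
  { intros z Hz. apply Clog_Cexp, Hin, Hz. }
  assert (Hinj : forall z z' : C, Cmod z < 1 -> Cmod z' < 1 -> Q z = Q z' -> z = z').
  { intros z z' Hz Hz' E. assert (E2 : (x0 + RtoC rho * z)%C = (x0 + RtoC rho * z')%C).
    { rewrite <- !Hinv by auto. now rewrite E. }
    replace z with (/ RtoC rho * ((x0 + RtoC rho * z) - x0))%C by (field; auto).
    rewrite E2. field; auto. }
  assert (Q0 : Q 0%C = w).
  { unfold Q. replace (x0 + RtoC rho * 0)%C with x0 by ring. now apply Cexp_Clog. }
  assert (H01 : Cmod 0 < 1) by (rewrite Cmod_0; lra).
  assert (DQ0 : C_derive Q 0 = (w * RtoC rho)%C).
  { rewrite (cder_unique _ _ _ (DQ 0%C)). replace (x0 + RtoC rho * 0)%C with x0 by ring.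
    unfold x0. now rewrite Cexp_Clog. }
  assert (Hw0 : w <> 0%C) by (intros ->; simpl in Hw; lra).
  destruct (injective_open Q 0%C 1 HQ Hinj H01 Rlt_0_1) as [e [He Hop]]. rewrite Q0 in Hop.
  apply (cder_ext_near (fun v => x0 + RtoC rho * disc_inv Q v)%C _ _ _ e); auto.
  - intros v Hv. destruct (Hop v Hv) as [z [Hz [_ <-]]]. rewrite disc_inv_spec, Hinv; auto.
  - eapply cder_val; [|apply cder_plus; [apply cder_const|apply cder_scal]].
    2: rewrite <- Q0; apply disc_inv_cder; auto.
    + rewrite DQ0. field; auto.
    + rewrite DQ0. now apply Cmult_neq_0.
Qed.

(** The difference of the two sides vanishes at both ends and its derivative is decreasing;
    by the mean value theorem it cannot be negative in between. *)
Lemma jordan_inequality (b : R) : 0 <= b <= 1 -> b <= sin (b * (PI / 2)).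
Proof.
  intros Hb. pose proof PI_RGT_0 as HPI. apply Rnot_lt_le. intros Hlt.
  destruct (Req_dec b 0) as [->|Hb0].
  { rewrite Rmult_0_l, sin_0 in Hlt. lra. }
  destruct (Req_dec b 1) as [->|Hb1].
  { rewrite Rmult_1_l, sin_PI2 in Hlt. lra. }
  set (f := fun t => sin (t * (PI / 2)) - t).
  set (df := fun t => PI / 2 * cos (t * (PI / 2)) - 1).
  assert (D : forall c, is_derive f c (df c)).
  { intros c. unfold f, df. auto_derive; auto. ring. }
  destruct (mvt_is_derive f df 0 b) as [c1 [C1 E1]]; [lra|auto|].
  destruct (mvt_is_derive f df b 1) as [c2 [C2 E2]]; [lra|auto|].
  unfold f in E1 at 2. rewrite Rmult_0_l, sin_0 in E1. unfold f in E2 at 1. rewrite Rmult_1_l, sin_PI2 in E2.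
  assert (F : f b < 0) by (unfold f; lra).
  assert (D1 : df c1 < 0) by nra. assert (D2 : 0 < df c2) by nra.
  assert (cos (c2 * (PI / 2)) <= cos (c1 * (PI / 2))).
  { apply cos_decr_1; nra. }
  unfold df in D1, D2. nra.
Qed.

(** The primitive of [1 / (1 + Bz)] that vanishes at [0]. In the variable [x = log_coord B
    z] one has [z = exp_int B x] and [K = exp_int A x], so that [A] and [B] play symmetric
    roles and the degenerate cases need no separate treatment. *)
Definition log_coord (B : R) (z : C) : C :=
  if Req_dec_T B 0 then z else (/ B * Clog (1 + B * z))%C.
(** The integral of [exp(A s)] for [s] from [0] to [x]. *)
Definition exp_int (A : R) (x : C) : C :=
  if Req_dec_T A 0 then x else (/ A * (Cexp (A * x) - 1))%C.

Lemma exp_int_mult (A : R) (x : C) : (A * exp_int A x)%C = (Cexp (A * x) - 1)%C.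
Proof.
  unfold exp_int. destruct (Req_dec_T A 0) as [->|HA].
  - replace (0 * x)%C with (RtoC 0) by ring. rewrite Cexp_0. ring.
  - apply RtoC_neq_0 in HA. field; auto.
Qed.

Lemma cder_exp_int (A : R) (x : C) : cder (exp_int A) x (Cexp (A * x)).
Proof.
  unfold exp_int. destruct (Req_dec_T A 0) as [->|HA].
  - replace (0 * x)%C with (RtoC 0) by ring. rewrite Cexp_0. apply cder_id.
  - apply RtoC_neq_0 in HA. eapply cder_val; [|apply cder_scal, cder_minus; [|apply cder_const]].
    2: apply (cder_comp Cexp (fun y => A * y)%C); [apply cder_Cexp|apply cder_scal, cder_id].
    cbv beta. field; auto.
Qed.

Definition halfplane (B : R) (z : C) : Prop := 0 < Re (1 + B * z).

Lemma halfplane_neq_0 (B : R) (z : C) : halfplane B z -> (1 + B * z)%C <> 0%C.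
Proof. unfold halfplane. intros H E. rewrite E in H. simpl in H. lra. Qed.

Lemma halfplane_disc (B : R) (z : C) : -1 <= B <= 1 -> Cmod z < 1 -> halfplane B z.
Proof.
  intros HB Hz. unfold halfplane. replace (Re (1 + B * z)) with (1 + B * Re z) by (destruct z; simpl; ring).
  pose proof (re_le_Cmod z) as H. apply Rabs_le_between in H. nra.
Qed.

Lemma halfplane_scale (B : R) (z : C) (t : R) : halfplane B z -> 0 <= t <= 1 -> halfplane B (t * z)%C.
Proof.
  unfold halfplane. intros H Ht.
  replace (Re (1 + B * (t * z))) with (1 + t * (B * Re z)) by (destruct z; simpl; ring).
  replace (Re (1 + B * z)) with (1 + B * Re z) in H by (destruct z; simpl; ring).
  set (p := B * Re z) in *. destruct (Req_dec t 1) as [->|Ht1]; [lra|].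
  assert (0 <= t * (1 + p)) by (apply Rmult_le_pos; lra). lra.
Qed.

Lemma cder_log_coord (B : R) (z : C) : halfplane B z -> cder (log_coord B) z (/ (1 + B * z)).
Proof.
  intros HO. pose proof (halfplane_neq_0 B z HO). unfold log_coord. destruct (Req_dec_T B 0) as [->|HB].
  - eapply cder_val; [|apply cder_id]. field; auto.
  - apply RtoC_neq_0 in HB. eapply cder_val; [|apply cder_scal].
    2: apply (cder_comp Clog (fun y => 1 + B * y)%C); [now apply cder_Clog|].
    2: cder_auto.
    cbv beta. field; auto.
Qed.

Lemma Cexp_log_coord (B : R) (z : C) : halfplane B z -> Cexp (B * log_coord B z) = (1 + B * z)%C.
Proof.
  intros HO. unfold log_coord. destruct (Req_dec_T B 0) as [->|HB].
  - replace (0 * z)%C with (RtoC 0) by ring. rewrite Cexp_0. ring.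
  - apply RtoC_neq_0 in HB. replace (B * (/ B * Clog (1 + B * z)))%C with (Clog (1 + B * z)) by (field; auto).
    now apply Cexp_Clog.
Qed.

Lemma exp_int_log_coord (B : R) (z : C) : halfplane B z -> exp_int B (log_coord B z) = z.
Proof.
  intros HO. destruct (Req_dec_T B 0) as [->|HB].
  - unfold exp_int, log_coord. destruct (Req_dec_T 0 0); [auto|lra].
  - apply RtoC_neq_0 in HB. replace (exp_int B (log_coord B z)) with (/ B * (B * exp_int B (log_coord B z)))%C by (field; auto).
    rewrite exp_int_mult, Cexp_log_coord by auto. field; auto.
Qed.

Lemma one_plus_exp_int (B : R) (x : C) : (1 + B * exp_int B x)%C = Cexp (B * x).
Proof. rewrite exp_int_mult. ring. Qed.

Lemma Rabs_scal_lt (b y c : R) : -1 <= b <= 1 -> Rabs y < c -> Rabs (b * y) < c.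
Proof.
  intros Hb Hy. rewrite Rabs_mult. assert (Rabs b <= 1) by (apply Rabs_le; lra).
  pose proof (Rabs_pos y). pose proof (Rabs_pos b). nra.
Qed.

Lemma Re_Cexp (x : C) : Re (Cexp x) = exp (Re x) * cos (Im x).
Proof. reflexivity. Qed.

Lemma Im_scal (b : R) (x : C) : Im (b * x) = b * Im x.
Proof. destruct x; simpl; ring. Qed.

Lemma halfplane_exp_int (B : R) (x : C) : -1 <= B <= 1 -> Rabs (Im x) < PI / 2 -> halfplane B (exp_int B x).
Proof.
  intros HB Hx. unfold halfplane. rewrite one_plus_exp_int. rewrite Re_Cexp. apply Rmult_lt_0_compat; [apply exp_pos|]. rewrite Im_scal.
  pose proof (Rabs_scal_lt B (Im x) (PI / 2) HB Hx) as H. apply Rabs_lt_between in H. apply cos_gt_0; lra.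
Qed.

Lemma log_coord_exp_int (B : R) (x : C) : -1 <= B <= 1 -> Rabs (Im x) < PI / 2 -> log_coord B (exp_int B x) = x.
Proof.
  intros HB Hx. unfold log_coord. rewrite one_plus_exp_int. destruct (Req_dec_T B 0) as [->|H].
  - unfold exp_int. destruct (Req_dec_T 0 0); [auto|lra].
  - apply RtoC_neq_0 in H. rewrite Clog_Cexp; [field; auto|].
    rewrite Im_scal. now apply Rabs_scal_lt.
Qed.

(** The angle [theta] of [1 + Bz] satisfies [|sin theta| < |B|], because [|Im z| < |1 + Bz|]
    in the disc; Jordan's inequality then bounds [theta] by [|B| pi / 2]. *)
Lemma log_coord_strip (B : R) (z : C) : -1 <= B <= 1 -> Cmod z < 1 -> Rabs (Im (log_coord B z)) < PI / 2.
Proof.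
  intros HB Hz. unfold log_coord. destruct (Req_dec_T B 0) as [->|HB0].
  - pose proof (im_le_Cmod z). pose proof PI2_1. lra.
  - pose proof (halfplane_disc B z HB Hz) as HO. unfold halfplane in HO.
    rewrite <- RtoC_inv, Im_scal, Rabs_mult, Rabs_inv by auto.
    pose proof (Clog_strip _ HO) as Hth. pose proof (Cexp_Clog _ HO) as HE.
    set (w := (1 + B * z)%C) in *. set (th := Im (Clog w)) in *.
    assert (PB : 0 < Rabs B) by now apply Rabs_pos_lt.
    apply Rmult_lt_reg_l with (Rabs B); auto. rewrite <- Rmult_assoc, Rinv_r, Rmult_1_l by lra.
    apply Rnot_le_lt. intros Hge.
    assert (HBa : Rabs B <= 1) by (apply Rabs_le; lra).
    assert (Hmod : exp (Re (Clog w)) = Cmod w) by (rewrite <- Cmod_Cexp, HE; auto).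
    assert (Hsin : Cmod w * Rabs (sin th) = Rabs B * Rabs (Im z)).
    { rewrite <- Rabs_mult, <- (Rabs_pos_eq (Cmod w)) by apply Cmod_ge_0. rewrite <- Rabs_mult. f_equal.
      rewrite <- Hmod. change (exp (Re (Clog w)) * sin th) with (Im (Cexp (Clog w))). rewrite HE. unfold w.
      destruct z; simpl; ring. }
    assert (Hs : Rabs B <= Rabs (sin th)).
    { eapply Rle_trans; [apply (jordan_inequality (Rabs B)); lra|].
      replace (Rabs (sin th)) with (sin (Rabs th)).
      - apply Rabs_lt_between in Hth. pose proof (Rabs_pos th).
        assert (Rabs th <= PI / 2) by (apply Rabs_le; lra).
        apply sin_incr_1; nra.
      - unfold Rabs at 1. apply Rabs_lt_between in Hth. destruct (Rcase_abs th).
        + rewrite sin_neg, Rabs_left; auto. apply sin_lt_0_var; lra.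
        + rewrite Rabs_pos_eq; auto. apply sin_ge_0; lra. }
    assert (Hy : Rabs (Im z) < Cmod w).
    { assert (S : Im z ^ 2 < Cmod w ^ 2).
      { unfold w. rewrite Cmod2_alt. 
        assert (Z : Re z ^ 2 + Im z ^ 2 < 1).
        { rewrite <- Cmod2_alt. pose proof (Cmod_ge_0 z). nra. }
        replace (Re (1 + B * z)) with (1 + B * Re z) by (destruct z; simpl; ring).
        replace (Im (1 + B * z)) with (B * Im z) by (destruct z; simpl; ring).
        set (x := Re z) in *. set (y := Im z) in *.
        destruct (Req_dec (B ^ 2) 1) as [E|E].
        - assert (Hx2 : x ^ 2 < 1) by nra. assert (HBx : (B * x) ^ 2 < 1) by (replace ((B * x) ^ 2) with (B ^ 2 * x ^ 2) by ring; rewrite E; lra).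
          assert (HBy : (B * y) ^ 2 = y ^ 2) by (replace ((B * y) ^ 2) with (B ^ 2 * y ^ 2) by ring; rewrite E; ring).
          assert (0 < 1 + B * x) by nra. rewrite HBy. nra.
        - assert (0 < 1 - B ^ 2) by nra. pose proof (pow2_ge_0 (x + B)).
          assert (0 < (1 - B ^ 2) * (1 - x ^ 2 - y ^ 2)) by (apply Rmult_lt_0_compat; lra). lra. }
      rewrite <- (pow2_abs (Im z)) in S. pose proof (Rabs_pos (Im z)). pose proof (Cmod_ge_0 w). nra. }
    assert (Rabs B * Rabs (Im z) < Rabs B * Cmod w) by (apply Rmult_lt_compat_l; auto).
    assert (Cmod w * Rabs B <= Cmod w * Rabs (sin th)) by (apply Rmult_le_compat_l; auto; apply Cmod_ge_0).
    lra.
Qed.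

Lemma log_coord_0 (B : R) : log_coord B 0 = 0%C.
Proof.
  unfold log_coord. destruct (Req_dec_T B 0) as [->|HB]; auto.
  replace (1 + B * 0)%C with (Cexp 0) by (rewrite Cexp_0; ring).
  rewrite Clog_Cexp; [ring|]. simpl. rewrite Rabs_R0. pose proof PI_RGT_0; lra.
Qed.

Definition Kfun (A B : R) (z : C) : C := exp_int A (log_coord B z).

Lemma janowski_K_eq (A B : R) (z : C) : B < A -> janowski_K A B z = Kfun A B z.
Proof.
  intros HAB. unfold janowski_K, Kfun, exp_int, log_coord.
  destruct (Req_dec_T A 0) as [HA|HA]; destruct (Req_dec_T B 0) as [HB|HB]; auto; try lra.
  unfold Cpower. do 2 f_equal. f_equal. rewrite RtoC_div by auto. apply RtoC_neq_0 in HB. field; auto.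
Qed.

Lemma Kfun_0 (A B : R) : Kfun A B 0 = 0%C.
Proof.
  unfold Kfun. rewrite log_coord_0. unfold exp_int. destruct (Req_dec_T A 0); auto.
  replace (A * 0)%C with (RtoC 0) by ring. rewrite Cexp_0. ring.
Qed.

Lemma cder_expX (A B : R) (z : C) : halfplane B z -> cder (fun y => Cexp (A * log_coord B y)) z (A * Cexp (A * log_coord B z) / (1 + B * z))%C.
Proof.
  intros HO. eapply cder_val; [|apply (cder_comp Cexp (fun y => A * log_coord B y)%C); [apply cder_Cexp|]].
  2: apply cder_scal; now apply cder_log_coord.
  cbv beta. unfold Cdiv. ring.
Qed.

Lemma cder_Kfun (A B : R) (z : C) : halfplane B z -> cder (Kfun A B) z (Cexp ((A - B)%R * log_coord B z)).
Proof.
  intros HO. pose proof (halfplane_neq_0 B z HO) as H. unfold Kfun.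
  eapply cder_val; [|apply (cder_comp (exp_int A) (log_coord B)); [apply cder_exp_int|now apply cder_log_coord]].
  rewrite <- Cexp_log_coord, <- Cexp_opp, <- Cexp_plus by auto. f_equal. rewrite RtoC_minus. ring.
Qed.

Lemma holo_Kfun (A B : R) : -1 <= B <= 1 -> holo 1 (Kfun A B).
Proof. intros HB z Hz. eexists. apply cder_Kfun. now apply halfplane_disc. Qed.

(** The function [K(z) / (z K'(z))], reciprocal of [janowski_psi]; here [K' = exp((A - B)
    X)] with [X = log_coord B]. *)
Definition Qfun (A B : R) (z : C) : C := (divz (Kfun A B) z * Cexp (- (A - B)%R * log_coord B z))%C.

Lemma Qfun_val (A B : R) (z : C) : z <> 0%C -> Qfun A B z = (Kfun A B z * Cexp (- (A - B)%R * log_coord B z) / z)%C.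
Proof.
  intros Hz. unfold Qfun, divz. destruct (Ceq_dec z 0); [easy|]. rewrite Kfun_0. field; auto.
Qed.

Lemma holo_Qfun (A B : R) : -1 <= B <= 1 -> holo 1 (Qfun A B).
Proof.
  intros HB. apply holo_mult; [apply holo_divz, holo_Kfun; auto|].
  intros z Hz. eexists. rewrite <- RtoC_opp. apply cder_expX. now apply halfplane_disc.
Qed.

Lemma Qfun_0 (A B : R) : -1 <= B <= 1 -> Qfun A B 0 = 1%C.
Proof.
  intros HB. unfold Qfun, divz. destruct (Ceq_dec 0 0); [|easy]. rewrite log_coord_0.
  rewrite (cder_unique _ _ _ (cder_Kfun A B 0 (halfplane_disc B 0 HB ltac:(rewrite Cmod_0; lra)))), log_coord_0.
  rewrite <- Cexp_plus. replace (_ + _)%C with (RtoC 0) by ring. apply Cexp_0.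
Qed.

(** The primitive of [kfun] that vanishes at [0]; by [mult_Qfun], [Q(z) = (1 + Bz) S(z) /
    z]. *)
Definition Sfun (A B : R) (z : C) : C := (Kfun A B z * Cexp (- A * log_coord B z))%C.
Definition kfun (A B : R) (z : C) : C := Cexp (- (A + B)%R * log_coord B z).

Lemma Sfun_mult (A B : R) (z : C) : (A * Sfun A B z)%C = (1 - Cexp (- A * log_coord B z))%C.
Proof.
  unfold Sfun, Kfun. rewrite Cmult_assoc, exp_int_mult.
  replace ((Cexp (A * log_coord B z) - 1) * Cexp (- A * log_coord B z))%C with
    (Cexp (A * log_coord B z) * Cexp (- A * log_coord B z) - Cexp (- A * log_coord B z))%C by ring.
  rewrite <- Cexp_plus. replace (A * log_coord B z + - A * log_coord B z)%C with (RtoC 0) by ring. rewrite Cexp_0. reflexivity.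
Qed.

Lemma expmA_kfun (A B : R) (z : C) : halfplane B z -> Cexp (- A * log_coord B z) = ((1 + B * z) * kfun A B z)%C.
Proof.
  intros HO. unfold kfun. rewrite <- Cexp_log_coord, <- Cexp_plus by auto. f_equal. rewrite RtoC_plus. ring.
Qed.

Lemma cder_Sfun (A B : R) (z : C) : halfplane B z -> cder (Sfun A B) z (kfun A B z).
Proof.
  intros HO. pose proof (halfplane_neq_0 B z HO) as Hn. unfold Sfun.
  eapply cder_val; [|apply cder_mult; [now apply cder_Kfun|]].
  2: rewrite <- RtoC_opp; now apply cder_expX.
  cbv beta. rewrite RtoC_opp.
  transitivity (Cexp ((A - B)%R * log_coord B z) * Cexp (- A * log_coord B z) - (A * Sfun A B z) / (1 + B * z))%C.
  { unfold Sfun. field; auto. }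
  rewrite Sfun_mult. rewrite <- Cexp_plus.
  replace ((A - B)%R * log_coord B z + - A * log_coord B z)%C with (- (B * log_coord B z))%C by (rewrite RtoC_minus; ring).
  rewrite Cexp_opp, Cexp_log_coord, expmA_kfun by auto. field; auto.
Qed.

(** This is [z^2 Q'(z)] by [cder_Qfun]. *)
Definition Zfun (A B : R) (z : C) : C := (z - (1 + A * z) * Sfun A B z)%C.

Lemma cder_Zfun (A B : R) (z : C) : halfplane B z -> cder (Zfun A B) z ((B - A)%R * (z * kfun A B z))%C.
Proof.
  intros HO. pose proof (cder_Sfun A B z HO). unfold Zfun. eapply cder_val; [|cder_auto].
  cbv beta. 
  transitivity (1 - A * Sfun A B z - (1 + A * z) * kfun A B z)%C; [ring|].
  rewrite Sfun_mult, expmA_kfun by auto. rewrite RtoC_minus. ring.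
Qed.

Lemma Zfun_0 (A B : R) : Zfun A B 0 = 0%C.
Proof. unfold Zfun, Sfun. rewrite Kfun_0. ring. Qed.

Lemma mult_Qfun (A B : R) (z : C) : halfplane B z -> z <> 0%C -> (z * Qfun A B z)%C = ((1 + B * z) * Sfun A B z)%C.
Proof.
  intros HO Hz. rewrite Qfun_val by auto. unfold Sfun.
  rewrite <- (Cexp_log_coord B z HO) at 1.
  transitivity (Kfun A B z * Cexp (- (A - B)%R * log_coord B z))%C; [field; auto|].
  replace (Cexp (- (A - B)%R * log_coord B z)) with (Cexp (B * log_coord B z) * Cexp (- A * log_coord B z))%C; [ring|].
  rewrite <- Cexp_plus. f_equal. rewrite RtoC_minus. ring.
Qed.

Lemma halfplane_open (B : R) (z : C) : halfplane B z -> exists d, 0 < d /\ forall y : C, Cmod (y - z) < d -> halfplane B y.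
Proof.
  unfold halfplane. intros H. set (m := Re (1 + B * z)) in *. pose proof (Rabs_pos B).
  exists (m / (Rabs B + 1)). split; [apply Rdiv_lt_0_compat; lra|]. intros y Hy.
  replace (Re (1 + B * y)) with (m + B * Re (y - z)) by (unfold m; destruct y, z; simpl; ring).
  apply Rlt_div_r in Hy; [|lra]. pose proof (re_le_Cmod (y - z)). pose proof (Cmod_ge_0 (y - z)).
  assert (Rabs (B * Re (y - z)) <= Rabs B * Cmod (y - z)).
  { rewrite Rabs_mult. apply Rmult_le_compat_l; auto. }
  apply Rabs_le_between in H3. nra.
Qed.

Lemma cder_Qfun (A B : R) (z : C) : halfplane B z -> z <> 0%C -> cder (Qfun A B) z (Zfun A B z / (z * z))%C.
Proof.
  intros HO Hz. pose proof (halfplane_neq_0 B z HO) as Hn.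
  destruct (halfplane_open B z HO) as [d [Hd HOd]].
  apply (cder_ext_near (fun y => (1 + B * y) * Sfun A B y / y)%C _ _ _ (Rmin d (Cmod z))).
  - apply Rmin_glb_lt; auto. now apply Cmod_gt_0.
  - intros y Hy.
    assert (Hy0 : y <> 0%C).
    { intros ->. replace (0 - z)%C with (- z)%C in Hy by ring. rewrite Cmod_opp in Hy.
      pose proof (Rmin_r d (Cmod z)). lra. }
    rewrite <- mult_Qfun; auto; [field; auto|]. apply HOd. eapply Rlt_le_trans; [exact Hy|apply Rmin_l].
  - pose proof (cder_Sfun A B z HO). eapply cder_val; [|apply cder_div; [exact Hz|cder_auto|apply cder_id]].
    cbv beta. f_equal. unfold Zfun.
    transitivity ((B * Sfun A B z + (1 + B * z) * kfun A B z) * z - (1 + B * z) * Sfun A B z)%C; [ring|].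
    transitivity (z * ((1 + B * z) * kfun A B z) - Sfun A B z)%C; [ring|].
    rewrite <- expmA_kfun by auto.
    replace (Cexp (- A * log_coord B z)) with (1 - A * Sfun A B z)%C by (rewrite Sfun_mult; ring). ring.
Qed.

(** The identity [z Q' = 1 - h Q] with [h(z) = (1 + Az) / (1 + Bz)], cleared of
    denominators. *)
Lemma Qfun_ode (A B : R) (z : C) : -1 <= B <= 1 -> Cmod z < 1 ->
  ((1 + B * z) * (z * C_derive (Qfun A B) z))%C = ((1 + B * z) - (1 + A * z) * Qfun A B z)%C.
Proof.
  intros HB Hz. pose proof (halfplane_disc B z HB Hz) as HO.
  destruct (Ceq_dec z 0) as [->|Hz0].
  - rewrite Qfun_0 by auto. ring.
  - rewrite (cder_unique _ _ _ (cder_Qfun A B z HO Hz0)).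
    replace (Qfun A B z) with ((1 + B * z) * Sfun A B z / z)%C by (rewrite <- mult_Qfun by auto; field; auto).
    unfold Zfun. field; auto.
Qed.

(** Both sides of [Qfun_ode] are differentiated at the origin. *)
Lemma Qfun_der_0 (A B : R) : -1 <= B <= 1 -> C_derive (Qfun A B) 0 = (- RtoC ((A - B) / 2))%C.
Proof.
  intros HB. pose proof (holo_Qfun A B HB) as HQ. pose proof (holo_C_derive 1 _ HQ) as HQ'.
  assert (H01 : Cmod 0 < 1) by (rewrite Cmod_0; lra).
  pose proof (holo_der 1 _ _ HQ H01) as D1. pose proof (holo_der 1 _ _ HQ' H01) as D2.
  set (q1 := C_derive (Qfun A B) 0) in *. set (q2 := C_derive (C_derive (Qfun A B)) 0) in *.
  assert (D : cder (fun z => (1 + B * z) * (z * C_derive (Qfun A B) z) - ((1 + B * z) - (1 + A * z) * Qfun A B z))%C 0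
     (q1 - (B - (A + q1)))%C).
  { eapply cder_val; [|cder_auto].
    cbv beta. fold q1. rewrite Qfun_0 by auto. ring. }
  (* the same function vanishes identically *)
  assert (D0 : cder (fun z => (1 + B * z) * (z * C_derive (Qfun A B) z) - ((1 + B * z) - (1 + A * z) * Qfun A B z))%C 0 0).
  { apply (cder_ext_near (fun _ => 0%C) _ _ _ 1); [lra| |apply cder_const].
    intros y Hy. replace (y - 0)%C with y in Hy by ring. rewrite Qfun_ode by auto. ring. }
  assert (E : (q1 - (B - (A + q1)))%C = 0%C).
  { rewrite <- (cder_unique _ _ _ D). apply (cder_unique _ _ _ D0). }
  assert (H2 : RtoC 2 <> 0%C) by (apply RtoC_neq_0; lra).
  replace q1 with (/ 2 * ((q1 - (B - (A + q1))) - (A - B)))%C by (field; auto).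
  rewrite E, RtoC_div, RtoC_minus by lra. field; auto.
Qed.

(** The derivative in [t] is [Im z / |1 + B t z|^2], of constant sign. *)
Lemma Im_log_coord_ray (B : R) (z : C) (t : R) : halfplane B z -> 0 <= t <= 1 ->
  0 <= Im (log_coord B (t * z)) <= Im (log_coord B z) \/ Im (log_coord B z) <= Im (log_coord B (t * z)) <= 0.
Proof.
  intros HO Ht.
  set (f := fun t : R => Im (log_coord B (t * z))).
  assert (D : forall u, 0 <= u <= 1 -> is_derive f u (Im (/ (1 + B * (u * z)) * z)%C)).
  { intros u Hu. apply (pder_Im (fun t => log_coord B (t * z)%C)). apply (pder_chain (log_coord B) (fun t => t * z)%C).
    - apply cder_log_coord. now apply halfplane_scale.
    - eapply pder_ext; [intros; apply Cmult_comm|]. eapply pder_val; [|apply pder_scal, pder_RtoC]. ring. }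
  assert (E : forall u, 0 <= u <= 1 -> Im (/ (1 + B * (u * z)) * z)%C = Im z / Cmod (1 + B * (u * z)) ^ 2).
  { intros u Hu. pose proof (halfplane_neq_0 _ _ (halfplane_scale B z u HO Hu)) as Hn. apply Cmod_gt_0 in Hn.
    rewrite Cmod2_alt in *. assert (P : 0 < Re (1 + B * (u * z)) ^ 2 + Im (1 + B * (u * z)) ^ 2).
    { rewrite <- Cmod2_alt. apply pow_lt; auto. }
    destruct z as [x y]. simpl in *. field. nra. }
  assert (M : forall a b, 0 <= a <= b -> b <= 1 -> exists c, f b - f a = c * Im z * (b - a) /\ 0 <= c).
  { intros a b Ha Hb. destruct (Req_dec a b) as [->|Hab]; [exists 0; split; [ring|lra]|].
    destruct (mvt_is_derive f (fun u => Im (/ (1 + B * (u * z)) * z)%C) a b) as [c [C1 C2]]; [lra| |].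
    - intros u Hu. apply D; lra.
    - rewrite E in C2 by lra.
      exists (/ Cmod (1 + B * (c * z)) ^ 2). split; [rewrite C2; unfold Rdiv; ring|].
      left. apply Rinv_0_lt_compat, pow_lt, Cmod_gt_0. apply halfplane_neq_0, halfplane_scale; auto; lra. }
  assert (F0 : f 0 = 0). { unfold f. replace (0 * z)%C with (RtoC 0) by ring. rewrite log_coord_0. reflexivity. }
  assert (F1 : f 1 = Im (log_coord B z)). { unfold f. replace (1 * z)%C with z by ring. reflexivity. }
  fold (f t). rewrite <- F1.
  destruct (M 0 t ltac:(lra) ltac:(lra)) as [c1 [E1 P1]]. destruct (M t 1 ltac:(lra) ltac:(lra)) as [c2 [E2 P2]].
  rewrite F0 in E1. destruct (Rle_lt_dec 0 (Im z)) as [Hz|Hz]; [left|right].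
  - assert (0 <= c1 * Im z * (t - 0)) by (repeat apply Rmult_le_pos; lra).
    assert (0 <= c2 * Im z * (1 - t)) by (repeat apply Rmult_le_pos; lra). lra.
  - assert (0 <= c1 * - Im z * (t - 0)) by (repeat apply Rmult_le_pos; lra).
    assert (0 <= c2 * - Im z * (1 - t)) by (repeat apply Rmult_le_pos; lra). lra.
Qed.

(** Along the ray, [t -> (1 + Bz) Z(tz) / z^2] vanishes at [0] and has derivative [-(A - B)
    t (1 + Bz) k(tz)]. The factor [(1 + Bz) k(tz)] is the exponential of a number whose
    imaginary part lies between [B Im x] and [-A Im x], where [x = log_coord B z], hence has
    positive real part. *)
Lemma Zfun_sign (A B : R) (z : C) : -1 <= B -> B < A -> A <= 1 -> halfplane B z -> Rabs (Im (log_coord B z)) < PI / 2 -> z <> 0%C ->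
  Re (Zfun A B z / (z * z) * (1 + B * z)) < 0.
Proof.
  intros HB HAB HA HO Hs Hz.
  set (f := fun t : R => Re ((1 + B * z) / (z * z) * Zfun A B (t * z))).
  set (df := fun t : R => (B - A) * t * Re ((1 + B * z) * kfun A B (t * z))).
  assert (D : forall u, 0 <= u <= 1 -> is_derive f u (df u)).
  { intros u Hu. evar_last.
    - apply (pder_Re (fun t => ((1 + B * z) / (z * z) * Zfun A B (t * z))%C)). apply pder_scal.
      apply (pder_chain (Zfun A B) (fun t => t * z)%C).
      + apply cder_Zfun. now apply halfplane_scale.
      + eapply pder_ext; [intros; apply Cmult_comm|]. apply pder_scal, pder_RtoC.
    - unfold df.
      replace ((1 + B * z) / (z * z) * ((B - A)%R * (u * z * kfun A B (u * z)) * (z * 1)))%C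
        with (RtoC ((B - A) * u) * ((1 + B * z) * kfun A B (u * z)))%C
        by (rewrite RtoC_mult; field; auto).
      set (v := ((1 + B * z) * kfun A B (u * z))%C). destruct v. simpl. ring. }
  destruct (mvt_is_derive f df 0 1 Rlt_0_1 D) as [c [C1 C2]].
  assert (Kpos : 0 < Re ((1 + B * z) * kfun A B (c * z))).
  { rewrite <- (Cexp_log_coord B z HO). unfold kfun. rewrite <- Cexp_plus. rewrite Re_Cexp.
    apply Rmult_lt_0_compat; [apply exp_pos|].
    replace (Im (B * log_coord B z + - (A + B)%R * log_coord B (c * z))) with (B * Im (log_coord B z) - (A + B) * Im (log_coord B (c * z)))
      by (destruct (log_coord B z), (log_coord B (c * z)); simpl; ring).
    pose proof (Im_log_coord_ray B z c HO ltac:(lra)) as Hm. set (m := Im (log_coord B (c * z))) in *.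
    apply Rabs_lt_between in Hs. set (y := Im (log_coord B z)) in *.
    apply cos_gt_0.
    - destruct Hm as [Hm|Hm]; nra.
    - destruct Hm as [Hm|Hm]; nra. }
  assert (F0 : f 0 = 0).
  { unfold f. replace (0 * z)%C with (RtoC 0) by ring. rewrite Zfun_0.
    replace ((1 + B * z) / (z * z) * 0)%C with (RtoC 0) by ring. reflexivity. }
  assert (F1 : f 1 = Re (Zfun A B z / (z * z) * (1 + B * z))).
  { unfold f. f_equal. replace (1 * z)%C with z by ring. unfold Cdiv. ring. }
  assert (0 < (A - B) * c * Re ((1 + B * z) * kfun A B (c * z))).
  { apply Rmult_lt_0_compat; auto. apply Rmult_lt_0_compat; lra. }
  unfold df in C2. lra.
Qed.

Lemma Qfun_der_sign (A B : R) (z : C) : -1 <= B -> B < A -> A <= 1 -> halfplane B z -> Rabs (Im (log_coord B z)) < PI / 2 ->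
  exists l, cder (Qfun A B) z l /\ Re (l * (1 + B * z)) < 0.
Proof.
  intros HB HAB HA HO Hs. destruct (Ceq_dec z 0) as [->|Hz].
  - exists (C_derive (Qfun A B) 0). split.
    + apply (holo_der 1); [apply holo_Qfun; lra|rewrite Cmod_0; lra].
    + rewrite Qfun_der_0 by lra. simpl. lra.
  - eexists. split; [now apply cder_Qfun|]. now apply Zfun_sign.
Qed.

Lemma Qfun_der_neq_0 (A B : R) (z : C) : -1 <= B -> B < A -> A <= 1 -> Cmod z < 1 -> C_derive (Qfun A B) z <> 0%C.
Proof.
  intros HB HAB HA Hz E.
  destruct (Qfun_der_sign A B z HB HAB HA) as [l [D S]].
  - apply halfplane_disc; lra.
  - apply log_coord_strip; lra.
  - rewrite <- (cder_unique _ _ _ D), E in S. replace (0 * (1 + B * z))%C with (RtoC 0) in S by ring. simpl in S. lra.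
Qed.

Lemma convex_comb_lt (a b c t : R) : 0 <= t <= 1 -> a < c -> b < c -> (1 - t) * a + t * b < c.
Proof.
  intros Ht Ha Hb. destruct (Req_dec t 1) as [->|Ht1]; [lra|].
  assert (0 < (1 - t) * (c - a)) by (apply Rmult_lt_0_compat; lra).
  assert (0 <= t * (c - b)) by (apply Rmult_le_pos; lra). lra.
Qed.

(** In the variable [x] the strip [|Im x| < pi / 2] is convex and contains the image of the
    disc, and [dQ/dx = (1 + Bz) Q'(z)] has negative real part there. Along a segment from
    [x1] to [x2] the real part of [Q / (x2 - x1)] is therefore strictly decreasing. *)
Lemma Qfun_inj (A B : R) : -1 <= B -> B < A -> A <= 1 ->
  forall z1 z2 : C, Cmod z1 < 1 -> Cmod z2 < 1 -> Qfun A B z1 = Qfun A B z2 -> z1 = z2.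
Proof.
  intros HB HAB HA z1 z2 H1 H2 E. apply NNPP. intros Hne.
  assert (HB' : -1 <= B <= 1) by lra.
  pose proof (log_coord_strip B z1 HB' H1) as S1. pose proof (log_coord_strip B z2 HB' H2) as S2.
  pose proof (exp_int_log_coord B z1 (halfplane_disc B z1 HB' H1)) as G1. pose proof (exp_int_log_coord B z2 (halfplane_disc B z2 HB' H2)) as G2.
  set (x1 := log_coord B z1) in *. set (x2 := log_coord B z2) in *.
  assert (Hx : (x2 - x1)%C <> 0%C).
  { intros Ex. apply Hne. rewrite <- G1, <- G2. f_equal. replace x2 with ((x2 - x1) + x1)%C by ring. rewrite Ex. ring. }
  set (x := fun t : R => (x1 + (x2 - x1) * t)%C).
  assert (Sx : forall t, 0 <= t <= 1 -> Rabs (Im (x t)) < PI / 2).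
  { intros t Ht. unfold x. replace (Im (x1 + (x2 - x1) * t)) with ((1 - t) * Im x1 + t * Im x2) by (destruct x1, x2; simpl; ring).
    apply Rabs_lt_between in S1. apply Rabs_lt_between in S2. apply Rabs_def1.
    - apply convex_comb_lt; lra.
    - apply Ropp_lt_cancel. rewrite Ropp_involutive.
      replace (- ((1 - t) * Im x1 + t * Im x2)) with ((1 - t) * - Im x1 + t * - Im x2) by ring.
      apply convex_comb_lt; lra. }
  set (zt := fun t => exp_int B (x t)).
  assert (D : forall t, 0 <= t <= 1 -> exists d, is_derive (fun t => Re (/ (x2 - x1) * Qfun A B (zt t))) t d /\ d < 0).
  { intros t Ht. specialize (Sx t Ht).
    destruct (Qfun_der_sign A B (zt t) HB HAB HA) as [l [D S]].
    - apply halfplane_exp_int; auto.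
    - unfold zt. rewrite log_coord_exp_int; auto.
    - exists (Re (l * (1 + B * zt t))). split; auto.
      evar_last.
      + apply (pder_Re (fun t => / (x2 - x1) * Qfun A B (zt t))%C). apply pder_scal.
        apply (pder_chain (Qfun A B) zt); [exact D|].
        apply (pder_chain (exp_int B) x); [apply cder_exp_int|].
        apply pder_plus; [apply pder_const|apply pder_scal, pder_RtoC].
      + f_equal. unfold zt at 1. rewrite one_plus_exp_int. field; auto. }
  set (f := fun t => Re (/ (x2 - x1) * Qfun A B (zt t))) in *.
  destruct (mvt_is_derive f (Derive f) 0 1 Rlt_0_1) as [c [C1 C2]].
  - intros t Ht. apply Derive_correct.
    destruct (D t Ht) as [d [Hd _]]. exists d; exact Hd.
  - destruct (D c ltac:(lra)) as [d [Hd Hneg]].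
    replace (Derive f c) with d in C2 by (symmetry; apply is_derive_unique; exact Hd).
    assert (F : f 1 = f 0).
    { unfold f, zt, x. replace (x1 + (x2 - x1) * 1)%C with x2 by ring. replace (x1 + (x2 - x1) * 0)%C with x1 by ring.
      rewrite G1, G2, E. reflexivity. }
    lra.
Qed.

(** * The subordination of zf'/f to zK'/K *)

Lemma Cmult_reg_r (a b c : C) : c <> 0%C -> (a * c)%C = (b * c)%C -> a = b.
Proof.
  intros Hc H. replace a with (a * c / c)%C by (field; auto). rewrite H. field; auto.
Qed.

Lemma Cmod_1_plus_neq_0 (b : R) (z : C) : -1 <= b <= 1 -> Cmod z < 1 -> (1 + b * z)%C <> 0%C.
Proof. intros Hb Hz. now apply halfplane_neq_0, halfplane_disc. Qed.

(** This says that [q = 1 / Q] satisfies [q(z) = h(phi(z))] with [|phi(z)| <= |z|], [h(z) =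
    (1 + Az) / (1 + Bz)]. It is [subordination_principle] for the Moebius map [g(v) =
    h^(-1)(1 / v)]: at a point where [z phi' = m phi] the differential equation of [Q]
    becomes [z (1 + (A - mB) phi) = phi (1 + m + A phi)], and then [|z| < |phi|] is
    impossible because [|1 + (A - mB) phi| < |1 + m + A phi|]. *)
Lemma Qfun_bound (A B : R) : -1 <= B -> B < A -> A <= 1 ->
  forall z : C, Cmod z < 1 -> Cmod (1 - Qfun A B z) <= Cmod z * Cmod (A * Qfun A B z - B).
Proof.
  intros HB HAB HA. assert (HB' : -1 <= B <= 1) by lra.
  assert (HD : (A - B)%C <> 0%C) by (rewrite <- RtoC_minus; apply RtoC_neq_0; lra).
  set (U := fun v : C => Cmod (1 - v) < Cmod (A * v - B)).
  set (g := fun v : C => ((1 - v) / (A * v - B))%C).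
  set (g' := fun v : C => ((B - A) / ((A * v - B) * (A * v - B)))%C).
  assert (UW : forall v, U v -> (A * v - B)%C <> 0%C).
  { intros v Hv. apply Cmod_gt_0. unfold U in Hv. pose proof (Cmod_ge_0 (1 - v)). lra. }
  assert (Ug : forall v, U v -> (g v * (A * v - B))%C = (1 - v)%C).
  { intros v Hv. unfold g. specialize (UW v Hv). field; auto. }
  assert (Main : forall z : C, Cmod z < 1 -> U (Qfun A B z) /\ Cmod (g (Qfun A B z)) <= Cmod z).
  { apply (subordination_principle (Qfun A B) g g' U).
    - now apply holo_Qfun.
    - intros v Hv. unfold U in *. set (e := Cmod (A * v - B) - Cmod (1 - v)).
      exists (e / 4). split; [unfold e; lra|]. intros v' Hv'.
      pose proof (Cmod_triangle (1 - v) (v - v')) as T1. replace (1 - v + (v - v'))%C with (1 - v')%C in T1 by ring.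
      pose proof (Cmod_triang_inv (A * v - B) (A * (v - v'))) as T2.
      replace (A * v - B - A * (v - v'))%C with (A * v' - B)%C in T2 by ring.
      rewrite Cmod_mult, Cmod_R in T2. rewrite (Cmod_sub_sym v) in T1, T2.
      assert (Rabs A <= 1) by (apply Rabs_le; lra). pose proof (Cmod_ge_0 (v' - v)).
      assert (Rabs A * Cmod (v' - v) <= Cmod (v' - v)) by (pose proof (Rabs_pos A); nra). unfold e in *. lra.
    - intros v Hv. specialize (UW v Hv). unfold g, g'. eapply cder_val; [|apply (cder_div (fun v => 1 - v) (fun v => A * v - B))%C; [exact UW|cder_auto|cder_auto]].
      cbv beta. f_equal. ring.
    - rewrite Qfun_0 by auto. unfold U. replace (1 - 1)%C with (RtoC 0) by ring. rewrite Cmod_0.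
      replace (A * 1 - B)%C with (A - B)%C by ring. now apply Cmod_gt_0.
    - rewrite Qfun_0 by auto. unfold g. replace (1 - 1)%C with (RtoC 0) by ring. unfold Cdiv. ring.
    - intros sigma v Hs H. unfold U.
      assert (Hle : Cmod (1 - v) <= sigma * Cmod (A * v - B)).
      { apply Rnot_lt_le. intros Hlt. set (e := Cmod (1 - v) - sigma * Cmod (A * v - B)) in *.
        destruct (H (e / 4) ltac:(unfold e; lra)) as (v' & Hv' & Hg & Hd).
        pose proof (Ug v' Hv') as E. apply (f_equal Cmod) in E. rewrite Cmod_mult in E.
        pose proof (Cmod_triangle (1 - v') (v' - v)) as T1. replace (1 - v' + (v' - v))%C with (1 - v)%C in T1 by ring.
        pose proof (Cmod_triangle (A * v - B) (A * (v' - v))) as T2.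
        replace (A * v - B + A * (v' - v))%C with (A * v' - B)%C in T2 by ring.
        rewrite (Cmod_mult A), Cmod_R in T2.
        assert (Rabs A <= 1) by (apply Rabs_le; lra). pose proof (Cmod_ge_0 (v' - v)).
        assert (Rabs A * Cmod (v' - v) <= Cmod (v' - v)) by (pose proof (Rabs_pos A); nra).
        pose proof (Cmod_ge_0 (A * v' - B)).
        assert (Cmod (1 - v') <= sigma * Cmod (A * v' - B)) by (rewrite <- E; apply Rmult_le_compat_r; auto).
        assert (sigma * Cmod (A * v' - B) <= sigma * (Cmod (A * v - B) + Cmod (v' - v))) by (apply Rmult_le_compat_l; lra).
        assert (sigma * Cmod (v' - v) <= Cmod (v' - v)) by nra. unfold e in *. lra. }
      assert (W0 : 0 < Cmod (A * v - B)).
      { apply Cmod_gt_0. intros E. rewrite E, Cmod_0 in Hle. pose proof (Cmod_ge_0 (1 - v)).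
        assert (E1 : (1 - v)%C = 0%C) by (apply Cmod_eq_0; lra).
        apply HD. replace (A - B)%C with (A * (1 - v) + (A * v - B))%C by ring. rewrite E, E1. ring. }
      nra.
    - intros z m Hz HU Hm Hlt HJ. set (v := Qfun A B z) in *.
      pose proof (UW v HU) as HW. pose proof (Ug v HU) as Hphi. set (phi := g v) in *.
      set (W := (A * v - B)%C) in *.
      assert (P1 : Cmod phi < 1).
      { unfold U in HU. fold W in HU. apply (f_equal Cmod) in Hphi. rewrite Cmod_mult in Hphi.
        apply Cmod_gt_0 in HW. apply Rmult_lt_reg_r with (Cmod W); lra. }
      pose proof (Qfun_ode A B z HB' Hz) as Ode. fold v in Ode. set (T := (z * C_derive (Qfun A B) z)%C) in *.
      assert (HJ' : ((B - A) * T)%C = (m * phi * (W * W))%C).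
      { replace (z * (g' v * C_derive (Qfun A B) z))%C with ((B - A) * T / (W * W))%C in HJ.
        - rewrite <- HJ. field; auto.
        - unfold T, g'. fold W. field; auto. }
      (* solving phi = g(v) for v gives W = (A - B) / (1 + A phi) *)
      assert (W1 : (W * (1 + A * phi))%C = (A - B)%C).
      { transitivity (W + A * (phi * W))%C; [ring|]. rewrite Hphi. unfold W. ring. }
      assert (Ode' : ((1 + B * z) * T)%C = (W * (phi - z))%C).
      { rewrite Ode. transitivity (phi * W - z * W)%C; [|ring]. rewrite Hphi. unfold W. ring. }
      assert (E1 : ((1 + B * z) * m * phi)%C = ((z - phi) * (1 + A * phi))%C).
      { apply (Cmult_reg_r _ _ (A - B)%C HD).
        apply (Cmult_reg_r _ _ W HW).
        transitivity ((1 + B * z) * (m * phi * (W * W)) * (1 + A * phi))%C.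
        { rewrite <- W1. ring. }
        rewrite <- HJ'. transitivity ((B - A) * ((1 + B * z) * T) * (1 + A * phi))%C; [ring|].
        rewrite Ode'. ring. }
      assert (E2 : (z * (1 + (A - m * B)%R * phi))%C = (phi * (RtoC (1 + m) + A * phi))%C).
      { rewrite RtoC_minus, RtoC_plus, RtoC_mult.
        transitivity ((z - phi) * (1 + A * phi) - (1 + B * z) * m * phi + phi * (1 + m + A * phi))%C; [ring|].
        rewrite E1. ring. }
      apply (f_equal Cmod) in E2. rewrite !Cmod_mult in E2.
      set (u1 := Cmod (1 + (A - m * B)%R * phi)) in *. set (u2 := Cmod (RtoC (1 + m) + A * phi)) in *.
      assert (S : u1 ^ 2 < u2 ^ 2).
      { unfold u1, u2. rewrite !Cmod2_alt. pose proof (Cmod_ge_0 phi) as Pp.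
        assert (Hph : Re phi ^ 2 + Im phi ^ 2 < 1) by (rewrite <- Cmod2_alt; nra).
        clear - HB HAB HA Hm Hph. destruct phi as [x y]. simpl in *.
        set (s2 := x * x + y * y). assert (Hs : s2 < 1) by (unfold s2; lra). assert (Hs0 : 0 <= s2) by (unfold s2; nra).
        assert (Q1 : 0 < m * (1 - B * B * s2)).
        { apply Rmult_lt_0_compat; [lra|]. assert (B * B <= 1) by nra. nra. }
        assert (Q2 : 0 <= 1 + (A + B) * x + A * B * s2).
        { replace (1 + (A + B) * x + A * B * s2) with ((1 + A * x) * (1 + B * x) + A * B * (y * y)) by (unfold s2; ring).
          assert (Hx : -1 <= x <= 1) by (unfold s2 in Hs; split; nra).
          assert (Hy : y * y <= 1 - x * x) by (unfold s2 in Hs; lra).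
          assert (G0 : 0 <= y * y) by nra.
          destruct (Rle_lt_dec 0 (A * B)) as [HP|HP].
          - assert (0 <= 1 + A * x) by nra. assert (0 <= 1 + B * x) by nra.
            assert (0 <= (1 + A * x) * (1 + B * x)) by (apply Rmult_le_pos; lra). nra.
          - apply Rle_trans with ((1 + A * x) * (1 + B * x) + A * B * (1 - x * x)); [|nra].
            replace ((1 + A * x) * (1 + B * x) + A * B * (1 - x * x)) with (1 + A * B + (A + B) * x) by ring.
            assert (0 <= (1 + A) * (1 + B)) by (apply Rmult_le_pos; lra).
            assert (0 <= (1 - A) * (1 - B)) by (apply Rmult_le_pos; lra).
            destruct (Rle_lt_dec 0 (A + B)); nra. }
        assert (Q3 : 0 <= m * (1 + (A + B) * x + A * B * s2)) by (apply Rmult_le_pos; lra).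
        assert (0 < m * (m * (1 - B * B * s2) + 2 * (1 + (A + B) * x + A * B * s2))).
        { apply Rmult_lt_0_compat; lra. }
        unfold s2 in *. nra. }
      assert (0 <= u1) by apply Cmod_ge_0. assert (0 <= u2) by apply Cmod_ge_0.
      assert (u1 < u2) by nra. pose proof (Cmod_ge_0 z). nra. }
  intros z Hz. destruct (Main z Hz) as [HU Hg]. rewrite <- (Ug _ HU), Cmod_mult.
  apply Rmult_le_compat_r; auto. apply Cmod_ge_0.
Qed.

Lemma Qfun_neq_0 (A B : R) (z : C) : -1 <= B -> B < A -> A <= 1 -> Cmod z < 1 -> Qfun A B z <> 0%C.
Proof.
  intros HB HAB HA Hz E. pose proof (Qfun_bound A B HB HAB HA z Hz) as H. rewrite E in H.
  replace (1 - 0)%C with (RtoC 1) in H by ring. replace (A * 0 - B)%C with (RtoC (- B)) in H by (rewrite RtoC_opp; ring).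
  rewrite !Cmod_R, Rabs_R1, Rabs_Ropp in H. assert (Rabs B <= 1) by (apply Rabs_le; lra).
  pose proof (Cmod_ge_0 z). pose proof (Rabs_pos B). nra.
Qed.

(** The sign of this quadratic function tells whether [v] lies inside, on, or outside the
    boundary of [h(|w| < s)]. It is convex for [|s B| <= 1]. *)
Definition disc_gap (A B s : R) (v : C) : R := Cmod (v - 1) ^ 2 - s ^ 2 * Cmod (A - B * v) ^ 2.

Lemma disc_gap_convex (A B s l : R) (p q : C) : -1 <= B <= 1 -> 0 <= s <= 1 -> 0 <= l <= 1 ->
  disc_gap A B s (RtoC (1 - l) * q + RtoC l * p) <= (1 - l) * disc_gap A B s q + l * disc_gap A B s p.
Proof.
  intros HB Hs Hl.
  assert (E : disc_gap A B s (RtoC (1 - l) * q + RtoC l * p) = (1 - l) * disc_gap A B s q + l * disc_gap A B s p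
     - l * (1 - l) * (1 - s ^ 2 * B ^ 2) * Cmod (q - p) ^ 2).
  { unfold disc_gap. rewrite !Cmod2_alt. destruct p as [a b], q as [c d]. simpl. ring. }
  rewrite E.
  assert (B ^ 2 <= 1) by nra. assert (s ^ 2 <= 1) by nra. assert (0 <= B ^ 2) by nra. assert (0 <= s ^ 2) by nra.
  assert (s ^ 2 * B ^ 2 <= 1) by nra.
  assert (0 <= l * (1 - l) * (1 - s ^ 2 * B ^ 2) * Cmod (q - p) ^ 2).
  { apply Rmult_le_pos; [|apply pow2_ge_0]. apply Rmult_le_pos; [apply Rmult_le_pos; lra|lra]. }
  lra.
Qed.

Lemma disc_gap_janowski (A B s : R) (w : C) : -1 <= B <= 1 -> Cmod w < 1 ->
  disc_gap A B s ((1 + A * w) / (1 + B * w)) = (A - B) ^ 2 * (Cmod w ^ 2 - s ^ 2) / Cmod (1 + B * w) ^ 2.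
Proof.
  intros HB Hw. pose proof (Cmod_1_plus_neq_0 B w HB Hw) as Hn. unfold disc_gap.
  replace ((1 + A * w) / (1 + B * w) - 1)%C with (RtoC (A - B) * w / (1 + B * w))%C by (rewrite RtoC_minus; field; auto).
  replace (A - B * ((1 + A * w) / (1 + B * w)))%C with (RtoC (A - B) / (1 + B * w))%C by (rewrite RtoC_minus; field; auto).
  rewrite !Cmod_div, Cmod_mult, Cmod_R by auto. apply Cmod_gt_0 in Hn.
  rewrite <- (pow2_abs (A - B)). field. lra.
Qed.

(** Here [P] stands for [f / (z f')] and [om] for [Q^(-1) o P]. At a point where [z om' = m
    om], comparing the equations of [P] and of [Q] shows that [h(om)] is the convex
    combination [(1 - 1/m) q(om) + (1/m) h(w(z))]. If [|z| < |om|], the point [q(om)] lies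
    in the closed disc [h(|.| <= |om|)] by [Qfun_bound] and [h(w(z))] in its interior,
    whereas [h(om)] lies on its boundary. *)
Lemma janowski_subordination (A B : R) (w P : C -> C) : -1 <= B -> B < A -> A <= 1 ->
  holo 1 w -> (forall z : C, Cmod z < 1 -> Cmod (w z) < 1) -> w 0%C = 0%C ->
  holo 1 P -> P 0%C = 1%C ->
  (forall z : C, Cmod z < 1 -> (z * C_derive P z)%C = (1 - (1 + A * w z) / (1 + B * w z) * P z)%C) ->
  exists om, holo 1 om /\ om 0%C = 0%C /\
    forall z : C, Cmod z < 1 -> Cmod (om z) <= Cmod z /\ P z = Qfun A B (om z).
Proof.
  intros HB HAB HA Hw Hw1 Hw0 HP HP0 Ode. assert (HB' : -1 <= B <= 1) by lra.
  pose proof (Qfun_inj A B HB HAB HA) as Hinj. pose proof (holo_Qfun A B HB') as HQ.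
  set (Q := Qfun A B) in *. set (g := disc_inv Q).
  assert (H01 : Cmod 0 < 1) by (rewrite Cmod_0; lra).
  assert (Q0 : Q 0%C = 1%C) by now apply Qfun_0.
  set (U := fun v : C => exists z : C, Cmod z < 1 /\ Q z = v).
  assert (Hsch : forall z : C, Cmod z < 1 -> Cmod (w z) <= Cmod z).
  { intros z Hz. rewrite <- (Rmult_1_l (Cmod z)). apply schwarz; auto; [|lra]. intros y Hy. left; auto. }
  assert (Ug : forall v, U v -> Cmod (g v) < 1 /\ Q (g v) = v).
  { intros v (z & Hz & <-). unfold g. rewrite disc_inv_spec; auto. }
  assert (Dg : forall v, U v -> cder g v (/ C_derive Q (g v))).
  { intros v (z & Hz & <-). unfold g. rewrite disc_inv_spec by auto. apply disc_inv_cder; auto. apply Qfun_der_neq_0; auto. }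
  assert (U1 : U 1%C) by (exists 0%C; auto).
  assert (g1 : g 1%C = 0%C) by (rewrite <- Q0; apply disc_inv_spec; auto).
  assert (Main : forall z : C, Cmod z < 1 -> U (P z) /\ Cmod (g (P z)) <= Cmod z).
  { apply (subordination_principle P g (fun v => / C_derive Q (g v))%C U); auto.
    - intros v (z & Hz & <-). destruct (injective_open Q z 1 HQ Hinj Hz Rlt_0_1) as [e [He H]].
      exists e. split; auto. intros v' Hv'. destruct (H v' Hv') as (y & Hy & _ & Ey). now exists y.
    - rewrite HP0; auto.
    - rewrite HP0; auto.
    - intros sigma v Hs H. destruct (image_disc_closed Q sigma v HQ Hs) as [z [Hz Ez]].
      + intros e He. destruct (H e He) as (v' & Hv' & Hg & Hd). destruct (Ug v' Hv') as [G1 G2].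
        exists (g v'). split; auto. now rewrite G2.
      + exists z. split; auto. lra.
    - intros z m Hz HU Hm Hlt HJ. destruct (Ug _ HU) as [G1 G2]. set (om := g (P z)) in *.
      assert (HQ' : C_derive Q om <> 0%C) by (apply Qfun_der_neq_0; auto).
      assert (HJ1 : (z * C_derive P z)%C = (m * (om * C_derive Q om))%C).
      { transitivity ((z * (/ C_derive Q om * C_derive P z)) * C_derive Q om)%C; [field; auto|].
        rewrite HJ. ring. }
      rewrite (Ode z Hz) in HJ1. rewrite <- G2 in HJ1.
      pose proof (Qfun_ode A B om HB' G1) as Ode2. fold Q in Ode2.
      pose proof (Cmod_1_plus_neq_0 B om HB' G1) as N1.
      pose proof (Cmod_1_plus_neq_0 B (w z) HB' (Hw1 z Hz)) as N2.
      pose proof (Qfun_neq_0 A B om HB HAB HA G1) as NQ. fold Q in NQ.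
      set (hw := ((1 + A * w z) / (1 + B * w z))%C) in *. set (ho := ((1 + A * om) / (1 + B * om))%C).
      assert (Ode3 : (om * C_derive Q om)%C = (1 - ho * Q om)%C).
      { apply (Cmult_reg_r _ _ (1 + B * om)%C N1). rewrite Cmult_comm, Ode2. unfold ho. field; auto. }
      rewrite Ode3 in HJ1. set (q := (/ Q om)%C).
      assert (Hmc : RtoC m <> 0%C) by (apply RtoC_neq_0; lra).
      assert (Hho : ho = (RtoC (1 - / m) * q + RtoC (/ m) * hw)%C).
      { rewrite RtoC_minus, RtoC_inv by lra.
        apply (Cmult_reg_r _ _ (m * Q om)%C); [now apply Cmult_neq_0|].
        transitivity (m - m * (1 - ho * Q om))%C; [ring|]. rewrite <- HJ1. unfold q. field; auto. }
      set (s := Cmod om) in *. assert (Hs : 0 <= s <= 1) by (split; [apply Cmod_ge_0|lra]).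
      assert (Hl : 0 < / m <= 1).
      { split; [apply Rinv_0_lt_compat; lra|]. rewrite <- Rinv_1. apply Rinv_le_contravar; lra. }
      assert (N_ho : disc_gap A B s ho = 0).
      { unfold ho. rewrite disc_gap_janowski by auto. unfold s. unfold Rminus at 2. rewrite Rplus_opp_r. unfold Rdiv. ring. }
      assert (N_hw : disc_gap A B s hw < 0).
      { unfold hw. rewrite disc_gap_janowski by auto. pose proof (Hsch z Hz). pose proof (Cmod_ge_0 (w z)).
        apply Cmod_gt_0 in N2. apply Rlt_div_l; [now apply pow_lt|]. rewrite Rmult_0_l.
        assert (0 < (A - B) ^ 2) by (apply pow_lt; lra).
        assert (Cmod (w z) < s) by lra. clearbody s.
        assert (Cmod (w z) ^ 2 < s ^ 2) by nra.
        assert (0 < (A - B) ^ 2 * (s ^ 2 - Cmod (w z) ^ 2)) by (apply Rmult_lt_0_compat; lra). lra. }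
      assert (N_q : disc_gap A B s q <= 0).
      { unfold disc_gap, q. pose proof (Qfun_bound A B HB HAB HA om G1) as HQb. fold Q s in HQb.
        replace (/ Q om - 1)%C with ((1 - Q om) / Q om)%C by (field; auto).
        replace (A - B * / Q om)%C with ((A * Q om - B) / Q om)%C by (field; auto).
        rewrite !Cmod_div by auto. apply Cmod_gt_0 in NQ.
        set (a := Cmod (1 - Q om)) in *. set (b := Cmod (A * Q om - B)) in *. set (c := Cmod (Q om)) in *.
        replace ((a / c) ^ 2 - s ^ 2 * (b / c) ^ 2) with ((a ^ 2 - (s * b) ^ 2) / c ^ 2) by (field; lra).
        apply Rle_div_l; [now apply pow_lt|]. rewrite Rmult_0_l.
        assert (0 <= a) by apply Cmod_ge_0. assert (a ^ 2 <= (s * b) ^ 2) by (apply pow_incr; auto). lra. }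
      pose proof (disc_gap_convex A B s (/ m) hw q HB' Hs ltac:(lra)) as Cv. rewrite <- Hho, N_ho in Cv.
      assert (0 <= (1 - / m) * - disc_gap A B s q) by (apply Rmult_le_pos; lra).
      assert (0 < / m * - disc_gap A B s hw) by (apply Rmult_lt_0_compat; lra). lra. }
  exists (fun z => g (P z)). split; [|split].
  - intros z Hz. destruct (Main z Hz) as [HU _]. eexists. apply (cder_comp g P); [now apply Dg|]. now apply (holo_der 1).
  - cbv beta. now rewrite HP0.
  - intros z Hz. destruct (Main z Hz) as [HU HM]. split; auto. symmetry. now apply Ug.
Qed.

(** * Coefficients *)

(** The bound on [f''/f'] makes [|f'(tz)|^2 exp(2ct)] nondecreasing in [t]. Its derivative
    is nonnegative also where [f'] vanishes, since [|f'|^2] has a critical point there. *)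
Lemma C_derive_zero_free (f : C -> C) (c : R) (z : C) : holo 1 f -> Cmod z < 1 -> C_derive f 0 <> 0%C ->
  (forall t : R, 0 < t < 1 ->
     C_derive f (t * z) <> 0%C ->
     Cmod (z * C_derive (C_derive f) (t * z)) <= c * Cmod (C_derive f (t * z))) ->
  C_derive f z <> 0%C.
Proof.
  intros Hf Hz H0 Hb E.
  pose proof (holo_C_derive 1 f Hf) as Hf1. pose proof (holo_C_derive 1 _ Hf1) as Hf2.
  set (f1 := C_derive f) in *. set (f2 := C_derive f1) in *.
  assert (Hin : forall t, 0 <= t <= 1 -> Cmod (t * z) < 1).
  { intros t Ht. rewrite Cmod_mult, Cmod_R, Rabs_pos_eq by lra. pose proof (Cmod_ge_0 z). nra. }
  set (N := fun t : R => Cmod (f1 (t * z)%C) ^ 2).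
  assert (D : forall t, 0 <= t <= 1 -> is_derive N t
      (2 * (Re (f1 (t * z)%C) * Re (z * f2 (t * z))%C + Im (f1 (t * z)%C) * Im (z * f2 (t * z))%C))).
  { intros t Ht. apply (pder_Cmod2 (fun t => f1 (t * z)%C)).
    eapply pder_val; [|apply (pder_chain f1 (fun t => t * z)%C)].
    2: apply (holo_der 1); auto.
    2: eapply pder_ext; [intros; apply Cmult_comm|]; apply pder_scal, pder_RtoC.
    cbv beta. fold f2. ring. }
  set (g := fun t : R => N t * exp (2 * c * t)).
  set (dg := fun t : R => (2 * (Re (f1 (t * z)%C) * Re (z * f2 (t * z))%C + Im (f1 (t * z)%C) * Im (z * f2 (t * z))%C))
     * exp (2 * c * t) + N t * (2 * c * exp (2 * c * t))).
  assert (Dg : forall t, 0 <= t <= 1 -> is_derive g t (dg t)).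
  { intros t Ht. evar_last.
    - apply (is_derive_mult (K := R_AbsRing)); [now apply D| |intros; apply Rmult_comm].
      apply (is_derive_comp (K := R_AbsRing) (V := R_NormedModule) exp (fun t => 2 * c * t)).
      + apply is_derive_exp.
      + apply (is_derive_scal (fun t => t)). apply (is_derive_id (K := R_AbsRing)).
    - unfold dg, plus, mult, scal; simpl. unfold mult, one; simpl. ring. }
  destruct (mvt_is_derive g dg 0 1 Rlt_0_1 Dg) as [t [Ht T]].
  assert (Pos : 0 <= dg t).
  { unfold dg. pose proof (exp_pos (2 * c * t)).
    apply Rle_trans with (exp (2 * c * t) * 2 * ((Re (f1 (t * z)%C) * Re (z * f2 (t * z))%C + Im (f1 (t * z)%C) * Im (z * f2 (t * z))%C) + c * N t)).
    2: right; ring.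
    apply Rmult_le_pos; [lra|].
    destruct (Ceq_dec (f1 (t * z)%C) 0) as [E0|E0].
    - unfold N. rewrite E0, Cmod_0. simpl. lra.
    - specialize (Hb t Ht E0). unfold N. set (u := f1 (t * z)%C) in *. set (v := (z * f2 (t * z))%C) in *.
      assert (Bd : Rabs (Re (Cconj u * v)) <= c * Cmod u ^ 2).
      { eapply Rle_trans; [apply re_le_Cmod|]. rewrite Cmod_mult, Cmod_conj.
        pose proof (Cmod_ge_0 u). nra. }
      apply Rabs_le_between in Bd. replace (Re (Cconj u * v)) with (Re u * Re v + Im u * Im v) in Bd
        by (destruct u, v; simpl; ring). lra. }
  assert (G0 : 0 < g 0).
  { unfold g, N. replace (0 * z)%C with (RtoC 0) by ring. apply Rmult_lt_0_compat; [|apply exp_pos].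
    apply pow_lt. now apply Cmod_gt_0. }
  assert (G1 : g 1 = 0).
  { unfold g, N. replace (1 * z)%C with z by ring. rewrite E, Cmod_0. ring. }
  lra.
Qed.

Lemma divz_0 (F : C -> C) : divz F 0 = C_derive F 0.
Proof. unfold divz. now destruct (Ceq_dec 0 0). Qed.

(** Schwarz's lemma for [w] bounds [f''/f' = (h(w) - 1) / z] near the origin, so that [f']
    has no zero and [P = f / (z f')] is holomorphic with [z P' = 1 - h(w) P]. *)
Lemma janowski_convex_subordinate (A B : R) (f : C -> C) : -1 <= B -> B < A -> A <= 1 -> janowski_convex A B f ->
  (forall z : C, Cmod z < 1 -> C_derive f z <> 0%C) /\
  exists om, holo 1 om /\ om 0%C = 0%C /\
    forall z : C, Cmod z < 1 -> Cmod (om z) <= Cmod z /\ (divz f z / C_derive f z)%C = Qfun A B (om z).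
Proof.
  intros HB HAB HA [[Hf [f0 f1]] (_ & _ & w & Hw & Hw1 & Hw0 & Heq)].
  assert (HB' : -1 <= B <= 1) by lra.
  assert (Hf' : holo 1 f) by exact Hf. assert (Hw' : holo 1 w) by exact Hw.
  assert (Hsch : forall z : C, Cmod z < 1 -> Cmod (w z) <= Cmod z).
  { intros z Hz. rewrite <- (Rmult_1_l (Cmod z)). apply schwarz; auto; [|lra]. intros y Hy. left; now apply Hw1. }
  pose proof (holo_C_derive 1 f Hf') as Hf1. pose proof (holo_C_derive 1 _ Hf1) as Hf2.
  assert (C10 : RtoC 1 <> 0%C) by (apply RtoC_neq_0; lra).
  assert (Hzf : forall z : C, Cmod z < 1 -> C_derive f z <> 0%C ->
     (z * C_derive (C_derive f) z)%C = (RtoC (A - B) * w z / (1 + B * w z) * C_derive f z)%C).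
  { intros z Hz Hn. specialize (Heq z Hz). cbv beta in Heq.
    pose proof (Cmod_1_plus_neq_0 B (w z) HB' (Hw1 z Hz)) as Hn2.
    replace (z * C_derive (C_derive f) z)%C with
      (((1 + z * C_derive (C_derive f) z / C_derive f z) - 1) * C_derive f z)%C by (field; auto).
    rewrite Heq, RtoC_minus. field; auto. }
  assert (Hne : forall z : C, Cmod z < 1 -> C_derive f z <> 0%C).
  { intros z Hz.
    apply (C_derive_zero_free f (2 * Cmod z / (1 - Cmod z))); auto; [rewrite f1; auto|].
    intros t Ht Hn.
    assert (Hz0 : 0 <= Cmod z) by apply Cmod_ge_0.
    assert (Htz : Cmod (t * z) = t * Cmod z) by (rewrite Cmod_mult, Cmod_R, Rabs_pos_eq; lra).
    assert (Htz1 : Cmod (t * z) < 1) by (rewrite Htz; nra).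
    pose proof (Hzf _ Htz1 Hn) as E. pose proof (Hsch _ Htz1) as Hwb.
    pose proof (Cmod_1_plus_neq_0 B (w (t * z)%C) HB' (Hw1 _ Htz1)) as Hn2.
    assert (Hden : 1 - Cmod z <= Cmod (1 + B * w (t * z)%C)).
    { pose proof (Cmod_triang_inv 1 (- (B * w (t * z)%C))) as T. rewrite Cmod_1, Cmod_opp, Cmod_mult, Cmod_R in T.
      replace (1 - - (B * w (t * z)%C))%C with (1 + B * w (t * z)%C)%C in T by ring.
      assert (Rabs B <= 1) by (apply Rabs_le; lra). pose proof (Cmod_ge_0 (w (t * z)%C)). rewrite Htz in Hwb. nra. }
    apply (f_equal Cmod) in E. rewrite <- Cmult_assoc in E. rewrite (Cmod_mult t), Cmod_R, Rabs_pos_eq in E by lra.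
    apply Rmult_le_reg_l with t; [lra|]. rewrite E. rewrite Cmod_mult, Cmod_div, Cmod_mult, Cmod_R, (Rabs_pos_eq (A - B)) by (auto; lra).
    rewrite <- Rmult_assoc. apply Rmult_le_compat_r; [apply Cmod_ge_0|].
    replace (t * (2 * Cmod z / (1 - Cmod z))) with (2 * (t * Cmod z) / (1 - Cmod z)) by (field; lra).
    unfold Rdiv. apply Rmult_le_compat.
    - apply Rmult_le_pos; [lra|apply Cmod_ge_0].
    - left. apply Rinv_0_lt_compat. now apply Cmod_gt_0.
    - rewrite <- Htz. apply Rmult_le_compat; try lra. apply Cmod_ge_0.
    - apply Rinv_le_contravar; lra. }
  split; auto.
  assert (HP : holo 1 (fun z => divz f z / C_derive f z)%C).
  { apply holo_mult; [now apply holo_divz|]. now apply holo_inv. }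
  apply (janowski_subordination A B w); auto.
  - rewrite divz_0, f1. field; auto.
  - intros z Hz. pose proof (Hne z Hz) as Hn.
    pose proof (holo_der 1 _ z (holo_divz 1 f Hf') Hz) as D1. pose proof (holo_der 1 _ z Hf1 Hz) as D2.
    rewrite (cder_unique _ _ _ (cder_div _ _ _ _ _ Hn D1 D2)).
    assert (E1 : C_derive f z = (divz f z + z * C_derive (divz f) z)%C).
    { apply cder_unique. apply (cder_ext (fun z => f 0%C + z * divz f z)%C); [intros; symmetry; apply divz_eq|].
      eapply cder_val; [|apply cder_plus; [apply cder_const|apply cder_mult; [apply cder_id|exact D1]]]. cbv beta. ring. }
    rewrite <- (Heq z Hz).
    set (a := C_derive f z) in *. set (b := C_derive (C_derive f) z) in *. set (p := divz f z) in *. set (q := C_derive (divz f) z) in *.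
    assert (E2 : (z * q)%C = (a - p)%C) by (rewrite E1; ring).
    transitivity ((z * q) * a / (a * a) - p * (z * b) / (a * a))%C; [field; auto|].
    rewrite E2. field; auto.
Qed.

Lemma pser_cons (b : nat -> C) (c0 : C) (z l : C) : pser b z l ->
  pser (fun n => match n with O => c0 | S k => b k end) z (c0 + z * l)%C.
Proof.
  intros H e He. pose proof (Cmod_ge_0 z).
  destruct (H (e / (Cmod z + 1)) ltac:(apply Rdiv_lt_0_compat; lra)) as [N HN].
  exists (S N). intros [|n] Hn; [lia|]. specialize (HN n ltac:(lia)).
  rewrite csum_split. simpl Cpow at 1. cbv beta iota.
  rewrite (csum_ext _ (fun k => z * (b k * z ^ k))%C) by (intros; rewrite Cpow_S; ring).
  rewrite csum_scal. set (s := csum _ n) in *.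
  replace (c0 * 1 + z * s - (c0 + z * l))%C with (z * (s - l))%C by ring.
  rewrite Cmod_mult. apply Rlt_div_r in HN; [|lra]. pose proof (Cmod_ge_0 (s - l)). nra.
Qed.

(** If the coefficients of order less than [n] of a vanishing series are [0], then that of
    order [n] is [O(|z|)] by [pser_tail]. *)
Lemma pser_coef_unique (a b : nat -> C) (F : C -> C) d : 0 < d ->
  (forall z : C, 0 < Cmod z < d -> pser a z (F z) /\ pser b z (F z)) -> forall n, a n = b n.
Proof.
  intros Hd H.
  assert (Hz : forall z : C, 0 < Cmod z < d -> pser (fun n => a n - b n)%C z 0).
  { intros z Hz. destruct (H z Hz) as [Ha Hb]. replace (RtoC 0) with (F z - F z)%C by ring. now apply pser_minus. }
  assert (Hr : Cmod (d / 2)%R = d / 2) by (rewrite Cmod_R; apply Rabs_pos_eq; lra).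
  destruct (pser_coef_bound _ _ _ (Hz (d / 2)%R ltac:(rewrite Hr; lra))) as (M & HM & HB). rewrite Hr in HB.
  assert (K : forall n, (a n - b n)%C = 0%C).
  { intros n. induction n as [n IH] using lt_wf_ind.
    apply (zero_of_linear_bound (fun _ => (a n - b n)%C) (2 * M * / (d / 2) ^ S n) (d / 4)).
    - intros e He. exists 1. split; [lra|]. intros. replace (_ - _)%C with (RtoC 0) by ring. now rewrite Cmod_0.
    - lra.
    - intros z Hzz. pose proof (pser_tail _ z _ M (d / 2) (S n) ltac:(lra) ltac:(lra) HB ltac:(lra) (Hz z ltac:(lra))) as T.
      simpl csum in T.
      assert (Z : csum (fun k => (a k - b k) * z ^ k)%C n = 0%C).
      { rewrite (csum_ext _ (fun _ => 0 * 0)%C) by (intros k Hk; rewrite (IH k Hk); ring). rewrite csum_scal. ring. }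
      rewrite Z in T. replace (0 - (0 + (a n - b n) * z ^ n))%C with (- ((a n - b n) * z ^ n))%C in T by ring.
      rewrite Cmod_opp, Cmod_mult, Cmod_pow in T. unfold Rdiv in T at 1. rewrite Rpow_mult_distr, pow_inv in T.
      assert (Pn : 0 < Cmod z ^ n) by (apply pow_lt; lra).
      apply Rmult_le_reg_r with (Cmod z ^ n); auto. eapply Rle_trans; [exact T|]. right.
      change (Cmod z ^ S n) with (Cmod z * Cmod z ^ n). ring. }
  intros n. replace (a n) with ((a n - b n) + b n)%C by ring. rewrite K. ring.
Qed.

(** Near the origin [f = z exp(g)], hence [z f' / f = 1 + z g']. *)
Lemma log_coef_series (f : C -> C) (gam : nat -> C) : holo 1 f -> f 0%C = 0%C ->
  (forall z : C, Cmod z < 1 -> C_derive f z <> 0%C) -> log_coefficients f gam ->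
  exists rho, 0 < rho < 1 /\ forall z : C, Cmod z < rho ->
    divz f z <> 0%C /\
    pser (fun n => match n with O => 1%C | S k => INR (S k) * (2 * gam (S k)) end)%C z (C_derive f z / divz f z)%C.
Proof.
  intros Hf f0 Hne (g & (g0 & Hg & Hexp) & Hser).
  apply locally_eps in Hg. destruct Hg as (d1 & Hd1 & Hg).
  apply locally'_eps in Hexp. destruct Hexp as (d2 & Hd2 & Hexp).
  apply locally_eps in Hser. destruct Hser as (d3 & Hd3 & Hser).
  set (d := Rmin (Rmin d1 d2) (Rmin d3 1)).
  assert (Hd : 0 < d) by (repeat apply Rmin_glb_lt; lra).
  assert (L1 : d <= d1) by (eapply Rle_trans; [apply Rmin_l|apply Rmin_l]).
  assert (L2 : d <= d2) by (eapply Rle_trans; [apply Rmin_l|apply Rmin_r]).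
  assert (L3 : d <= d3) by (eapply Rle_trans; [apply Rmin_r|apply Rmin_l]).
  assert (L4 : d <= 1) by (eapply Rle_trans; [apply Rmin_r|apply Rmin_r]).
  clearbody d.
  assert (S0 : forall z : C, (z - RtoC 0)%C = z) by (intros; ring).
  set (a := fun n => match n with O => RtoC 0 | S _ => (2 * gam n)%C end) in *.
  assert (Ha : forall z : C, Cmod z < d -> pser a z (g z)).
  { intros z Hz. apply has_expansion_pser. apply Hser. rewrite S0. lra. }
  assert (Hfg : forall z : C, Cmod z < d -> f z = (z * Cexp (g z))%C).
  { intros z Hz. destruct (Ceq_dec z 0) as [->|Hz0]; [rewrite f0; ring|].
    rewrite Hexp; auto; [field; auto|]. rewrite S0. lra. }
  assert (Hr : Cmod (d / 2)%R = d / 2) by (rewrite Cmod_R; apply Rabs_pos_eq; lra).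
  destruct (pser_coef_bound _ _ _ (Ha (d / 2)%R ltac:(rewrite Hr; lra))) as (M & HM & HB). rewrite Hr in HB.
  exists (d / 2). split; [lra|]. intros z Hz.
  destruct (pser_cder a g M (d / 2) z ltac:(lra) HB) as (dg & Dg & Sg); [intros; apply Ha; lra|auto|].
  assert (Df : cder f z (Cexp (g z) * (1 + z * dg))%C).
  { apply (cder_ext_near (fun y => y * Cexp (g y))%C _ _ _ (d - Cmod z)); [lra| |].
    - intros y Hy. symmetry. apply Hfg.
      pose proof (Cmod_triangle (y - z) z) as T. replace (y - z + z)%C with y in T by ring. lra.
    - eapply cder_val; [|apply cder_mult; [apply cder_id|apply (cder_comp Cexp g); [apply cder_Cexp|exact Dg]]].
      cbv beta. ring. }
  assert (Dz : divz f z = Cexp (g z)).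
  { unfold divz. destruct (Ceq_dec z 0) as [Hz0|Hz0].
    - rewrite Hz0 in Df. rewrite Hz0, (cder_unique _ _ _ Df). ring.
    - rewrite f0, Hfg by lra. field; auto. }
  split; [rewrite Dz; apply Cexp_neq_0|].
  rewrite (cder_unique _ _ _ Df), Dz.
  replace (Cexp (g z) * (1 + z * dg) / Cexp (g z))%C with (1 + z * dg)%C by (field; apply Cexp_neq_0).
  exact (pser_cons _ 1%C z dg Sg).
Qed.

Lemma psi_series (A B : R) (E : nat -> C) : -1 <= B -> B < A -> A <= 1 -> psi_coefficients A B E ->
  exists rho, 0 < rho < 1 /\ forall z : C, Cmod z < rho ->
    pser (fun n => match n with O => 1%C | S _ => E n end) z (/ Qfun A B z)%C.
Proof.
  intros HB HAB HA HE. assert (HB' : -1 <= B <= 1) by lra.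
  apply locally'_eps in HE. destruct HE as (d & Hd & HE).
  exists (Rmin d (1 / 2)). pose proof (Rmin_l d (1 / 2)). pose proof (Rmin_r d (1 / 2)).
  split; [split; [apply Rmin_glb_lt; lra|lra]|]. intros z Hz.
  destruct (Ceq_dec z 0) as [->|Hz0].
  - rewrite Qfun_0 by auto. replace (/ 1)%C with (1 + 0 * 0)%C.
    2:{ field. }
    intros e He. exists 1%nat. intros [|n] Hn; [lia|].
    rewrite (csum_pow_0 (fun n => match n with O => 1%C | S _ => E n end)).
    replace (1 - (1 + 0 * 0))%C with (RtoC 0) by ring. now rewrite Cmod_0.
  - apply has_expansion_pser. specialize (HE z).
    replace (/ Qfun A B z)%C with (janowski_psi A B z).
    + apply HE; auto. replace (z - RtoC 0)%C with z by ring. lra.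
    + unfold janowski_psi. replace (janowski_K A B) with (Kfun A B).
      2:{ apply functional_extensionality. intros y. symmetry. now apply janowski_K_eq. }
      assert (HO : halfplane B z) by (apply halfplane_disc; auto; lra).
      rewrite (cder_unique _ _ _ (cder_Kfun A B z HO)).
      assert (HQ : Qfun A B z <> 0%C) by (apply Qfun_neq_0; auto; lra).
      rewrite Qfun_val in * by auto.
      replace (- (A - B)%R * log_coord B z)%C with (- ((A - B)%R * log_coord B z))%C in * by ring.
      rewrite Cexp_opp in *. pose proof (Cexp_neq_0 ((A - B)%R * log_coord B z)).
      assert (HK : Kfun A B z <> 0%C).
      { intros EK. apply HQ. rewrite EK. unfold Cdiv. ring. }
      field; auto.
Qed.

(** Rogosinski's inequality for [z f' / f = q o om]. *)
Lemma coef_majorization (A B : R) (E : nat -> C) (f : C -> C) (gam : nat -> C) : -1 <= B -> B < A -> A <= 1 -> psi_coefficients A B E ->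
  janowski_convex A B f -> log_coefficients f gam ->
  forall N, rsum (fun k => INR (S k) ^ 2 * Cmod (gam (S k)) ^ 2) N <= 1 / 4 * rsum (fun k => Cmod (E (S k)) ^ 2) N.
Proof.
  intros HB HAB HA HE Hf Hgam N.
  destruct (janowski_convex_subordinate A B f HB HAB HA Hf) as (Hne & om & Hom & om0 & Hsub).
  destruct Hf as [[Hf [f0 _]] _].
  destruct (log_coef_series f gam Hf f0 Hne Hgam) as (r1 & Hr1 & S1).
  destruct (psi_series A B E HB HAB HA HE) as (r2 & Hr2 & S2).
  set (c := fun n => match n with O => RtoC 1 | S k => (INR (S k) * (2 * gam (S k)))%C end) in *.
  set (e := fun n => match n with O => RtoC 1 | S _ => E n end) in *.
  set (r := Rmin r1 r2). assert (Hr : 0 < r) by (apply Rmin_glb_lt; lra).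
  assert (Ra : r <= r1) by apply Rmin_l. assert (Rb : r <= r2) by apply Rmin_r. clearbody r.
  assert (Hrr : Cmod (r / 2)%R = r / 2) by (rewrite Cmod_R; apply Rabs_pos_eq; lra).
  destruct (S1 (r / 2)%R ltac:(rewrite Hrr; lra)) as [_ T1].
  pose proof (S2 (r / 2)%R ltac:(rewrite Hrr; lra)) as T2.
  apply pser_coef_bound in T1. destruct T1 as (M1 & HM1 & B1). apply pser_coef_bound in T2. destruct T2 as (M2 & HM2 & B2).
  rewrite Hrr in B1, B2.
  assert (Rog : rsum (fun k => Cmod (c k) ^ 2) (S N) <= rsum (fun k => Cmod (e k) ^ 2) (S N)).
  { apply (rogosinski om); auto.
    - intros z Hz. destruct (Hsub z Hz). lra.
    - exists ((2 * M1 + 2 * M2) * / (r / 2) ^ S N), (r / 4). split; [lra|]. intros z Hz.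
      destruct (Hsub z ltac:(lra)) as [Ho1 Ho2].
      destruct (S1 z ltac:(lra)) as [Dn P1]. pose proof (S2 (om z) ltac:(lra)) as P2.
      rewrite <- Ho2 in P2. replace (/ (divz f z / C_derive f z))%C with (C_derive f z / divz f z)%C in P2.
      2:{ specialize (Hne z ltac:(lra)). field; auto. }
      pose proof (pser_tail c z _ M1 (r / 2) (S N) ltac:(lra) ltac:(lra) B1 ltac:(lra) P1) as Q1.
      pose proof (pser_tail e (om z) _ M2 (r / 2) (S N) ltac:(lra) ltac:(lra) B2 ltac:(lra) P2) as Q2.
      set (s1 := csum (fun k => e k * om z ^ k)%C (S N)) in *. set (s2 := csum (fun k => c k * z ^ k)%C (S N)) in *.
      set (l := (C_derive f z / divz f z)%C) in *.
      replace (s1 - s2)%C with ((l - s2) + - (l - s1))%C by ring.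
      eapply Rle_trans; [apply Cmod_triangle|]. rewrite Cmod_opp.
      assert (Pw : (Cmod (om z) / (r / 2)) ^ S N <= (Cmod z / (r / 2)) ^ S N).
      { apply pow_incr. split.
        - apply le_div_r; [lra|]. rewrite Rmult_0_l. apply Cmod_ge_0.
        - apply Rmult_le_compat_r; auto. left; apply Rinv_0_lt_compat; lra. }
      assert (2 * M2 * (Cmod (om z) / (r / 2)) ^ S N <= 2 * M2 * (Cmod z / (r / 2)) ^ S N) by (apply Rmult_le_compat_l; lra).
      replace ((2 * M1 + 2 * M2) * / (r / 2) ^ S N * Cmod z ^ S N) with
        (2 * M1 * (Cmod z / (r / 2)) ^ S N + 2 * M2 * (Cmod z / (r / 2)) ^ S N).
      + lra.
      + unfold Rdiv at 1 3. rewrite !Rpow_mult_distr, !pow_inv. ring. }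
  rewrite !rsum_split in Rog. unfold c, e in Rog. rewrite Cmod_1 in Rog.
  rewrite (rsum_ext (fun k => Cmod (INR (S k) * (2 * gam (S k)))%C ^ 2) (fun k => 4 * (INR (S k) ^ 2 * Cmod (gam (S k)) ^ 2))) in Rog.
  - rewrite rsum_scal in Rog. lra.
  - intros k _. rewrite !Cmod_mult, !Cmod_R, (Rabs_pos_eq 2), (Rabs_pos_eq (INR (S k))) by (try apply pos_INR; lra). ring.
Qed.

(** Summation by parts. *)
Lemma abel_majorization (x y lam : nat -> R) : (forall k, 0 <= lam k) -> (forall k, lam (S k) <= lam k) ->
  (forall N, rsum x N <= rsum y N) -> forall N, rsum (fun k => lam k * x k) N <= rsum (fun k => lam k * y k) N.
Proof.
  intros Hp Hd H.
  assert (K : forall n, lam n * (rsum y (S n) - rsum x (S n)) <= rsum (fun k => lam k * y k) (S n) - rsum (fun k => lam k * x k) (S n)).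
  { intros n. induction n as [|n IH].
    - simpl. lra.
    - set (P := rsum y (S n)) in *. set (P' := rsum x (S n)) in *.
      change (rsum y (S (S n))) with (P + y (S n)). change (rsum x (S (S n))) with (P' + x (S n)).
      set (W := rsum (fun k => lam k * y k) (S n)) in *. set (W' := rsum (fun k => lam k * x k) (S n)) in *.
      change (rsum (fun k => lam k * y k) (S (S n))) with (W + lam (S n) * y (S n)).
      change (rsum (fun k => lam k * x k) (S (S n))) with (W' + lam (S n) * x (S n)).
      pose proof (H (S n)) as HS. fold P P' in HS.
      assert (0 <= (lam n - lam (S n)) * (P - P')) by (apply Rmult_le_pos; [specialize (Hd n); lra|lra]). lra. }
  intros [|N]; [simpl; lra|]. specialize (K N). specialize (H (S N)).
  assert (0 <= lam N * (rsum y (S N) - rsum x (S N))) by (apply Rmult_le_pos; auto; lra). lra.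
Qed.

Lemma sum_n_m_rsum (a : nat -> R) N : sum_n_m a 1 N = rsum (fun k => a (S k)) N.
Proof.
  induction N as [|N IH].
  - rewrite sum_n_m_zero by lia. reflexivity.
  - destruct N as [|N].
    + rewrite sum_n_n. simpl. ring.
    + rewrite sum_n_Sm by lia. rewrite IH. reflexivity.
Qed.

Lemma sum_from1_le (a b : nat -> R) :
  (forall N, rsum (fun k => a (S k)) N <= 1 / 4 * rsum (fun k => b (S k)) N) ->
  Rbar_le (sum_from1 a) (Rbar_mult (Finite (1 / 4)) (sum_from1 b)).
Proof.
  intros H. unfold sum_from1. rewrite <- Lim_seq_scal_l. apply Lim_seq_le_loc.
  exists O. intros n _. rewrite !sum_n_m_rsum. apply H.
Qed.

(** With [n = k + 1] the weight is [(n + 1)^(t - 2) ((n + 1) / n)^2], a product of two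
    nonincreasing factors. *)
Lemma weight_nonincreasing (t : R) k : t <= 2 ->
  Rpower (INR (S (S k)) + 1) t / INR (S (S k)) ^ 2 <= Rpower (INR (S k) + 1) t / INR (S k) ^ 2.
Proof.
  intros Ht. rewrite (S_INR (S k)). set (n := INR (S k)).
  assert (Hn : 1 <= n) by (unfold n; rewrite S_INR; pose proof (pos_INR k); lra).
  assert (E : n + 1 + 1 = (n + 1) * ((n + 2) / (n + 1))) by (field; lra).
  assert (Hq : 1 < (n + 2) / (n + 1)) by (apply Rlt_div_r; lra).
  rewrite E, <- Rpower_mult_distr by lra.
  assert (P2 : Rpower ((n + 2) / (n + 1)) t <= ((n + 2) / (n + 1)) ^ 2).
  { rewrite <- (Rpower_pow 2) by lra. apply Rle_Rpower; [lra|]. simpl; lra. }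
  assert (P1 : 0 < Rpower (n + 1) t) by apply exp_pos.
  apply Rle_div_l; [apply pow_lt; lra|].
  replace (Rpower (n + 1) t / n ^ 2 * (n + 1) ^ 2) with (Rpower (n + 1) t * ((n + 1) / n) ^ 2) by (field; lra).
  apply Rmult_le_compat_l; [lra|]. eapply Rle_trans; [exact P2|]. apply pow_incr. split; [lra|].
  apply Rle_div_l; [lra|]. replace ((n + 1) / n * (n + 1)) with ((n + 1) * (n + 1) / n) by (field; lra).
  apply Rle_div_r; nra.
Qed.

(** Here [1 + z K''/K' = h(z)] exactly, that is, [w(z) = z]. *)
Lemma Kfun_janowski (A B : R) : -1 <= B -> B < A -> A <= 1 -> janowski_convex A B (Kfun A B).
Proof.
  intros HB HAB HA. assert (HB' : -1 <= B <= 1) by lra.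
  assert (H01 : Cmod 0 < 1) by (rewrite Cmod_0; lra).
  assert (HK : holo 1 (Kfun A B)) by now apply holo_Kfun.
  assert (D1 : forall z : C, Cmod z < 1 -> C_derive (Kfun A B) z = Cexp ((A - B)%R * log_coord B z)).
  { intros z Hz. apply cder_unique, cder_Kfun. now apply halfplane_disc. }
  assert (D2 : forall z : C, Cmod z < 1 -> C_derive (C_derive (Kfun A B)) z = ((A - B)%R * Cexp ((A - B)%R * log_coord B z) / (1 + B * z))%C).
  { intros z Hz. apply cder_unique.
    apply (cder_ext_near (fun z => Cexp ((A - B)%R * log_coord B z)) _ _ _ (1 - Cmod z)); [lra| |].
    - intros y Hy. symmetry. apply D1. pose proof (Cmod_triangle (y - z) z) as T.
      replace (y - z + z)%C with y in T by ring. lra.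
    - apply cder_expX. now apply halfplane_disc. }
  assert (Hh : holo 1 (fun z => (1 + A * z) / (1 + B * z))%C).
  { intros z Hz. eexists. apply cder_div.
    - now apply Cmod_1_plus_neq_0.
    - cder_auto.
    - cder_auto. }
  assert (Eq : forall z : C, Cmod z < 1 ->
     (1 + z * C_derive (C_derive (Kfun A B)) z / C_derive (Kfun A B) z)%C = ((1 + A * z) / (1 + B * z))%C).
  { intros z Hz. rewrite D1, D2 by auto. pose proof (Cmod_1_plus_neq_0 B z HB' Hz).
    pose proof (Cexp_neq_0 ((A - B)%R * log_coord B z)). rewrite RtoC_minus in *. field; auto. }
  split; [split; [exact HK|split]|split; [|split]].
  - apply Kfun_0.
  - rewrite D1 by auto. rewrite log_coord_0. replace ((A - B)%R * 0)%C with (RtoC 0) by ring. apply Cexp_0.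
  - intros z Hz. destruct (Hh z Hz) as [l Hl]. exists l.
    apply (cder_ext_near (fun z => (1 + A * z) / (1 + B * z))%C _ _ _ (1 - Cmod z)); [change (Cmod z < 1) in Hz; lra| |exact Hl].
    intros y Hy. symmetry. apply Eq. pose proof (Cmod_triangle (y - z) z) as T.
    replace (y - z + z)%C with y in T by ring. lra.
  - exact Hh.
  - exists (fun z => z). split; [|split; [auto|split; [reflexivity|exact Eq]]].
    intros z _. exists (RtoC 1). apply cder_id.
Qed.

Lemma Kfun_log_coef (A B : R) : -1 <= B -> B < A -> A <= 1 -> exists gam, log_coefficients (Kfun A B) gam.
Proof.
  intros HB HAB HA. assert (HB' : -1 <= B <= 1) by lra.
  assert (H01 : Cmod 0 < 1) by (rewrite Cmod_0; lra).
  pose proof (holo_divz 1 _ (holo_Kfun A B HB')) as HD. set (kap := divz (Kfun A B)) in *.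
  assert (K0 : kap 0%C = 1%C).
  { unfold kap. rewrite divz_0, (cder_unique _ _ _ (cder_Kfun A B 0 (halfplane_disc B 0 HB' H01))), log_coord_0.
    replace ((A - B)%R * 0)%C with (RtoC 0) by ring. apply Cexp_0. }
  destruct (holo_ccont 1 kap 0 HD H01 1 Rlt_0_1) as [d0 [Hd0 Hc]]. rewrite K0 in Hc.
  set (d := Rmin d0 1). assert (Hd : 0 < d) by (apply Rmin_glb_lt; lra).
  assert (Hd1 : d <= d0) by apply Rmin_l. assert (Hd2 : d <= 1) by apply Rmin_r. clearbody d.
  assert (S0 : forall z : C, (z - RtoC 0)%C = z) by (intros; ring).
  assert (Hre : forall z : C, Cmod z < d -> 0 < Re (kap z)).
  { intros z Hz. specialize (Hc z ltac:(rewrite S0; lra)). pose proof (re_le_Cmod (kap z - 1)) as T.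
    replace (Re (kap z - 1)) with (Re (kap z) - 1) in T by (destruct (kap z); simpl; ring).
    assert (T2 : Rabs (Re (kap z) - 1) < 1) by lra. apply Rabs_lt_between in T2. lra. }
  set (g := fun z => Clog (kap z)).
  assert (Hg : holo d g).
  { intros z Hz. destruct (HD z ltac:(lra)) as [l Hl]. eexists.
    apply (cder_comp Clog kap); [apply cder_Clog; auto|exact Hl]. }
  assert (g0 : g 0%C = 0%C).
  { unfold g. rewrite K0, <- Cexp_0. apply Clog_Cexp. simpl. rewrite Rabs_R0. pose proof PI_RGT_0; lra. }
  destruct (holo_pser d g (d / 2) Hg ltac:(lra)) as (b & M & _ & _ & Hb).
  assert (b0 : b O = 0%C).
  { rewrite <- g0. symmetry. apply pser_0. apply Hb. rewrite Cmod_0; lra. }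
  exists (fun n => (b n / 2)%C), g. split; [split; [exact g0|split]|].
  - apply locally_eps. exists d. split; auto. intros z Hz. rewrite S0 in Hz. exact (Hg z Hz).
  - apply locally'_eps. exists d. split; auto. intros z Hz Hz0. rewrite S0 in Hz.
    unfold g. rewrite Cexp_Clog by auto. unfold kap, divz. destruct (Ceq_dec z 0); [easy|].
    rewrite Kfun_0. replace (Kfun A B z - 0)%C with (Kfun A B z) by ring. reflexivity.
  - apply locally_eps. exists (d / 2). split; [lra|]. intros z Hz. rewrite S0 in Hz.
    apply has_expansion_pser. apply (pser_ext b); [|now apply Hb].
    intros [|n]; auto. field.
Qed.

(** Both sequences expand [z K' / K]. *)
Lemma Kfun_coef_eq (A B : R) (E gam : nat -> C) : -1 <= B -> B < A -> A <= 1 -> psi_coefficients A B E ->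
  log_coefficients (Kfun A B) gam -> forall k, E (S k) = (INR (S k) * (2 * gam (S k)))%C.
Proof.
  intros HB HAB HA HE Hgam k. assert (HB' : -1 <= B <= 1) by lra.
  assert (D1 : forall z : C, Cmod z < 1 -> C_derive (Kfun A B) z = Cexp ((A - B)%R * log_coord B z)).
  { intros z Hz. apply cder_unique, cder_Kfun. now apply halfplane_disc. }
  destruct (log_coef_series (Kfun A B) gam) as (r1 & Hr1 & S1); auto.
  - now apply holo_Kfun.
  - apply Kfun_0.
  - intros z Hz. rewrite D1 by auto. apply Cexp_neq_0.
  - destruct (psi_series A B E HB HAB HA HE) as (r2 & Hr2 & S2).
    pose proof (pser_coef_unique (fun n => match n with O => 1%C | S _ => E n end)
      (fun n => match n with O => 1%C | S k => (INR (S k) * (2 * gam (S k)))%C end)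
      (fun z => / Qfun A B z)%C (Rmin r1 r2)) as U.
    specialize (U ltac:(apply Rmin_glb_lt; lra)). refine (U _ (S k)).
    intros z Hz. pose proof (Rmin_l r1 r2). pose proof (Rmin_r r1 r2). split; [apply S2; lra|].
    destruct (S1 z ltac:(lra)) as [Dn P]. replace (/ Qfun A B z)%C with (C_derive (Kfun A B) z / divz (Kfun A B) z)%C; auto.
    rewrite D1 by lra. unfold Qfun. replace (- (A - B)%R * log_coord B z)%C with (- ((A - B)%R * log_coord B z))%C by ring.
    rewrite Cexp_opp. pose proof (Cexp_neq_0 ((A - B)%R * log_coord B z)). field; auto.
Qed.

Theorem theorem2p3 :
  forall (A B : R) (E : nat -> C),
    -1 <= B -> B < A -> A <= 1 ->
    psi_coefficients A B E ->
    (forall (f : C -> C) (gam : nat -> C),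
       janowski_convex A B f -> log_coefficients f gam ->
       Rbar_le
         (sum_from1 (fun n => INR n ^ 2 * Cmod (gam n) ^ 2))
         (Rbar_mult (Finite (1 / 4))
            (sum_from1 (fun n => Cmod (E n) ^ 2)))
       /\
       (forall t : R, t <= 2 ->
          Rbar_le
            (sum_from1 (fun n => Rpower (INR n + 1) t * Cmod (gam n) ^ 2))
            (Rbar_mult (Finite (1 / 4))
               (sum_from1 (fun n =>
                  Rpower (INR n + 1) t / INR n ^ 2 * Cmod (E n) ^ 2)))))
    /\
    (exists (f : C -> C) (gam : nat -> C),
       janowski_convex A B f /\ log_coefficients f gam /\
       sum_from1 (fun n => INR n ^ 2 * Cmod (gam n) ^ 2)
       = Rbar_mult (Finite (1 / 4))
           (sum_from1 (fun n => Cmod (E n) ^ 2))).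
Proof.
  intros A B E HB HAB HA HE. split.
  - intros f gam Hf Hgam. pose proof (coef_majorization A B E f gam HB HAB HA HE Hf Hgam) as Maj.
    split.
    + apply sum_from1_le. exact Maj.
    + intros t Ht. apply sum_from1_le. intros N.
      set (lam := fun k => Rpower (INR (S k) + 1) t / INR (S k) ^ 2).
      assert (Hn : forall k, INR (S k) <> 0) by (intros; apply not_0_INR; lia).
      rewrite (rsum_ext _ (fun k => lam k * (INR (S k) ^ 2 * Cmod (gam (S k)) ^ 2))).
      2:{ intros k _. unfold lam. field. apply Hn. }
      rewrite <- rsum_scal.
      rewrite (rsum_ext (fun k => 1 / 4 * (Rpower (INR (S k) + 1) t / INR (S k) ^ 2 * Cmod (E (S k)) ^ 2))
        (fun k => lam k * (1 / 4 * Cmod (E (S k)) ^ 2))) by (intros; unfold lam; ring).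
      apply abel_majorization.
      * intros k. unfold lam. left. apply Rdiv_lt_0_compat; [apply exp_pos|].
        apply pow_lt. apply lt_0_INR. lia.
      * intros k. now apply weight_nonincreasing.
      * intros M. rewrite rsum_scal. apply Maj.
  - destruct (Kfun_log_coef A B HB HAB HA) as [gam Hgam].
    exists (Kfun A B), gam. split; [now apply Kfun_janowski|]. split; [exact Hgam|].
    pose proof (Kfun_coef_eq A B E gam HB HAB HA HE Hgam) as Heq.
    unfold sum_from1. rewrite <- Lim_seq_scal_l. apply Lim_seq_ext. intros N.
    rewrite !sum_n_m_rsum, <- rsum_scal. apply rsum_ext. intros k _.
    rewrite Heq, !Cmod_mult, !Cmod_R, (Rabs_pos_eq 2), (Rabs_pos_eq (INR (S k))) by (try apply pos_INR; lra). field.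
Qed.
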